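(* Let $G$ be a finite-dimensional real vector space partially ordered by a closed and pointed convex cone $C\subset G$. Then the weakly $h^*$-monotone $\mathbb{R}^d$-valuations $\varphi:\mathcal{P}(\mathbb{R}^d)\to G$ are exactly the maps $c_1\chi+c_2\mathrm{vol}_d$ with $c_1,c_2\in C$, and $(c_1,c_2)\mapsto c_1\chi+c_2\mathrm{vol}_d$ is an isomorphism from $C\times C$ onto the cone of weakly $h^*$-monotone $\mathbb{R}^d$-valuations into $G$.
   Context: $\mathcal{P}(\mathbb{R}^d)$ is the set of all convex polytopes in $\mathbb{R}^d$ (including $\emptyset$); $\chi$ is the Euler characteristic ($\chi(P)=1$ for $P\ne\emptyset$, $\chi(\emptyset)=0$), $\mathrm{vol}_d$ the $d$-dimensional volume. The order is $x\preceq y$ iff $y-x\in C$. An $\mathbb{R}^d$-valuation is a map $\varphi:\mathcal{P}(\mathbb{R}^d)\to G$ with $\varphi(\emptyset)=0$, $\varphi(P\cup Q)+\varphi(P\cap Q)=\varphi(P)+\varphi(Q)$ whenever $P,Q,P\cup Q$ are polytopes, and $\varphi(t+P)=\varphi(P)$ for $t\in\mathbb{R}^d$. For an $r$-dimensional polytope $P$ there are unique $h_0,\dots,h_r\in G$ with $\varphi(nP)=\sum_{i=0}^rh_i\binom{n+r-i}{r}$ for all $n\in\mathbb{Z}_{\ge0}$; $h^\varphi_i(P)=h_i$ for $i\le r$ and $0$ for $r<i\le d$. $\varphi$ is weakly $h^*$-monotone if $\varphi(\{0\})\succeq0$ and $h^\varphi_i(P)\preceq h^\varphi_i(Q)$ for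 all $0\le i\le d$ and all polytopes $P\subseteq Q$ with $\dim P=\dim Q$. *)

(* Defs.v *)
From HB Require Import structures.
From mathcomp Require Import all_boot all_order all_algebra.
From mathcomp Require Import all_classical all_reals all_analysis.

Set Implicit Arguments.
Unset Strict Implicit.
Unset Printing Implicit Defensive.

Import Order.TTheory GRing.Theory Num.Theory.
Import numFieldNormedType.Exports.

Local Open Scope classical_set_scope.
Local Open Scope ring_scope.

Section Cones.
Context {R : realType}.

Definition convex_cone (V : lmodType R) (C : set V) : Prop :=
  [/\ C 0,
      forall x y, C x -> C y -> C (x + y)
    & forall (a : R) x, 0 <= a -> C x -> C (a *: x)].

Definition pointed_cone (V : lmodType R) (C : set V) : Prop :=
  forall x, C x -> C (- x) -> x = 0.

(* A [vectType] carries no topology: closedness is read in the coordinates of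
   a basis.  All bases give the same topology on G. *)
Definition closed_in_vect (G : vectType R) (C : set G) : Prop :=
  closed [set u : 'rV[R]_(\dim {:G}) |
    C (\sum_(i < \dim {:G}) u 0 i *: (vbasis {:G})`_i)].

Definition cone_le (V : lmodType R) (C : set V) (x y : V) : Prop := C (y - x).

Definition cone_isomorphism (U V : lmodType R) (A : set U) (B : set V)
    (f : U -> V) : Prop :=
  [/\ convex_cone A, convex_cone B, set_bij A B f,
      forall x y, A x -> A y -> f (x + y) = f x + f y
    & forall (a : R) x, 0 <= a -> A x -> f (a *: x) = a *: f x].

End Cones.

Section Polytopes.
Context {R : realType} {d : nat}.
Local Notation V := 'rV[R]_d.

Definition conv_hull (A : set V) : set V :=
  smallest (@convex_set R V) A.

Definition is_polytope (P : set V) : Prop :=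
  exists2 A : set V, finite_set A & P = conv_hull A.

End Polytopes.

Record polytope (R : realType) (d : nat) := Polytope {
  polytope_set :> set 'rV[R]_d;
  polytopeP : is_polytope polytope_set }.

Section PolytopeOps.
Context {R : realType} {d : nat}.
Local Notation V := 'rV[R]_d.
Implicit Types (A X : set V) (P Q : polytope R d).

Let aff (a : R) (t x : V) : V := t + a *: x.

Lemma convex_setP X : convex_set X <->
  forall x y (l : R), 0 <= l -> l <= 1 -> X x -> X y ->
    X (l *: x + (1 - l) *: y).
Proof.
split=> [cX x y l l0 l1 Xx Xy|cX].
  have := cX x y (Itv01 l0 l1); rewrite !inE => /(_ Xx Xy).
  by by [].
move=> x y l; rewrite !inE => Xx Xy.
exact: (cX x y l%:num).
Qed.

Lemma aff_conv a t l (x y : V) :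
  aff a t (l *: x + (1 - l) *: y) = l *: aff a t x + (1 - l) *: aff a t y.
Proof.
rewrite /aff !scalerDr !scalerA [RHS]addrACA -scalerDl subrKC scale1r.
by rewrite [a * l]mulrC [a * (1 - l)]mulrC.
Qed.

Lemma conv_hull_convex A : convex_set (conv_hull A).
Proof.
apply/convex_setP => x y l l0 l1 hx hy X [cX AX].
by move/convex_setP: (cX); apply => //; [exact: hx|exact: hy].
Qed.

Lemma conv_hull_aff a t A : aff a t @` conv_hull A = conv_hull (aff a t @` A).
Proof.
apply/seteqP; split=> [_ [x hx <-] X [/convex_setP cX AX]|x].
  apply: (hx (aff a t @^-1` X)); split; last by move=> y Ay; apply: AX; exists y.
  by apply/convex_setP => y z l l0 l1 Xy Xz /=; rewrite aff_conv; exact: cX.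
apply; split; last first.
  by move=> _ [y Ay <-]; exists y => // X [_]; apply.
apply/convex_setP => _ _ l l0 l1 [y hy <-] [z hz <-].
exists (l *: y + (1 - l) *: z); last by rewrite aff_conv.
by move/convex_setP: (@conv_hull_convex A); exact.
Qed.

Lemma is_polytope_aff a t P : is_polytope (aff a t @` P).
Proof.
have [A fA ->] := polytopeP P; exists (aff a t @` A); first exact: finite_image.
exact: conv_hull_aff.
Qed.

Lemma is_polytope_translate t P : is_polytope [set t + x | x in (P : set V)].
Proof.
have := is_polytope_aff 1 t P; congr is_polytope.
by apply: eq_imagel => x _; rewrite /aff scale1r.
Qed.

Lemma is_polytope_dilate (n : nat) P :
  is_polytope [set n%:R *: x | x in (P : set V)].
Proof.
have := is_polytope_aff n%:R 0 P; congr is_polytope.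
by apply: eq_imagel => x _; rewrite /aff add0r.
Qed.

Lemma is_polytope0 : is_polytope (set0 : set V).
Proof.
exists set0 => //; apply/seteqP; split=> // x.
by apply; split.
Qed.

Lemma is_polytope_origin : is_polytope [set (0 : V)].
Proof.
exists [set 0] => //; apply/seteqP; split=> [x -> X [_]|x]; first exact.
apply; split=> //; apply/convex_setP => _ _ l _ _ -> ->.
by rewrite !scaler0 addr0.
Qed.

Definition empty_polytope := Polytope is_polytope0.
Definition origin_polytope := Polytope is_polytope_origin.
Definition translate t P := Polytope (is_polytope_translate t P).
Definition dilate n P := Polytope (is_polytope_dilate n P).

(* Dimension of the smallest affine subspace containing P: [U] ranges over
   direction spaces. *)
Definition aff_dim P : nat :=
  \big[minn/d]_(k < d.+1 | `[< exists2 U : {vspace V}, \dim U = k &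
      forall x y, polytope_set P x -> polytope_set P y -> x - y \in U >]) k.

Definition pdim P : int :=
  if `[< (P : set V) = set0 >] then -1 else (aff_dim P)%:Z.

Definition euler_char P : R := if `[< (P : set V) = set0 >] then 0 else 1.

End PolytopeOps.

(* d-fold product of the Lebesgue measure on the line, i.e. the unfolding of
   the library's product measure, [(m1 \x m2) A = \int[m1]_x m2 (xsection A x)],
   starting from the counting measure on the one-point space. *)
Fixpoint lebesgue_vol {R : realType} (d : nat) : set 'rV[R]_d -> \bar R :=
  match d with
  | 0 => fun A => if `[< A 0 >] then 1%E else 0%E
  | d'.+1 => fun A =>
      (\int[@lebesgue_measure R]_x
         lebesgue_vol [set y : 'rV[R]_d' | A (row_mx (x%:M : 'rV[R]_1) y)])%E
  end.

Definition vol {R : realType} {d : nat} (P : polytope R d) : R :=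
  fine (lebesgue_vol P).

Section Valuations.
Context {R : realType} {d : nat} {G : vectType R}.
Implicit Types (phi : polytope R d -> G) (P Q : polytope R d).

(* [U] and [I] are the polytopes P `|` Q and P `&` Q. *)
Definition valuation phi : Prop :=
  [/\ phi empty_polytope = 0,
      forall P Q U I : polytope R d,
        (U : set 'rV[R]_d) = P `|` Q -> (I : set 'rV[R]_d) = P `&` Q ->
        phi U + phi I = phi P + phi Q
    & forall t P, phi (translate t P) = phi P].

Definition is_hstar_vector phi P (r : nat) (h : {ffun 'I_r.+1 -> G}) : Prop :=
  forall n : nat, phi (dilate n P) = \sum_(i < r.+1) h i *+ 'C(n + r - i, r).

(* For a valuation the vector exists and is unique (McMullen), so [xget]
   returns it; [insub] fails, giving 0, exactly when i > dim P. *)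
Definition hstar phi (i : nat) P : G :=
  oapp (xget 0 [set h | is_hstar_vector phi P h]) 0
       (insub i : option 'I_(aff_dim P).+1).

Definition weakly_hstar_monotone (C : set G) phi : Prop :=
  cone_le C 0 (phi origin_polytope) /\
  forall (i : nat) P Q, (i <= d)%N -> P `<=` Q -> pdim P = pdim Q ->
    cone_le C (hstar phi i P) (hstar phi i Q).

Definition weakly_hstar_monotone_valuations (C : set G) :
    set (polytope R d -> G) :=
  [set phi | valuation phi /\ weakly_hstar_monotone C phi].

Definition chi_vol (c : G * G) : polytope R d -> G :=
  fun P => euler_char P *: c.1 + vol P *: c.2.

End Valuations.

Arguments weakly_hstar_monotone_valuations {R} d {G} C.
Arguments chi_vol {R} d {G} c P.

(* Main.v *)
(* For an r-dimensional polytope P the function n |-> phi (n P) is a polynomial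
   of degree at most r (McMullen): every polytope can be cut by hyperplanes into
   simplices, and for the simplex [n >= x_1 >= ... >= x_r >= 0] cutting along the
   hyperplanes [x_j = 1] shows that the first difference has lower degree.

   In the basis 'C(n + r - i, r), a monomial n^j with 0 < j < r has coefficients
   of both signs.  Comparing P with its shrunken copies P / m and letting m grow,
   weak h*-monotonicity and pointedness of C kill these monomials, so
   phi (n P) = phi {0} + n^r a(P).  Comparing the prisms P + [0, w] and
   P + [0, 2 w] with their dilates by 2 gives a(P) = 0 for r < d.  Hence
   phi - phi {0} chi is simple, monotone and homogeneous of degree d; counting
   the unit cells that meet a large dilate of P, it is determined by its value on
   the unit cube, and so is a multiple of the volume.

   Conversely n^d has nonnegative coefficients (the Eulerian numbers) in the above
   basis, so c1 chi + c2 vol is weakly h*-monotone. *)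
From HB Require Import structures.
Require Import Defs.
From mathcomp Require Import all_boot all_order all_algebra.
From mathcomp Require Import all_classical all_reals all_analysis.
From mathcomp Require Import measurable_realfun ring lra zify.

Set Implicit Arguments.
Unset Strict Implicit.
Unset Printing Implicit Defensive.

Import Order.TTheory GRing.Theory Num.Theory.
Import numFieldNormedType.Exports.

Local Open Scope classical_set_scope.
Local Open Scope ring_scope.

(** * Convex hulls and half-space cuts *)

(** Everything therefore goes through one hyperplane cut at a time: a claim about P is deduced from
    its two halves and its section, which needs polytopes both as hulls and as intersections of
    half-spaces. The signs come from one fact: the coefficients of a polynomial in the basis of
    degree r sum to r! times its coefficient of n^r, hence to 0 for a lower monomial. Monotonicity
    at two suitable indices then puts a positive and a negative multiple of the same vector into C.
    Monotonicity of phi itself on full-dimensional polytopes uses the index 1 only, as h_1 = phi P -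
    (d + 1) phi {0}. Closedness of C serves two limits: shrinking P to a point, and refining the
    count of cells. In dimension 0 the valuations chi and vol coincide, so c1 and c2 are not
    determined by the valuation; hence the condition 0 < d on the isomorphism. *)

Section Hulls.
Context {R : realType}.

Definition affine_map (V W : lmodType R) (f : V -> W) : Prop :=
  forall x y (l : R), f (l *: x + (1 - l) *: y) = l *: f x + (1 - l) *: f y.

Section ConvexSums.
Context {d : nat}.
Local Notation V := 'rV[R]_d.

(* [y] lies in [w X], except that [0 X] is [{0}] even for empty [X]. *)
Definition cone_over (X : set V) (w : R) (y : V) : Prop :=
  (w = 0 /\ y = 0) \/ (0 < w /\ X (w^-1 *: y)).

Lemma cone_over1 X y : cone_over X 1 y -> X y.
Proof. by case=> [[/eqP]|[_]]; rewrite ?oner_eq0 // invr1 scale1r. Qed.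

Lemma cone_overZ X (w : R) a : 0 <= w -> (w != 0 -> X a) ->
  cone_over X w (w *: a).
Proof.
rewrite le_eqVlt => /orP[/eqP<- _|w0 Xa]; first by left; rewrite scale0r.
have w_neq0 : w != 0 by rewrite gt_eqF.
by right; rewrite scalerA mulVf// scale1r; split=> //; exact: Xa.
Qed.

(** Homogenised convexity: points with unnormalised weights can be added, and the total weight is
    compared with 1 only at the end, by [cone_over1]. *)
Lemma cone_overD X w y w' y' : convex_set X ->
  cone_over X w y -> cone_over X w' y' -> cone_over X (w + w') (y + y').
Proof.
move=> /convex_setP cX [[-> ->]|[w0 Xy]]; first by rewrite !add0r.
move=> [[-> ->]|[w'0 Xy']]; first by rewrite !addr0; right.
right; split; first exact: addr_gt0.
have ww0 : w + w' != 0 by rewrite gt_eqF// addr_gt0.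
have -> : (w + w')^-1 *: (y + y') =
    (w / (w + w')) *: (w^-1 *: y) + (1 - w / (w + w')) *: (w'^-1 *: y').
  rewrite !scalerA scalerDr; congr (_ *: _ + _ *: _); field; rewrite ?ww0 ?gt_eqF//.
apply: cX => //; first by rewrite divr_ge0 ?addr_ge0 ?ltW.
by rewrite ler_pdivrMr ?mul1r ?lerDl ?addr_gt0 ?ltW.
Qed.

Lemma cone_over_sum X (I : Type) (r : seq I) (w : I -> R) (y : I -> V) :
  convex_set X -> (forall i, cone_over X (w i) (y i)) ->
  cone_over X (\sum_(i <- r) w i) (\sum_(i <- r) y i).
Proof.
move=> cX h; elim/big_ind2: _ => //; first by left.
by move=> *; exact: cone_overD.
Qed.

Lemma sub_conv_hull (A : set V) : A `<=` conv_hull A.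
Proof. by move=> a Aa X [_]; apply. Qed.

Lemma conv_hull_sub (A X : set V) : convex_set X -> A `<=` X ->
  conv_hull A `<=` X.
Proof. by move=> cX AX x; apply; split. Qed.

Lemma conv_hullS (A B : set V) : A `<=` B -> conv_hull A `<=` conv_hull B.
Proof.
move=> AB; apply: conv_hull_sub; first exact: conv_hull_convex.
exact: subset_trans AB (@sub_conv_hull B).
Qed.

(** The weights are a function on the points themselves; as the list has no duplicates, indicator
    weights sum to 1. *)
Lemma conv_hull_seqP (s : seq V) x : uniq s -> conv_hull [set` s] x <->
  exists l : V -> R, [/\ forall a, 0 <= l a, \sum_(a <- s) l a = 1
     & x = \sum_(a <- s) l a *: a].
Proof.
move=> us; split=> [|[l [l0 l1 ->]]]; last first.
  apply: cone_over1; rewrite -l1.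
  rewrite big_seq [X in cone_over _ _ X]big_seq big_mkcond [X in cone_over _ _ X]big_mkcond.
  apply: cone_over_sum => [|a]; first exact: conv_hull_convex.
  case: ifP => sa; last by left.
  by apply: cone_overZ => // _; apply: sub_conv_hull.
suff : conv_hull [set` s] `<=` [set x | exists l : V -> R,
    [/\ forall a, 0 <= l a, \sum_(a <- s) l a = 1
      & x = \sum_(a <- s) l a *: a]] by apply.
apply: conv_hull_sub => [|a /= sa]; last first.
  exists (fun b => (b == a)%:R); split=> [b||].
  - exact: ler0n.
  - rewrite (bigD1_seq a)//= eqxx big1 ?addr0//.
    by move=> b /negbTE ->.
  - rewrite (bigD1_seq a)//= eqxx scale1r big1 ?addr0// => b /negbTE ->.
    by rewrite scale0r.
apply/convex_setP => y z t t0 t1 [l [l0 l1 ->]] [l' [l'0 l'1 ->]].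
exists (fun a => t * l a + (1 - t) * l' a); split=> [a||].
- by rewrite addr_ge0 ?mulr_ge0 ?subr_ge0.
- by rewrite big_split /= -!mulr_sumr l1 l'1 !mulr1 subrKC.
- rewrite !scaler_sumr -big_split; apply: eq_bigr => a _ /=.
  by rewrite [RHS]scalerDl !scalerA.
Qed.

Lemma is_polytopeP (P : set V) : is_polytope P <->
  exists2 s : seq V, uniq s & P = conv_hull [set` s].
Proof.
split=> [[A /finite_seqP[s ->] ->]|[s us ->]].
  exists (undup s); first exact: undup_uniq.
  by congr conv_hull; apply/seteqP; split=> x /=; rewrite mem_undup.
by exists [set` s] => //; exact: finite_seq.
Qed.

Lemma polytope_convex (P : set V) : is_polytope P -> convex_set P.
Proof. by move=> [A _ ->]; exact: conv_hull_convex. Qed.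

Lemma convex2 (P : set V) (l m : R) x y : convex_set P -> 0 <= l -> 0 <= m ->
  l + m = 1 -> P x -> P y -> P (l *: x + m *: y).
Proof.
move=> /convex_setP cP l0 m0 lm Px Py.
have -> : m = 1 - l by rewrite -lm addrC addKr.
by apply: cP => //; rewrite -lm lerDl.
Qed.

Definition dot (a x : V) : R := \sum_i a 0 i * x 0 i.
Definition aeval (h : V * R) (x : V) : R := dot h.1 x + h.2.

Lemma dotDr a x y : dot a (x + y) = dot a x + dot a y.
Proof. by rewrite -big_split; apply: eq_bigr => i _; rewrite mxE mulrDr. Qed.
Lemma dotZr a (l : R) x : dot a (l *: x) = l * dot a x.
Proof. by rewrite mulr_sumr; apply: eq_bigr => i _; rewrite mxE mulrCA. Qed.
Lemma dotDl a b x : dot (a + b) x = dot a x + dot b x.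
Proof. by rewrite -big_split; apply: eq_bigr => i _; rewrite mxE mulrDl. Qed.
Lemma dotZl (l : R) a x : dot (l *: a) x = l * dot a x.
Proof. by rewrite mulr_sumr; apply: eq_bigr => i _; rewrite mxE mulrA. Qed.
Lemma dot0r a : dot a 0 = 0.
Proof. by rewrite /dot big1// => i _; rewrite mxE mulr0. Qed.
Lemma dotNr a x : dot a (- x) = - dot a x.
Proof. by rewrite -scaleN1r dotZr mulN1r. Qed.
Lemma dotBr a x y : dot a (x - y) = dot a x - dot a y.
Proof. by rewrite dotDr dotNr. Qed.
Lemma dot_sumr (I : Type) (r : seq I) a (f : I -> V) :
  dot a (\sum_(i <- r) f i) = \sum_(i <- r) dot a (f i).
Proof. by elim/big_ind2: _ => [|x y x' y' <- <-|//]; rewrite ?dot0r ?dotDr. Qed.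
Lemma dot_deltal i x : dot (delta_mx 0 i) x = x 0 i.
Proof.
rewrite /dot (bigD1 i)//= !mxE !eqxx mul1r big1 ?addr0// => j ji.
by rewrite !mxE eqxx (negbTE ji) mul0r.
Qed.

Lemma aevalD h k x : aeval (h + k) x = aeval h x + aeval k x.
Proof. by rewrite /aeval dotDl addrACA. Qed.
Lemma aevalZ (l : R) h x : aeval (l *: h) x = l * aeval h x.
Proof. by rewrite /aeval dotZl mulrDr. Qed.
Lemma aevalN h x : aeval (- h) x = - aeval h x.
Proof. by rewrite -scaleN1r aevalZ mulN1r. Qed.
Lemma aevalB h k x : aeval (h - k) x = aeval h x - aeval k x.
Proof. by rewrite aevalD aevalN. Qed.
Lemma aeval0 h : aeval h 0 = h.2.
Proof. by rewrite /aeval dot0r add0r. Qed.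
Lemma aeval_conv h x y (l m : R) : l + m = 1 ->
  aeval h (l *: x + m *: y) = l * aeval h x + m * aeval h y.
Proof.
move=> lm; rewrite /aeval dotDr !dotZr !mulrDr [RHS]addrACA; congr (_ + _).
by rewrite -mulrDl lm mul1r.
Qed.
Lemma aevalDr h x y : aeval h (x + y) = aeval h x + dot h.1 y.
Proof. by rewrite /aeval dotDr addrAC. Qed.

Lemma aeval_sum h (s : seq V) (l : V -> R) : \sum_(a <- s) l a = 1 ->
  aeval h (\sum_(a <- s) l a *: a) = \sum_(a <- s) l a * aeval h a.
Proof.
move=> l1; rewrite /aeval dot_sumr.
under [RHS]eq_bigr do rewrite mulrDr; rewrite big_split -mulr_suml l1 mul1r.
by congr (_ + _); apply: eq_bigr => a _; rewrite dotZr.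
Qed.

Lemma aeval_convex h : convex_set [set x | 0 <= aeval h x].
Proof.
apply/convex_setP => x y l l0 l1 /= hx hy.
by rewrite aeval_conv ?subrKC// addr_ge0// mulr_ge0// subr_ge0.
Qed.

Lemma convex_setI (X Y : set V) : convex_set X -> convex_set Y ->
  convex_set (X `&` Y).
Proof.
move=> /convex_setP cX /convex_setP cY; apply/convex_setP.
by move=> x y l l0 l1 [? ?] [? ?]; split; [exact: cX|exact: cY].
Qed.

(* Pair each vertex on the positive side with each vertex on the negative side:
   the point x = \sum l_a a with h x >= 0 is a convex combination of the
   positive vertices and of the crossing points of the segments [a, b] with
   h = 0; the weight of the crossing point is proportional to
   l_a * l_b * (h a - h b). *)
Lemma polytope_cut (P : set V) (h : V * R) :
  is_polytope P -> is_polytope (P `&` [set x | 0 <= aeval h x]).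
Proof.
move=> /is_polytopeP[s us ->].
pose sp := [seq a <- s | 0 <= aeval h a].
pose sn := [seq a <- s | aeval h a < 0].
pose c a b := (aeval h a - aeval h b)^-1 *:
  ((- aeval h b) *: a + aeval h a *: b).
pose B := [set` sp ++ [seq c a b | a <- sp, b <- sn]].
exists B; first exact: finite_seq.
have subB : B `<=` conv_hull [set` s] `&` [set x | 0 <= aeval h x].
  move=> x; rewrite /B /= mem_cat => /orP[|/allpairsP[[a b]]].
    by rewrite mem_filter => /andP[hx sx]; split=> //; exact: sub_conv_hull.
  rewrite /= !mem_filter => -[/andP[ha sa] /andP[hb sb] ->].
  have D0 : 0 < aeval h a - aeval h b by rewrite subr_gt0 (lt_le_trans hb).
  rewrite /c scalerDr !scalerA.
  have e1 : (aeval h a - aeval h b)^-1 * - aeval h b +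
      (aeval h a - aeval h b)^-1 * aeval h a = 1.
    by rewrite -mulrDr [- _ + _]addrC mulVf ?gt_eqF.
  split; last first.
    rewrite /= aeval_conv// -!mulrA -mulrDr [X in _ * X](_ : _ = 0) ?mulr0//; last by ring.
  apply: (@convex2 (conv_hull [set` s])) => //; first exact: conv_hull_convex.
  - by apply: mulr_ge0; rewrite ?invr_ge0 ?oppr_ge0 ltW.
  - by apply: mulr_ge0; rewrite ?invr_ge0 ?(ltW D0).
  - exact: sub_conv_hull.
  - exact: sub_conv_hull.
apply/seteqP; split; last first.
  apply: conv_hull_sub => //; apply: convex_setI; first exact: conv_hull_convex.
  exact: aeval_convex.
move=> _ [/(conv_hull_seqP _ us)[l [l0 l1 ->]] /=].
rewrite aeval_sum//.
have splitE (W : lmodType R) (F : V -> W) :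
    \sum_(a <- s) F a = \sum_(a <- sp) F a + \sum_(a <- sn) F a.
  rewrite !big_filter (bigID (fun a => 0 <= aeval h a)) /=.
  by congr (_ + _); apply: eq_bigl => a; rewrite ltNge.
have spos a : a \in sp -> 0 <= aeval h a by rewrite mem_filter => /andP[].
have sneg a : a \in sn -> aeval h a < 0 by rewrite mem_filter => /andP[].
have cB : convex_set (conv_hull B) by exact: conv_hull_convex.
pose Sp := \sum_(a <- sp) l a * aeval h a.
pose Sn := \sum_(b <- sn) l b * - aeval h b.
have Sn0 : 0 <= Sn.
  by rewrite /Sn big_seq sumr_ge0// => b /sneg hb; rewrite mulr_ge0// oppr_ge0 ltW.
rewrite (splitE R^o) -/Sp => hS.
have {hS} SnSp : Sn <= Sp.
  rewrite -subr_ge0; move: hS; rewrite /Sn.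
  by under [X in _ -> 0 <= _ - X]eq_bigr do rewrite mulrN; rewrite sumrN opprK.
have coneP a : a \in sp -> conv_hull B a.
  by move=> sa; apply: sub_conv_hull; rewrite /B /= mem_cat sa.
have coneC a b : a \in sp -> b \in sn -> conv_hull B (c a b).
  move=> sa sb; apply: sub_conv_hull; rewrite /B /= mem_cat; apply/orP; right.
  exact: allpairs_f.
apply: cone_over1; rewrite -l1 (splitE R^o) (splitE V).
have cpos : cone_over (conv_hull B) (\sum_(a <- sp) l a) (\sum_(a <- sp) l a *: a).
  rewrite big_seq [X in cone_over _ _ X]big_seq big_mkcond [X in cone_over _ _ X]big_mkcond.
  by apply: cone_over_sum => // a; case: ifP => sa; [apply: cone_overZ; auto|left].
have [Sp0|Sp0] := eqVneq Sp 0.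
  have ln0 b : b \in sn -> l b = 0.
    move=> sb; have /eqP : Sn = 0 by apply/eqP; rewrite eq_le Sn0 -Sp0 SnSp.
    rewrite /Sn big_seq psumr_eq0 => [/allP/(_ b sb)|c' /sneg hc]; last first.
      by rewrite mulr_ge0// oppr_ge0 ltW.
    by rewrite sb mulf_eq0 oppr_eq0 (lt_eqF (sneg _ sb)) orbF => /eqP.
  have e1 : \sum_(a <- sn) l a = 0 by rewrite big_seq big1// => b /ln0.
  have e2 : \sum_(a <- sn) l a *: a = 0.
    by rewrite big_seq big1// => b /ln0 ->; rewrite scale0r.
  by rewrite e1 e2 !addr0.
have Sp_gt0 : 0 < Sp.
  rewrite lt_neqAle eq_sym Sp0 /= /Sp big_seq sumr_ge0// => a /spos ha.
  by rewrite mulr_ge0.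
pose w a b := l a * l b * (aeval h a - aeval h b) / Sp.
have ccross : cone_over (conv_hull B) (\sum_(a <- sp) \sum_(b <- sn) w a b)
    (\sum_(a <- sp) \sum_(b <- sn) w a b *: c a b).
  rewrite big_seq [X in cone_over _ _ X]big_seq big_mkcond [X in cone_over _ _ X]big_mkcond.
  apply: cone_over_sum => // a; case: ifP => sa; last by left.
  rewrite big_seq [X in cone_over _ _ X]big_seq big_mkcond [X in cone_over _ _ X]big_mkcond.
  apply: cone_over_sum => // b; case: ifP => sb; last by left.
  apply: cone_overZ; last by move=> _; exact: coneC.
  rewrite /w divr_ge0 ?(ltW Sp_gt0)// mulr_ge0 ?mulr_ge0//.
  by rewrite subr_ge0 (le_trans (ltW (sneg _ sb)))// spos.
(* Each positive vertex keeps the fraction [1 - Sn / Sp] of its weight; the fraction [Sn / Sp] is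
   spent on lifting the negative vertices to the hyperplane. *)
have k0 : 0 <= 1 - Sn / Sp by rewrite subr_ge0 ler_pdivrMr// mul1r.
have cpos' : cone_over (conv_hull B) ((1 - Sn / Sp) * \sum_(a <- sp) l a)
    ((1 - Sn / Sp) *: \sum_(a <- sp) l a *: a).
  rewrite mulr_sumr scaler_sumr.
  under [X in cone_over _ _ X]eq_bigr do rewrite scalerA.
  rewrite big_seq [X in cone_over _ _ X]big_seq big_mkcond [X in cone_over _ _ X]big_mkcond.
  apply: cone_over_sum => // a; case: ifP => sa; last by left.
  by apply: cone_overZ; [rewrite mulr_ge0|auto].
have crossE (W : lmodType R) (F : V -> W) :
    \sum_(a <- sp) \sum_(b <- sn)
       ((l a * l b * - aeval h b / Sp) *: F a + (l a * l b * aeval h a / Sp) *: F b) =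
    (Sn / Sp) *: (\sum_(a <- sp) l a *: F a) + \sum_(b <- sn) l b *: F b.
  under eq_bigr do rewrite big_split.
  rewrite big_split /=; congr (_ + _).
    rewrite scaler_sumr; apply: eq_bigr => a _.
    rewrite -scaler_suml scalerA; congr (_ *: _).
    by rewrite mulrAC /Sn !mulr_suml; apply: eq_bigr => b _; ring.
  rewrite exchange_big; apply: eq_bigr => b _ /=.
  rewrite -scaler_suml; congr (_ *: _).
  transitivity (Sp * (l b / Sp)); last by field.
  by rewrite /Sp mulr_suml; apply: eq_bigr => a _; rewrite -/Sp; ring.
have := cone_overD cB cpos' ccross; congr (cone_over _ _ _).
- have := crossE R^o (fun=> 1).
  under [X in _ = _ *: X + _]eq_bigr do rewrite [_ *: _]mulr1.
  under [X in _ = _ + X]eq_bigr do rewrite [_ *: _]mulr1.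
  rewrite (_ : \sum_(a <- sp) _ = \sum_(a <- sp) \sum_(b <- sn) w a b); last first.
    apply: eq_bigr => a _; apply: eq_bigr => b _; rewrite ![_ *: 1]mulr1 /w.
    by rewrite -mulrDl -mulrDr addrC.
  move=> ->; rewrite addrA; congr (_ + _).
  by rewrite [_ *: _]/(_ * _) -mulrDl subrK mul1r.
- have := crossE V id.
  rewrite (_ : \sum_(a <- sp) _ = \sum_(a <- sp) \sum_(b <- sn) w a b *: c a b); last first.
    apply: eq_big_seq => a sa; apply: eq_big_seq => b sb.
    rewrite /w /c scalerA scalerDr !scalerA.
    have D0 : aeval h a - aeval h b != 0.
      by rewrite gt_eqF// subr_gt0 (lt_le_trans (sneg _ sb))// spos.
    by congr (_ *: _ + _ *: _); field; rewrite D0 Sp0.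
  by move=> ->; rewrite addrA -scalerDl subrK scale1r.
Qed.

Lemma cone_overZr X w y (l : R) : 0 <= l -> cone_over X w y ->
  cone_over X (l * w) (l *: y).
Proof.
rewrite le_eqVlt => /orP[/eqP<- _|l0]; first by left; rewrite mul0r scale0r.
case=> [[-> ->]|[w0 Xy]]; first by left; rewrite mulr0 scaler0.
right; split; first exact: mulr_gt0.
have -> : (l * w)^-1 *: (l *: y) = w^-1 *: y; last by [].
by rewrite scalerA invfM mulrAC mulVf ?mul1r// gt_eqF.
Qed.

(** For convex [P], the union of the [t P] with [0 <= t <= 1], where [0 <= t] is forced by
    [cone_over]. The apex 0 is present even for empty [P]. *)
Definition pyramid (P : set V) : set V := [set x | exists2 t, t <= 1 & cone_over P t x].

Lemma pyramid_convex P : convex_set P -> convex_set (pyramid P).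
Proof.
move=> cP; apply/convex_setP => x y l l0 l1 [t t1 ct] [u u1 cu].
exists (l * t + (1 - l) * u).
  have := ler_wpM2l l0 t1; have l1' : 0 <= 1 - l by rewrite subr_ge0.
  by have := ler_wpM2l l1' u1; lra.
by apply: cone_overD => //; apply: cone_overZr => //; rewrite subr_ge0.
Qed.

Lemma sub_pyramid P : P `<=` pyramid P.
Proof. by move=> x Px; exists 1 => //; right; rewrite invr1 scale1r. Qed.

Lemma pyramid0 P : pyramid P 0.
Proof. by exists 0 => //; left. Qed.

Lemma conv_hull_origin (A : set V) : conv_hull (0 |` A) = pyramid (conv_hull A).
Proof.
apply/seteqP; split.
  apply: conv_hull_sub; first exact: pyramid_convex (@conv_hull_convex _ _ _).
  move=> x [->|Ax]; first exact: pyramid0.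
  by apply: sub_pyramid; exact: sub_conv_hull.
move=> x [t t1 [[_ ->]|[t0 hx]]].
  by apply: sub_conv_hull; left.
have -> : x = t *: (t^-1 *: x) + (1 - t) *: 0.
  by rewrite scaler0 addr0 scalerA mulfV ?scale1r// gt_eqF.
move/convex_setP: (@conv_hull_convex _ _ (0 |` A)); apply=> //; first exact: ltW.
  by apply: conv_hullS hx; right.
by apply: sub_conv_hull; left.
Qed.

Lemma polytope_pyramid P : is_polytope P -> is_polytope (pyramid P).
Proof.
move=> [A fA ->]; exists (0 |` A); first by rewrite finite_setU; split.
by rewrite conv_hull_origin.
Qed.

Lemma polytope_bounded (P : set V) : is_polytope P ->
  exists M : nat, forall x i, P x -> `|x 0 i| < M%:R.
Proof.
move=> /is_polytopeP[s us ->].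
pose M : R := \sum_(a <- s) \sum_i `|a 0 i|.
have M0 : 0 <= M by apply: sumr_ge0 => a _; apply: sumr_ge0.
exists (Num.bound M) => x i hx; apply: le_lt_trans (archi_boundP M0).
suff : conv_hull [set` s] `<=` [set x | `|x 0 i| <= M] by apply.
apply: conv_hull_sub => [|a /= sa].
  apply/convex_setP => y z l l0 l1 /= hy hz; rewrite !mxE.
  have l1' : 0 <= 1 - l by rewrite subr_ge0.
  apply: le_trans (ler_normD _ _) _; rewrite !normrM (ger0_norm l0) (ger0_norm l1').
  by have := ler_wpM2l l0 hy; have := ler_wpM2l l1' hz; lra.
rewrite /M (bigD1_seq a)//= (bigD1 i)//= -addrA lerDl.
by rewrite addr_ge0 ?sumr_ge0// => *; rewrite sumr_ge0.
Qed.

Lemma polytope_translate (P : set V) t : is_polytope P ->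
  is_polytope [set t + x | x in P].
Proof. by move=> pP; exact: (is_polytope_translate t (Polytope pP)). Qed.

Lemma polytope_dilate (P : set V) n : is_polytope P ->
  is_polytope [set n%:R *: x | x in P].
Proof. by move=> pP; exact: (is_polytope_dilate n (Polytope pP)). Qed.

Definition prism (P : set V) (w : V) : set V :=
  [set x | exists2 t, 0 <= t <= 1 & P (x - t *: w)].

Lemma prism_convex P w : convex_set P -> convex_set (prism P w).
Proof.
move=> /convex_setP cP; apply/convex_setP => x y l l0 l1 [t /andP[t0 t1] Px] [u /andP[u0 u1] Py].
have l1' : 0 <= 1 - l by rewrite subr_ge0.
exists (l * t + (1 - l) * u).
  rewrite addr_ge0 ?mulr_ge0//=.
  by have := ler_wpM2l l0 t1; have := ler_wpM2l l1' u1; lra.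
have -> : l *: x + (1 - l) *: y - (l * t + (1 - l) * u) *: w =
  l *: (x - t *: w) + (1 - l) *: (y - u *: w).
  by rewrite (scalerBr l) (scalerBr (1 - l)) !scalerA [(_ + _) *: w]scalerDl opprD addrACA.
exact: cP.
Qed.

Lemma polytope_prism P w : is_polytope P -> is_polytope (prism P w).
Proof.
move=> [A fA defP]; exists (A `|` [set w + x | x in A]).
  by rewrite finite_setU; split=> //; exact: finite_image.
apply/seteqP; split; last first.
  apply: conv_hull_sub.
    by apply: prism_convex; rewrite defP; exact: conv_hull_convex.
  move=> x [Ax|[a Aa <-]].
    exists 0; first by rewrite lexx ler01.
    by rewrite scale0r subr0 defP; exact: sub_conv_hull.
  exists 1; first by rewrite lexx ler01.
  by rewrite scale1r addrAC subrr add0r defP; exact: sub_conv_hull.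
move=> x [t /andP[t0 t1]]; rewrite defP => hx.
set B := _ `|` _.
have -> : x = t *: (w + (x - t *: w)) + (1 - t) *: (x - t *: w).
  rewrite scalerDr -addrA -scalerDl subrKC scale1r.
  by rewrite addrCA subrr addr0.
have cB := @conv_hull_convex _ _ B.
move/convex_setP: (cB); apply=> //; last first.
  by apply: conv_hullS hx => y; left.
suff : conv_hull A `<=` [set y | conv_hull B (w + y)] by apply.
apply: conv_hull_sub => [|a Aa]; last first.
  by apply: sub_conv_hull; right; exists a.
apply/convex_setP => y z l l0 l1 /= hy hz.
have -> : w + (l *: y + (1 - l) *: z) = l *: (w + y) + (1 - l) *: (w + z).
  by rewrite !scalerDr [RHS]addrACA -scalerDl subrKC scale1r.
by move/convex_setP: cB; apply.
Qed.

Lemma polytope_set0 : is_polytope (set0 : set V). Proof. exact: is_polytope0. Qed.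
Lemma polytope_set1 (x : V) : is_polytope [set x].
Proof.
have := polytope_translate x (@is_polytope_origin R d); congr is_polytope.
by rewrite image_set1 addr0.
Qed.

End ConvexSums.

Lemma conv_hull_image (k d : nat) (f : 'rV[R]_k -> 'rV[R]_d) A :
  affine_map f -> f @` conv_hull A = conv_hull (f @` A).
Proof.
move=> af; apply/seteqP; split=> [_ [x hx <-] Y [/convex_setP cY AY]|x].
  apply: (hx (f @^-1` Y)); split; last by move=> y Ay; apply: AY; exists y.
  by apply/convex_setP => y z l l0 l1 Xy Xz /=; rewrite af; exact: cY.
apply; split; last first.
  by move=> _ [y Ay <-]; exists y => //; exact: sub_conv_hull.
apply/convex_setP => _ _ l l0 l1 [y hy <-] [z hz <-].
exists (l *: y + (1 - l) *: z); last by rewrite af.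
by move/convex_setP: (@conv_hull_convex _ _ A); exact.
Qed.

Lemma polytope_affine_image (k d : nat) (f : 'rV[R]_k -> 'rV[R]_d) X :
  affine_map f -> is_polytope X -> is_polytope (f @` X).
Proof.
move=> af [A fA ->]; exists (f @` A); first exact: finite_image.
exact: conv_hull_image.
Qed.

Lemma affine_translate d (t : 'rV[R]_d) : affine_map (fun x => t + x).
Proof.
by move=> x y l; rewrite !scalerDr [RHS]addrACA -scalerDl subrKC scale1r.
Qed.

End Hulls.

(** * Half-space representation *)

Section HRepresentation.
Context {R : realType} {d : nat}.
Local Notation V := 'rV[R]_d.

Definition hpoly (s : seq (V * R)) : set V :=
  [set x | forall h, h \in s -> 0 <= aeval h x].

Lemma hpoly_cons h s : hpoly (h :: s) = [set x | 0 <= aeval h x] `&` hpoly s.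
Proof.
apply/seteqP; split=> x.
  by move=> hx; split=> [|k ks]; apply: hx; rewrite inE ?eqxx ?ks ?orbT.
by move=> [hx sx] k; rewrite inE => /orP[/eqP->|/sx].
Qed.

Lemma hpoly_cat s r : hpoly (s ++ r) = hpoly s `&` hpoly r.
Proof.
apply/seteqP; split=> x.
  by move=> hx; split=> h hs; apply: hx; rewrite mem_cat hs ?orbT.
by move=> [sx rx] h; rewrite mem_cat => /orP[/sx|/rx].
Qed.

Lemma bounded_ray (P : set V) p x : is_polytope P ->
  (forall n : nat, P (p + n%:R *: x)) -> x = 0.
Proof.
move=> /polytope_bounded[M PM] Px; apply/rowP => i; rewrite mxE.
apply/eqP; apply: contraT => xi0.
have xi_gt0 : 0 < `|x 0 i| by rewrite normr_gt0.
have y0 : 0 <= (M%:R + `|p 0 i|) / `|x 0 i| by rewrite divr_ge0 ?addr_ge0.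
have := archi_boundP y0; set n := Num.bound _.
rewrite ltr_pdivrMr// => h1.
have := PM _ i (Px n); rewrite !mxE.
have := ler_normB (p 0 i + n%:R * x 0 i) (p 0 i).
rewrite addrAC subrr add0r normrM [`|n%:R|]ger0_norm ?ler0n//.
by move: h1; lra.
Qed.

(** One-dimensional core of the elimination of a variable. Either list may be empty, so the bounds
    are built up by induction instead of taking extrema. *)
Lemma separating_point (L U : seq R) :
  (forall a b, a \in L -> b \in U -> a <= b) ->
  exists t, (forall a, a \in L -> a <= t) /\ (forall b, b \in U -> t <= b).
Proof.
elim: L => [_|a L IH LU].
  elim: U => [|b U [t [_ tU]]]; first by exists 0.
  exists (Num.min b t); split=> // c; rewrite inE => /orP[/eqP->|/tU tc].
    by rewrite ge_min lexx.
  by rewrite ge_min tc orbT.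
have [|t [tL tU]] := IH.
  by move=> c b cL; apply: LU; rewrite inE cL orbT.
exists (Num.max a t); split=> [c|b bU].
  rewrite inE => /orP[/eqP->|/tL ct]; first by rewrite le_max lexx.
  by rewrite le_max ct orbT.
by rewrite ge_max tU// LU// inE eqxx.
Qed.

(** An entry [(h, c)] is the constraint [aeval h x + t * c >= 0]. Entries with [c > 0] bound [t]
    from below, those with [c < 0] from above; eliminating [t] means that every lower bound is at
    most every upper bound. *)
Lemma fourier_motzkin (S : seq ((V * R) * R)) : exists r, hpoly r =
  [set x | exists t, forall k, k \in S -> 0 <= aeval k.1 x + t * k.2].
Proof.
exists ([seq k.1 | k <- S & k.2 == 0] ++
  [seq k.2 *: l.1 - l.2 *: k.1 | k <- [seq k <- S | 0 < k.2],
                                  l <- [seq l <- S | l.2 < 0]]).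
rewrite hpoly_cat; apply/seteqP; split=> x; last first.
  move=> [t ht]; split=> [h /mapP[k]|h /allpairsP[[k l]]].
    rewrite mem_filter => /andP[/eqP k0 /ht]; rewrite k0 mulr0 addr0.
    by move=> h0 ->.
  rewrite !mem_filter /= => -[/andP[k0 /ht hk] /andP[l0 /ht hl] ->].
  rewrite aevalB !aevalZ.
  have := mulr_ge0 (ltW k0) hl; have l0' : 0 <= - l.2 by rewrite oppr_ge0 ltW.
  have := mulr_ge0 l0' hk; lra.
move=> [hz hpn].
have [|t [tL tU]] := @separating_point
   [seq - aeval k.1 x / k.2 | k <- [seq k <- S | 0 < k.2]]
   [seq aeval l.1 x / - l.2 | l <- [seq l <- S | l.2 < 0]].
  move=> _ _ /mapP[k kS ->] /mapP[l lS ->].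
  have := hpn _ (allpairs_f (fun k l => k.2 *: l.1 - l.2 *: k.1) kS lS).
  move: kS lS; rewrite !mem_filter => /andP[k0 _] /andP[l0 _].
  rewrite aevalB !aevalZ => h.
  rewrite ler_pdivrMr// mulrAC ler_pdivlMr ?oppr_gt0//; lra.
exists t => k kS; have [k0|k0|k0] := ltgtP k.2 0.
- have /tU : aeval k.1 x / - k.2 \in [seq aeval l.1 x / - l.2 | l <- [seq l <- S | l.2 < 0]].
    by apply/mapP; exists k => //; rewrite mem_filter k0.
  by rewrite ler_pdivlMr ?oppr_gt0//; lra.
- have /tL : - aeval k.1 x / k.2 \in [seq - aeval k.1 x / k.2 | k <- [seq k <- S | 0 < k.2]].
    by apply/mapP; exists k => //; rewrite mem_filter k0.
  by rewrite ler_pdivrMr//; lra.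
- rewrite k0 mulr0 addr0; apply: hz; apply/mapP; exists k => //.
  by rewrite mem_filter k0 eqxx.
Qed.

Lemma hpoly_translate s t : exists r, [set t + x | x in hpoly s] = hpoly r.
Proof.
exists [seq (h.1, h.2 - dot h.1 t) | h <- s].
have E (h : V * R) x : aeval (h.1, h.2 - dot h.1 t) (t + x) = aeval h x.
  by rewrite /aeval /= dotDr; ring.
apply/seteqP; split=> [_ [x hx <-] _ /mapP[h hs ->]|x hx].
  by rewrite E; exact: hx.
exists (x - t); last by rewrite subrKC.
by move=> h hs; rewrite -E subrKC; apply: hx; apply/mapP; exists h.
Qed.

(* The pyramid is the union of the [t P], [0 <= t <= 1]; eliminate [t]. *)
Lemma hpoly_pyramid P s : is_polytope P -> P !=set0 -> P = hpoly s ->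
  exists r, pyramid P = hpoly r.
Proof.
move=> pP [p Pp] defP.
have [r rE] := fourier_motzkin
  (((0, 0), 1) :: ((0, 1), -1) :: [seq ((h.1, 0), h.2) | h <- s]).
exists r; rewrite rE.
(* At [t = 0] the homogenised constraints describe the recession cone of [P], which is [{0}] because
   [P] is bounded; this agrees with the degenerate case of [cone_over]. *)
have coneE t x : 0 <= t ->
    cone_over P t x <-> (forall h, h \in s -> 0 <= dot h.1 x + t * h.2).
  rewrite le_eqVlt => /orP[/eqP<-|t0]; split.
  - move=> [[_ ->]|[]]; last by rewrite ltxx.
    by move=> h _; rewrite dot0r mul0r addr0.
  - move=> hx; left; split=> //; apply: (bounded_ray (p := p) pP) => n.
    rewrite defP => h hs; rewrite aevalDr dotZr addr_ge0//.
      by move: Pp; rewrite defP; exact.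
    by rewrite mulr_ge0//; have := hx h hs; rewrite mul0r addr0.
  - move=> [[t00 _]|[_]]; first by move: t0; rewrite t00 ltxx.
    rewrite defP => hx h /hx; rewrite /aeval dotZr => h0.
    have := mulr_ge0 (ltW t0) h0; rewrite mulrDr mulrA mulfV ?mul1r// gt_eqF//.
  - move=> hx; right; split=> //; rewrite defP => h /hx h0; rewrite /aeval dotZr.
    have ti : 0 <= t^-1 by rewrite invr_ge0 ltW.
    by have := mulr_ge0 ti h0; rewrite mulrDr mulrA mulVf ?mul1r// gt_eqF.
have z x : aeval (0, 0) x = 0 :> R.
  by rewrite /aeval /dot /= big1 ?addr0// => i _; rewrite mxE mul0r.
have o x : aeval (0, 1) x = 1 :> R.
  by rewrite /aeval /dot /= big1 ?add0r// => i _; rewrite mxE mul0r.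
apply/seteqP; split=> x [t].
  move=> t1 ct; have t0 : 0 <= t by case: ct => [[->]|[/ltW]].
  exists t => k; rewrite !inE => /or3P[/eqP->|/eqP->|/mapP[h hs ->]] /=.
  - by rewrite z mulr1 add0r.
  - by rewrite o mulrN1 subr_ge0.
  - by rewrite {1}/aeval /= addr0; move/(coneE _ _ t0): ct; apply.
move=> ht; have t0 : 0 <= t.
  by have := ht ((0, 0), 1); rewrite inE eqxx /= z mulr1 add0r; apply.
exists t.
  by have := ht ((0, 1), -1); rewrite !inE eqxx orbT /= o mulrN1 subr_ge0; apply.
apply/(coneE _ _ t0) => h hs.
have := ht ((h.1, 0), h.2); rewrite !inE /= {1}/aeval addr0; apply.
by apply/orP; right; apply/orP; right; apply/mapP; exists h.
Qed.

Lemma hpoly_set1 (v : V) : exists r, [set v] = hpoly r.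
Proof.
exists ([seq (delta_mx 0 i, - v 0 i) | i <- enum 'I_d] ++
        [seq (- delta_mx 0 i, v 0 i) | i <- enum 'I_d]).
rewrite hpoly_cat; apply/seteqP; split=> x.
  move=> ->; split=> h /mapP[i _ ->]; rewrite /aeval /=.
    by rewrite dot_deltal subrr.
  by rewrite -scaleN1r dotZl dot_deltal mulN1r addNr.
move=> [h1 h2]; apply/rowP => i; apply/eqP; rewrite eq_le.
have := h1 (delta_mx 0 i, - v 0 i) (map_f _ (mem_enum _ i)).
have := h2 (- delta_mx 0 i, v 0 i) (map_f (fun i => (- delta_mx 0 i, v 0 i)) (mem_enum _ i)).
rewrite /aeval /= -scaleN1r dotZl dot_deltal; lra.
Qed.

(** Induction on the vertices: after translating the new vertex to the origin, the hull is a pyramid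
    over the previous one. An empty previous hull is treated apart, since [hpoly_pyramid] needs a
    point. *)
Lemma polytope_hpoly (P : set V) : is_polytope P -> exists s, P = hpoly s.
Proof.
move=> /is_polytopeP[s _ ->] {P}; elim: s => [|v s [r IH]].
  exists [:: (0, -1)]; apply/seteqP; split=> x.
    by move=> /(_ set0); case; split=> //; exact: convex_set0.
  move/(_ (0, -1)); rewrite inE eqxx => /(_ isT).
  rewrite /aeval /dot big1 => [|i _]; last by rewrite mxE mul0r.
  by rewrite add0r oppr_ge0 ler10.
have [->|s0] := eqVneq s [::].
  have [t tE] := hpoly_set1 v; exists t; rewrite -tE.
  have := polytope_set1 v => /polytope_convex cv.
  apply/seteqP; split; first by apply: conv_hull_sub => // x; rewrite /= inE => /eqP.
  by move=> x ->; apply: sub_conv_hull; rewrite /= inE.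
have -> : [set` v :: s] = [set v + x | x in 0 |` [set - v + a | a in [set` s]]].
  apply/seteqP; split=> x /=; rewrite inE.
    move=> /orP[/eqP->|sx]; first by exists 0; [left|rewrite addr0].
    exists (- v + x); last by rewrite addrA subrr add0r.
    by right; exists x.
  move=> [_ [->|[a /= sa <-]] <-]; first by rewrite addr0 eqxx.
  by rewrite addrA subrr add0r sa orbT.
rewrite -conv_hull_image; last exact: affine_translate.
rewrite conv_hull_origin -conv_hull_image; last exact: affine_translate.
have [r' r'E] := hpoly_translate r (- v).
rewrite -IH in r'E; have [||t ->] := hpoly_pyramid _ _ r'E.
- apply: polytope_translate; apply/is_polytopeP; exists (undup s); first exact: undup_uniq.
  by congr conv_hull; apply/seteqP; split=> x /=; rewrite mem_undup.
- case: s s0 {IH r'E} => // a s _; exists (- v + a); exists a => //.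
  by apply: sub_conv_hull; rewrite /= inE eqxx.
exact: hpoly_translate.
Qed.

End HRepresentation.

(** * Dissection into simplices *)

Section CutInduction.
Context {R : realType} {d : nat}.
Local Notation V := 'rV[R]_d.

Definition hge (h : V * R) : set V := [set x | 0 <= aeval h x].
Definition heq (h : V * R) : set V := [set x | aeval h x = 0].

Lemma hge_hgeN h : hge h `&` hge (- h) = heq h.
Proof.
apply/seteqP; split=> x; rewrite /hge /heq /= aevalN oppr_ge0.
  by move=> [h0 h1]; apply/eqP; rewrite eq_le h1 h0.
by move=> ->; rewrite lexx.
Qed.

Lemma hge_setU h : hge h `|` hge (- h) = setT.
Proof.
apply/seteqP; split=> // x _; rewrite /hge /= aevalN oppr_ge0.
by case/orP: (le_total 0 (aeval h x)); [left|right].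
Qed.

Lemma polytope_hge (P : set V) h : is_polytope P -> is_polytope (P `&` hge h).
Proof. exact: polytope_cut. Qed.

Lemma polytope_heq (P : set V) h : is_polytope P -> is_polytope (P `&` heq h).
Proof. by move=> pP; rewrite -hge_hgeN setIA; do 2 apply: polytope_hge. Qed.

(* [orthoscheme [:: w1; ...; wk]] is the simplex of all
   [x1 w1 + ... + xk wk] with [1 >= x1 >= ... >= xk >= 0]. *)
Fixpoint orthoscheme (ws : seq V) : set V :=
  if ws is w :: ws' then pyramid [set w + y | y in orthoscheme ws'] else [set 0].

Lemma orthoscheme0 ws : orthoscheme ws 0.
Proof. by case: ws => [|w ws] //; exact: pyramid0. Qed.

(** The section by the hyperplane is among the premises because inclusion-exclusion for a cut
    involves it. *)
Definition cut_closed (Pi : set V -> Prop) : Prop :=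
  forall P h, is_polytope P -> Pi (P `&` hge h) -> Pi (P `&` hge (- h)) ->
    Pi (P `&` heq h) -> Pi P.

Lemma pyramidI_hge (F : set V) g : g.2 = 0 ->
  pyramid F `&` hge g = pyramid (F `&` hge g).
Proof.
move=> g0; have gE (t : R) x : aeval g (t *: x) = t * aeval g x.
  by rewrite /aeval g0 !addr0 dotZr.
apply/seteqP; split=> [x [[t t1 cx] gx]|x [t t1]].
  exists t => //; case: cx => [|[t0 Fx]]; first by left.
  by right; split=> //; split=> //; rewrite /hge /= gE mulr_ge0// invr_ge0 ltW.
move=> [[t0 ->]|[t0 [Fx gx]]]; split.
- exact: pyramid0.
- by rewrite /hge /= aeval0 g0.
- by exists t => //; right.
- rewrite /hge /=; have -> : x = t *: (t^-1 *: x).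
    by rewrite scalerA mulfV ?scale1r// gt_eqF.
  by rewrite gE mulr_ge0// ltW.
Qed.

Lemma pyramidI_heq (F : set V) g : g.2 = 0 ->
  pyramid F `&` heq g = pyramid (F `&` heq g).
Proof.
move=> g0; rewrite -hge_hgeN setIA pyramidI_hge// pyramidI_hge /= ?g0 ?oppr0//.
by rewrite -setIA.
Qed.

Lemma pyramid_set0 : pyramid (set0 : set V) = [set 0].
Proof.
apply/seteqP; split=> [x [t _ [[]|[]]] //|x ->]; exact: pyramid0.
Qed.

(** A ray from 0 through a nonzero point of the bounded set [P] must leave [P], and it can do so
    only across the hyperplane [heq h]. *)
Lemma pyramid_base (P : set V) h : is_polytope P -> h.2 = 1 ->
  (forall x, P x -> 0 <= aeval h x) ->
  (forall x (t : R), P x -> 0 <= t -> 0 <= aeval h (t *: x) -> P (t *: x)) ->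
  P 0 -> P = pyramid (P `&` heq h).
Proof.
move=> pP h1 Ph Pt P0; apply/seteqP; split=> [x Px|x [t t1]]; last first.
  move=> [[_ ->]//|[t0 [Px hx]]].
  have -> : x = t *: (t^-1 *: x) by rewrite scalerA mulfV ?scale1r// gt_eqF.
  apply: Pt => //; first exact: ltW.
  move: hx; rewrite /heq /= /aeval h1 !dotZr mulrA mulfV ?gt_eqF// mul1r => hx.
  have -> : dot h.1 x = - t; last by rewrite addrC subr_ge0.
  have : t * (t^-1 * dot h.1 x + 1) = 0 by rewrite hx mulr0.
  by rewrite mulrDr mulrA mulfV ?gt_eqF// mul1r mulr1 => /eqP; rewrite addr_eq0 => /eqP.
have hE (t : R) : aeval h (t *: x) = t * dot h.1 x + 1 by rewrite /aeval h1 dotZr.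
have [m0|m0] := leP 0 (dot h.1 x).
  have -> : x = 0.
    apply: (bounded_ray (p := 0) pP) => n; rewrite add0r; apply: Pt => //.
    by rewrite hE addr_ge0// mulr_ge0.
  exact: pyramid0.
exists (- dot h.1 x).
  by have := Ph _ Px; rewrite /aeval h1; lra.
right; split; first by rewrite oppr_gt0.
have e : aeval h ((- dot h.1 x)^-1 *: x) = 0.
  by rewrite hE invrN mulNr mulVf ?addNr// lt_eqF.
split=> //; apply: Pt => //; first by rewrite invr_ge0 oppr_ge0 ltW.
by rewrite e.
Qed.

(* A bounded intersection of half-spaces containing 0 has constraints
   [m <= 0] and [m <= 1], m linear.  Cutting along [m1 = m2] makes one
   of the two constraints [m1 <= 1], [m2 <= 1] redundant on each side; with a
   single constraint [m <= 1] left the polytope is a pyramid with apex 0 over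
   its face [m = 1], to which induction on the dimension applies. *)
Lemma cut_induction (U : {vspace V}) (Pi : set V -> Prop) :
  Pi set0 ->
  (forall p ws, free ws -> {subset ws <= U} ->
     Pi [set p + y | y in orthoscheme ws]) ->
  cut_closed Pi ->
  forall P, is_polytope P -> (forall x y, P x -> P y -> x - y \in U) -> Pi P.
Proof.
have [n] := ubnP (\dim U); elim: n => // n IH in U Pi *.
rewrite ltnS => dimU Pi0 PiS PiC P pP PU.
have [->//|/set0P[p0 Pp0]] := eqVneq P set0.
pose Q := [set - p0 + x | x in P].
have QP : P = [set p0 + x | x in Q].
  apply/seteqP; split=> [x Px|_ [_ [y Py <-] <-]]; last by rewrite addrA subrr add0r.
  by exists (- p0 + x); [exists x|rewrite addrA subrr add0r].
have pQ : is_polytope Q by exact: polytope_translate.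
have Q0 : Q 0 by exists p0 => //; rewrite addNr.
have QU x : Q x -> x \in U.
  by move=> [y Py <-]; rewrite addrC; exact: PU.
pose Pi1 X := Pi [set p0 + x | x in X].
suff : Pi1 Q by rewrite /Pi1 -QP.
have Pi1S p ws : free ws -> {subset ws <= U} ->
    Pi1 [set p + y | y in orthoscheme ws].
  move=> fw wU; have := PiS (p0 + p) ws fw wU; congr Pi; apply/seteqP; split.
    by move=> _ [y yw <-]; exists (p + y); [exists y|rewrite addrA].
  by move=> _ [_ [y yw <-] <-]; exists y; rewrite ?addrA.
have Pi1z : Pi1 [set 0].
  have := Pi1S 0 [::]; rewrite /= image_set1 addr0; apply=> //.
  by rewrite /free span_nil dimv0.
have Pi1C : cut_closed Pi1.
  move=> X h pX; pose k : V * R := (h.1, h.2 - dot h.1 p0).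
  have kE x : aeval k (p0 + x) = aeval h x by rewrite /aeval /= dotDr; ring.
  have e1 : [set p0 + x | x in X `&` hge h] = [set p0 + x | x in X] `&` hge k.
    apply/seteqP; split.
      by move=> _ [x [Xx hx] <-]; split; [exists x|rewrite /hge /= kE].
    by move=> _ [[x Xx <-]]; rewrite /hge /= kE => hx; exists x.
  have e2 : [set p0 + x | x in X `&` hge (- h)] =
      [set p0 + x | x in X] `&` hge (- k).
    apply/seteqP; split.
      by move=> _ [x [Xx hx] <-]; split; [exists x|move: hx; rewrite /hge /= !aevalN kE].
    by move=> _ [[x Xx <-]]; rewrite /hge /= aevalN kE -aevalN => hx; exists x.
  have e3 : [set p0 + x | x in X `&` heq h] = [set p0 + x | x in X] `&` heq k.
    apply/seteqP; split.
      by move=> _ [x [Xx hx] <-]; split; [exists x|rewrite /heq /= kE].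
    by move=> _ [[x Xx <-]]; rewrite /heq /= kE => hx; exists x.
  rewrite /Pi1 e1 e2 e3; apply: PiC; exact: polytope_translate.
(* As 0 lies in [Q], all constant terms are nonnegative: [s0] collects the linear constraints, [s1]
   those scaled to constant term 1. The induction is on the number of the latter. *)
suff core : forall k s1 s0 X, size s1 = k -> is_polytope X ->
    (forall x, X x -> x \in U) -> (forall h, h \in s0 -> h.2 = 0) ->
    (forall h, h \in s1 -> h.2 = 1) -> X = hpoly (s0 ++ s1) -> Pi1 X.
  have [s sE] := polytope_hpoly pQ.
  have s0 h : h \in s -> 0 <= h.2 by move=> hs; move: Q0; rewrite sE => /(_ h hs); rewrite aeval0.
  apply: (core (size [seq h <- s | h.2 != 0]) [seq h.2^-1 *: h | h <- s & h.2 != 0] [seq h <- s | h.2 == 0]) => //.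
  - by rewrite size_map.
  - by move=> h; rewrite mem_filter => /andP[/eqP].
  - by move=> _ /mapP[h + ->]; rewrite mem_filter => /andP[h0 _] /=; exact: mulVf.
  - rewrite sE hpoly_cat; apply/seteqP; split=> x.
      move=> hx; split=> h; first by rewrite mem_filter => /andP[_ /hx].
      move=> /mapP[k']; rewrite mem_filter => /andP[k0 /[dup] /s0 k'0 /hx] h0 ->.
      by rewrite aevalZ mulr_ge0// invr_ge0.
    move=> [h1 h2] h hs; have [h0|h0] := eqVneq h.2 0.
      by apply: h1; rewrite mem_filter h0 eqxx.
    have := h2 (h.2^-1 *: h).
    rewrite (_ : _ \in _); last by apply/mapP; exists h; rewrite ?mem_filter ?h0.
    by move=> /(_ isT); rewrite aevalZ pmulr_rge0// invr_gt0 lt_def h0 s0//.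
elim=> [|k IHk] s1 s0 X.
  move=> /size0nil-> pX XU s0z _; rewrite cats0 => XE.
  (* With linear constraints only, [X] is a bounded cone. *)
  have -> // : X = [set 0].
  have X0 : X 0 by rewrite XE => h /s0z; rewrite aeval0 => ->.
  apply/seteqP; split=> [x Xx|x ->//]; apply: (bounded_ray (p := 0) pX) => m.
  rewrite add0r XE => h hs; have := Xx; rewrite XE => /(_ h hs).
  by rewrite /aeval (s0z h hs) !addr0 dotZr => hx; rewrite mulr_ge0.
case: s1 => [//|h1 [|h2 s1]] /= sz pX XU s0z s1z XE.
  have h11 : h1.2 = 1 by apply: s1z; rewrite inE.
  have X0 : X 0.
    rewrite XE => h; rewrite aeval0 mem_cat => /orP[/s0z ->//|/s1z ->].
    exact: ler01.
  have XPyr : X = pyramid (X `&` heq h1).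
    apply: pyramid_base => //.
      by move=> x; rewrite XE; apply; rewrite mem_cat mem_seq1 eqxx orbT.
    move=> x t Xx t0 htx; rewrite XE => h; rewrite mem_cat mem_seq1 => /orP[hs|/eqP->//].
    have := Xx; rewrite XE => /(_ h); rewrite mem_cat hs => /(_ isT).
    by rewrite /aeval (s0z h hs) !addr0 dotZr => hx; rewrite mulr_ge0.
  set F := X `&` heq h1 in XPyr.
  have [F0|/set0P[f Ff]] := eqVneq F set0.
    by rewrite XPyr F0 pyramid_set0.
  (* Directions parallel to the face [F]. The space is smaller than [U], as the linear part of [h1]
     takes the value -1 at [f]. *)
  pose U' := (U :&: lker (linfun (mulmxr (h1.1)^T : 'rV[R]_d -> 'rV[R]_1)))%VS.
  have U'P x : (x \in U') = (x \in U) && (dot h1.1 x == 0).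
    rewrite memv_cap memv_ker lfunE /=; congr (_ && _).
    have -> : x *m h1.1^T = (dot h1.1 x)%:M.
      apply/rowP => i; rewrite !mxE ord1 eqxx mulr1n; apply: eq_bigr => j _.
      by rewrite !mxE mulrC.
    apply/eqP/eqP => [/rowP/(_ 0)|->]; last by rewrite raddf0.
    by rewrite !mxE eqxx mulr1n.
  have U'U : (U' <= U)%VS by exact: capvSl.
  have dimU' : (\dim U' < \dim U)%N.
    rewrite ltn_neqAle dimvS// andbT; apply/eqP => eqd.
    have eU : U' = U by apply/eqP; rewrite eqEdim U'U eqd leqnn.
    have : f \in U' by rewrite eU; apply: XU; case: Ff.
    rewrite U'P => /andP[_ /eqP f0]; case: Ff => _; rewrite /heq /= /aeval f0 h11 add0r.
    by move/eqP; rewrite oner_eq0.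
  have onh x : heq h1 x -> dot h1.1 x = -1.
    by rewrite /heq /= /aeval h11 => /eqP; rewrite addr_eq0 => /eqP.
  (* The property handed to the induction on dimension: subsets of the hyperplane of [F] are judged
     through the pyramid over them. *)
  pose Pi' Y := (forall y, Y y -> y \in U /\ heq h1 y) -> Pi1 (pyramid Y).
  suff : Pi' F by rewrite /Pi' -XPyr; apply=> y [Xy hy]; split=> //; exact: XU.
  apply: (IH U') => [||p ws fw wU'|Y g pY Y1 Y2 Y3 hY||x y].
  - exact: leq_trans dimU' dimU.
  - by move=> _; rewrite pyramid_set0.
  - move=> hp; have [pU hp1] : p \in U /\ heq h1 p.
      by apply: hp; exists 0; rewrite ?addr0//; exact: orthoscheme0.
    have -> : pyramid [set p + y | y in orthoscheme ws] = orthoscheme (p :: ws) by [].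
    have := Pi1S 0 (p :: ws).
    rewrite (_ : [set 0 + y | y in _] = orthoscheme (p :: ws)); last first.
      by under eq_imagel do rewrite add0r; rewrite image_id.
    apply.
      rewrite free_cons fw andbT; apply/negP => pws.
      have : p \in U'.
        by move: p pws {hp pU hp1}; apply/subvP; apply/span_subvP => w /wU'.
      rewrite U'P (onh _ hp1) => /andP[_]; rewrite oppr_eq0 oner_eq0//.
    move=> w; rewrite inE => /orP[/eqP->//|/wU'].
    by rewrite U'P => /andP[].
  (* Subtracting a multiple of [h1] does not change [g] on the face but makes it linear, so that the
     cut of [Y] extends to a cut of the pyramid through its apex. *)
  - pose g' := g - g.2 *: h1.
    have g'2 : g'.2 = 0 by rewrite /g' /= h11 [_ *: _]mulr1 subrr.
    have gE y : Y y -> aeval g' y = aeval g y.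
      move=> /hY[_ h0]; rewrite /g' aevalB aevalZ.
      by move: h0; rewrite /heq /= => ->; rewrite mulr0 subr0.
    have gN2 : (- g').2 = 0 by rewrite -[LHS]/(- g'.2) g'2 oppr0.
    apply: (Pi1C _ g'); first exact: polytope_pyramid.
    + rewrite pyramidI_hge// (_ : _ `&` _ = Y `&` hge g); first by apply: Y1 => y [/hY].
      by apply/seteqP; split=> y [Yy]; rewrite /hge /= gE.
    + rewrite pyramidI_hge// (_ : _ `&` _ = Y `&` hge (- g)); first by apply: Y2 => y [/hY].
      by apply/seteqP; split=> y [Yy]; rewrite /hge /= !aevalN gE.
    + rewrite pyramidI_heq// (_ : _ `&` _ = Y `&` heq g); first by apply: Y3 => y [/hY].
      by apply/seteqP; split=> y [Yy]; rewrite /heq /= gE.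
  - exact: polytope_heq.
  - move=> [Xx /onh hx] [Xy /onh hy]; rewrite U'P rpredB ?XU//=.
    by rewrite dotBr hx hy subrr.
have h11 : h1.2 = 1 by apply: s1z; rewrite inE eqxx.
have h21 : h2.2 = 1 by apply: s1z; rewrite !inE eqxx orbT.
pose g := h1 - h2.
have g0 : g.2 = 0 by rewrite /g /= h11 h21 subrr.
have gN0 : (- g).2 = 0 by rewrite -[LHS]/(- g.2) g0 oppr0.
have size_s1 h : (size (h :: s1) = k)%N by case: sz.
have XgU (Y : set V) x : (X `&` Y) x -> x \in U by case=> /XU.
have s1z' h : h \in h1 :: s1 -> h.2 = 1.
  by rewrite inE => /orP[/eqP->//|hs]; apply: s1z; rewrite !inE hs !orbT.
have s1z'' h : h \in h2 :: s1 -> h.2 = 1.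
  by rewrite inE => /orP[/eqP->//|hs]; apply: s1z; rewrite !inE hs !orbT.
rewrite hpoly_cat !hpoly_cons in XE.
have gE x : aeval g x = aeval h1 x - aeval h2 x by rewrite aevalB.
apply: (Pi1C _ g) => //.
- apply: (IHk (h2 :: s1) (g :: s0)) => //; first exact: polytope_hge.
  + exact: XgU.
  + by move=> h; rewrite inE => /orP[/eqP->|/s0z].
  + rewrite cat_cons hpoly_cons hpoly_cat hpoly_cons XE.
    apply/seteqP; split=> [x [[? [? [? ?]]] ?] //|x [gx [sx [h2x s1x]]]].
    split=> //; do !split => //; move: gx h2x; rewrite /= gE; lra.
- apply: (IHk (h1 :: s1) (- g :: s0)) => //; first exact: polytope_hge.
  + exact: XgU.
  + by move=> h; rewrite inE => /orP[/eqP->|/s0z].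
  + rewrite cat_cons hpoly_cons hpoly_cat hpoly_cons XE.
    apply/seteqP; split=> [x [[? [? [? ?]]] ?] //|x [gx [sx [h2x s1x]]]].
    split=> //; do !split => //; move: gx h2x; rewrite /= aevalN gE; lra.
- apply: (IHk (h1 :: s1) (g :: - g :: s0)) => //; first exact: polytope_heq.
  + exact: XgU.
  + by move=> h; rewrite !inE => /or3P[/eqP->|/eqP->|/s0z].
  + rewrite -hge_hgeN !cat_cons !hpoly_cons hpoly_cat hpoly_cons XE.
    apply/seteqP; split=> [x [[? [? [? ?]]] [? ?]] //|x [gx [gnx [sx [h2x s1x]]]]].
    split=> //; do !split => //; move: gx gnx h2x; rewrite /= aevalN gE; lra.
Qed.

End CutInduction.

(** * The binomial basis of degree r *)

Section BinomialBasis.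
Context {R : realType}.

Definition hexp (G : nmodType) (r : nat) (h : nat -> G) (n : nat) : G :=
  \sum_(i < r.+1) h i *+ 'C(n + r - i, r).

(** The system is unitriangular: at [n = i] the binomial of index [i] equals 1 and those of larger
    index vanish. *)
Lemma hexp_unique (G : zmodType) r (h k : nat -> G) :
  hexp r h =1 hexp r k -> forall i, (i <= r)%N -> h i = k i.
Proof.
move=> hk i; have [m] := ubnP i; elim: m i => // m IH i; rewrite ltnS => im ir.
have split_i (l : nat -> G) : hexp r l i = \sum_(j < r.+1 | (j < i)%N) l j *+ 'C(i + r - j, r) + l i.
  rewrite /hexp (bigID (fun j : 'I_r.+1 => (j < i)%N)) /=; congr (_ + _).
  have ir' : (i < r.+1)%N by [].
  rewrite (bigD1 (Ordinal ir')) /= -?leqNgt// addKn binn mulr1n big1 ?addr0// => j.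
  rewrite -leqNgt => /andP[ij /eqP ji].
  rewrite bin_small ?mulr0n//; have : (i != j :> nat) by apply/eqP => ij'; apply: ji; apply: val_inj.
  by have := ltn_ord j; lia.
have := hk i; rewrite !split_i; rewrite (eq_bigr (fun j : 'I_r.+1 => k j *+ 'C(i + r - j, r))).
  by move=> /addrI.
by move=> j ji; rewrite IH//; [exact: leq_trans im|rewrite -ltnS].
Qed.

(** Polynomials of degree at most [r]. In the binomial basis this makes sense over any abelian
    group, without division. *)
Definition hdeg (G : zmodType) r (f : nat -> G) : Prop := exists h, f =1 hexp r h.

Lemma hdegD (G : zmodType) r (f g : nat -> G) :
  hdeg r f -> hdeg r g -> hdeg r (fun n => f n + g n).
Proof.
move=> [h hf] [k kg]; exists (fun i => h i + k i) => n; rewrite hf kg -big_split.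
by apply: eq_bigr => i _; rewrite mulrnDl.
Qed.

Lemma hdegN (G : zmodType) r (f : nat -> G) : hdeg r f -> hdeg r (fun n => - f n).
Proof.
move=> [h hf]; exists (fun i => - h i) => n; rewrite hf -sumrN.
by apply: eq_bigr => i _; rewrite mulNrn.
Qed.

Lemma hdegB (G : zmodType) r (f g : nat -> G) :
  hdeg r f -> hdeg r g -> hdeg r (fun n => f n - g n).
Proof. by move=> hf hg; apply: hdegD => //; exact: hdegN. Qed.

Lemma hdeg_eq (G : zmodType) r (f g : nat -> G) : f =1 g -> hdeg r f -> hdeg r g.
Proof. by move=> fg [h hf]; exists h => n; rewrite -fg. Qed.

Lemma hdeg_const (G : zmodType) (c : G) : hdeg 0 (fun=> c).
Proof. by exists (fun=> c) => n; rewrite /hexp big_ord1 bin0. Qed.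

(* By Pascal's rule; the sum of the new coefficients telescopes to 0. *)
Lemma hexp_lift (G : zmodType) r (h : nat -> G) : exists k,
  hexp r h =1 hexp r.+1 k /\ \sum_(i < r.+2) k i = 0.
Proof.
pose h1 i := if (i <= r)%N then h i else 0.
pose h2 i := if i is i'.+1 then h i' else 0.
have h1r : h1 r.+1 = 0 by rewrite /h1 ltnn.
exists (fun i => h1 i - h2 i); split=> [n|]; last first.
  rewrite sumrB big_ord_recr [X in _ - X]big_ord_recl /= h1r addr0 add0r.
  apply/eqP; rewrite subr_eq0; apply/eqP; apply: eq_bigr => i _.
  by rewrite /h1 -ltnS ltn_ord.
rewrite /hexp; under [RHS]eq_bigr do rewrite mulrnBl.
rewrite sumrB [X in _ = X - _]big_ord_recr [X in _ - X]big_ord_recl /= h1r !mul0rn addr0 add0r.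
rewrite -sumrB; apply: eq_bigr => i _; have ir := ltn_ord i.
rewrite /h1 -ltnS ir -mulrnBr; last by apply: leq_bin2l; rewrite /bump; lia.
congr (_ *+ _).
rewrite (_ : n + r.+1 - i = (n + r - i).+1)%N; last by lia.
by rewrite (_ : n + r.+1 - bump 0 i = n + r - i)%N ?binS ?addKn //; rewrite /bump; lia.
Qed.

Lemma hdegS (G : zmodType) r (f : nat -> G) : hdeg r f -> hdeg r.+1 f.
Proof.
by move=> [h hf]; have [k [hk _]] := hexp_lift r h; exists k => n; rewrite hf hk.
Qed.

Lemma hdegW (G : zmodType) r s (f : nat -> G) : (r <= s)%N -> hdeg r f -> hdeg s f.
Proof.
move=> rs hf; rewrite -(subnK rs); elim: (s - r)%N => // m IH.
by rewrite addSn; exact: hdegS.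
Qed.

Lemma hdeg_sum (G : zmodType) r (I : Type) (s : seq I) (P : pred I) (f : I -> nat -> G) :
  (forall i, P i -> hdeg r (f i)) -> hdeg r (fun n => \sum_(i <- s | P i) f i n).
Proof.
move=> hf; elim: s => [|i s IH].
  apply: hdeg_eq (hdegW (leq0n r) (hdeg_const 0)) => n; by rewrite big_nil.
case Pi : (P i); last by apply: hdeg_eq IH => n; rewrite big_cons Pi.
by apply: hdeg_eq (hdegD (hf i Pi) IH) => n; rewrite big_cons Pi.
Qed.

(** Discrete integration: by Pascal's rule, shifting the coefficients by one index gives a function
    with the prescribed difference and value 0 at 0, to which [f 0] is added. *)
Lemma hdeg_antidiff (G : zmodType) r (f : nat -> G) :
  hdeg r (fun n => f n.+1 - f n) -> hdeg r.+1 f.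
Proof.
move=> [h hf].
apply: (@hdeg_eq _ _ (fun n => f 0%N + hexp r.+1 (fun i => if i is i'.+1 then h i' else 0) n)).
  move=> n; rewrite -[RHS](subrK (f 0%N)) addrC; congr (_ + _).
  rewrite /hexp big_ord_recl mul0rn add0r.
  elim: n => [|n IH].
    rewrite subrr big1// => i _; rewrite bin_small ?mulr0n//.
    by rewrite /= /bump; have := ltn_ord i; lia.
  have -> : f n.+1 - f 0%N = f n.+1 - f n + (f n - f 0%N) by rewrite addrA subrK.
  rewrite hf -IH /hexp -big_split; apply: eq_bigr => i _ /=.
  rewrite -mulrnDr; congr (_ *+ _).
  have := ltn_ord i; rewrite /bump => ir.
  rewrite (_ : n.+1 + r.+1 - (1 + i) = (n + r - i).+1)%N; last by lia.
  rewrite (_ : n + r.+1 - (1 + i) = n + r - i)%N; last by lia.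
  by rewrite binS addnC.
apply: hdegD; first exact: hdegW (hdeg_const _).
by exists (fun i => if i is i'.+1 then h i' else 0).
Qed.

Lemma binomial_poly r s : exists2 p : {poly R}, (size p <= r.+1)%N &
  forall n : nat, p.[n%:R] = 'C(n + s, r)%:R.
Proof.
elim: s r => [|s IHs] r.
  elim: r => [|r [p sp pE]].
    by exists 1 => [|n]; rewrite ?size_poly1// hornerE bin0.
  exists (r.+1%:R^-1 *: (('X - (r%:R)%:P) * p)) => [|n].
    apply: leq_trans (size_scale_leq _ _) _; apply: leq_trans (size_polyMleq _ _) _.
    by rewrite size_XsubC.
  rewrite hornerZ hornerM hornerXsubC pE addn0.
  have r0 : r.+1%:R != 0 :> R by rewrite pnatr_eq0.
  apply: (mulfI r0); rewrite mulVKf// -natrM mul_bin_left natrM.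
  have [rn|nr] := leqP r n; first by rewrite natrB.
  by rewrite bin_small// !mulr0.
case: r => [|r]; first by exists 1 => [|n]; rewrite ?size_poly1// hornerE bin0.
have [p sp pE] := IHs r.+1; have [q sq qE] := IHs r.
exists (p + q) => [|n]; last by rewrite hornerD pE qE addnS binS natrD.
apply: leq_trans (size_polyD _ _) _; rewrite geq_max sp /=.
exact: leq_trans sq _.
Qed.

Definition mexp (G : lmodType R) r (a : nat -> G) (n : nat) : G :=
  \sum_(j < r.+1) n%:R ^+ j *: a j.

Lemma hdeg_mexp (G : lmodType R) r (f : nat -> G) : hdeg r f ->
  exists a, f =1 mexp r a.
Proof.
move=> [h hf].
have pP i : exists p : {poly R}, (i < r.+1)%N -> (size p <= r.+1)%N /\
    forall n : nat, p.[n%:R] = 'C(n + r - i, r)%:R.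
  have [p sp pE] := binomial_poly r (r - i); exists p => ir; split=> // n.
  by rewrite pE addnBA.
have {pP} [p pP] := choice pP.
exists (fun j => \sum_(i < r.+1) (p i)`_j *: h i) => n.
rewrite hf /hexp /mexp; under [RHS]eq_bigr do rewrite scaler_sumr.
rewrite exchange_big; apply: eq_bigr => i _ /=.
have [sp pE] := pP i (ltn_ord i).
rewrite -scaler_nat -pE (horner_coef_wide _ sp) scaler_suml.
by apply: eq_bigr => j _; rewrite scalerA mulrC.
Qed.

(** Each coordinate is a real polynomial of degree at most [r] with more than [r] roots. *)
Lemma mexp_eq0 (G : vectType R) r (a : nat -> G) :
  (forall n, mexp r a n = 0) -> forall j, (j <= r)%N -> a j = 0.
Proof.
move=> a0 j jr.
suff cj i : coord (vbasis {:G}) i (a j) = 0.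
  rewrite (coord_vbasis (memvf (a j))) big1// => i _.
  by rewrite cj scale0r.
pose p : {poly R} := \poly_(j < r.+1) coord (vbasis {:G}) i (a j).
have pn (n : nat) : p.[n%:R] = 0.
  rewrite horner_poly; have := congr1 (coord (vbasis {:G}) i) (a0 n).
  rewrite !linear0 /mexp linear_sum => e; rewrite -[RHS]e.
  by apply: eq_bigr => k _; rewrite linearZ mulrC.
have : p = 0.
  apply: (@roots_geq_poly_eq0 _ p [seq n%:R | n <- iota 0 r.+1]).
  - by apply/allP => _ /mapP[n _ ->]; rewrite /root pn.
  - by rewrite map_inj_uniq ?iota_uniq// => m n /eqP; rewrite eqr_nat => /eqP.
  - by rewrite size_map size_iota; exact: size_poly.
move=> /(congr1 (fun q : {poly R} => q`_j)); rewrite coef_poly ltnS jr coef0.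
exact.
Qed.

Lemma mexp_inj (G : vectType R) r (a b : nat -> G) : mexp r a =1 mexp r b ->
  forall j, (j <= r)%N -> a j = b j.
Proof.
move=> ab j jr; apply/eqP; rewrite -subr_eq0; apply/eqP.
apply: (@mexp_eq0 _ r (fun j => a j - b j)) => // n.
rewrite /mexp; under eq_bigr do rewrite scalerBr.
by rewrite sumrB; have := ab n; rewrite /mexp => ->; rewrite subrr.
Qed.

(* The coefficients are the Eulerian numbers. *)
Lemma power_hexp d : exists2 e : nat -> R, (forall i, 0 <= e i) &
  forall n : nat, n%:R ^+ d = hexp d e n.
Proof.
elim: d => [|d [e e0 eE]].
  by exists (fun=> 1) => // n; rewrite /hexp big_ord1 bin0 expr0.
(* The Eulerian recurrence: the new coefficient is [i e_i + (d + 2 - i) e_(i-1)]. The first part is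
   cut off at [d], since [e] is arbitrary beyond that index. *)
pose e1 i := if (i <= d)%N then i%:R * e i else 0.
pose e2 i := if i is i'.+1 then (d.+1 - i')%:R * e i' else 0.
have e1d : e1 d.+1 = 0 by rewrite /e1 ltnn.
exists (fun i => e1 i + e2 i) => [i|n].
  apply: addr_ge0; first by rewrite /e1; case: ifP => // _; exact: mulr_ge0.
  by case: i => [|i] //=; exact: mulr_ge0.
rewrite exprS eE /hexp; under [RHS]eq_bigr do rewrite mulrnDl.
rewrite big_split /= [X in _ = X + _]big_ord_recr [X in _ = _ + X]big_ord_recl /= e1d !mul0rn addr0 add0r.
rewrite mulr_sumr -big_split; apply: eq_bigr => i _ /=; have id := ltn_ord i.
rewrite /e1 -ltnS id /bump -[e i *+ _]mulr_natr -[(i%:R * e i) *+ _]mulr_natr.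
rewrite -[(_ * e i) *+ _ in RHS]mulr_natr.
rewrite (_ : n + d.+1 - i = (n + d - i).+1)%N; last by lia.
rewrite (_ : n + d.+1 - (1 + i) = n + d - i)%N; last by lia.
(* The inductive step of Worpitzky's identity. *)
have : (n * 'C(n + d - i, d) = i * 'C((n + d - i).+1, d.+1) +
    (d.+1 - i) * 'C(n + d - i, d.+1))%N.
  set m := (n + d - i)%N.
  have h1 := mul_bin_left m d; have h2 := binS m d.
  have [dm|md] := leqP d m; last first.
    by rewrite h2 !bin_small ?muln0//; lia.
  have mn : (n = (m - d) + i)%N by rewrite /m; lia.
  have h3 : (d.+1 * 'C(m, d.+1) = i * 'C(m, d.+1) + (d.+1 - i) * 'C(m, d.+1))%N.
    by rewrite -mulnDl subnKC// ltnW.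
  by rewrite h2 {1}mn mulnDl -h1 h3 mulnDr addnAC.
move=> /(congr1 (fun k => k%:R : R)); rewrite natrD !natrM => E.
transitivity (e i * (n%:R * 'C(n + d - i, d)%:R)); first by ring.
by rewrite E; ring.
Qed.

(** The last raising of the degree, from [r - 1] to [r], makes the coefficients telescope to 0. *)
Lemma hexp_small_power j r : (j < r)%N -> exists2 e : nat -> R,
  (forall n : nat, n%:R ^+ j = hexp r e n) & \sum_(i < r.+1) e i = 0.
Proof.
case: r => // r; rewrite ltnS => jr.
have [e _ eE] := power_hexp j.
have : hdeg r (fun n => n%:R ^+ j : R) by apply: hdegW jr _; exists e.
move=> [k kE]; have [l [kl l0]] := hexp_lift r k.
by exists l => // n; rewrite kE kl.
Qed.

(** Coefficients with sum 0 that do not all vanish take both signs, and they do not all vanish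
    because the value at [n = 1] is 1. *)
Lemma hexp_small_power_signs j r : (j < r)%N -> exists2 e : nat -> R,
  (forall n : nat, n%:R ^+ j = hexp r e n) &
  exists i1 i2, [/\ (i1 <= r)%N, (i2 <= r)%N, 0 < e i1 & e i2 < 0].
Proof.
move=> /hexp_small_power[e eE e0]; exists e => //.
have noall (s : R) : s != 0 -> exists i : 'I_r.+1, 0 < s * e i.
  move=> s0; apply: contrapT => no.
  have np (i : 'I_r.+1) : s * e i <= 0.
    by rewrite leNgt; apply/negP => hi; apply: no; exists i.
  have : \sum_(i < r.+1) - (s * e i) == 0 by rewrite sumrN -mulr_sumr e0 mulr0 oppr0.
  rewrite psumr_eq0 => [|i _]; last by rewrite oppr_ge0.
  move=> /allP z; have := eE 1%N; rewrite expr1n /hexp big1 => [/eqP|i _].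
    by rewrite oner_eq0.
  have := z i (mem_index_enum i); rewrite /= oppr_eq0 mulf_eq0 (negbTE s0) /= => /eqP ->.
  by rewrite mul0rn.
have [|i1 h1] := noall 1; first exact: oner_neq0.
have [|i2 h2] := noall (-1); first by rewrite oppr_eq0 oner_neq0.
exists i1, i2; split; rewrite -1?ltnS//; first by move: h1; rewrite mul1r.
by move: h2; rewrite mulN1r oppr_gt0.
Qed.

End BinomialBasis.

(** * Polynomiality of dilates *)

Section SetValuations.
Context {R : realType}.

(** The valuation axioms on bare sets, with polytopality as a side condition: pieces can then be
    rewritten along set equalities, and valuations pulled back along linear maps. *)
Definition set_valuation d (G : zmodType) (Phi : set 'rV[R]_d -> G) : Prop :=
  [/\ Phi set0 = 0,
      forall A B, is_polytope A -> is_polytope B -> is_polytope (A `|` B) ->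
        is_polytope (A `&` B) -> Phi (A `|` B) + Phi (A `&` B) = Phi A + Phi B
    & forall t A, is_polytope A -> Phi [set t + x | x in A] = Phi A].

Lemma valuation_cut d (G : zmodType) (Phi : set 'rV[R]_d -> G) P h :
  set_valuation Phi -> is_polytope P ->
  Phi P = Phi (P `&` hge h) + Phi (P `&` hge (- h)) - Phi (P `&` heq h).
Proof.
move=> [_ PhiU _] pP; rewrite -PhiU -?setIUr ?hge_setU ?setIT//.
- by rewrite -setIIr hge_hgeN addrK.
- exact: polytope_hge.
- exact: polytope_hge.
- by rewrite -setIIr hge_hgeN; exact: polytope_heq.
Qed.

(** * The dilated order simplex and its cells *)

Section ChainSimplex.
Context {k : nat} {G : zmodType}.
Local Notation V := 'rV[R]_k.

(* Coordinates indexed by [nat], with value 0 beyond the dimension. *)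
Definition co (x : V) (j : nat) : R := if insub j is Some i then x 0 i else 0.
Definition co_form (j : nat) : V := if insub j is Some i then delta_mx 0 i else 0.

Lemma dot_co_form j x : dot (co_form j) x = co x j.
Proof.
rewrite /co_form /co; case: insubP => [i _ _|_]; first exact: dot_deltal.
by rewrite /dot big1// => i _; rewrite mxE mul0r.
Qed.

Lemma coD x y j : co (x + y) j = co x j + co y j.
Proof. by rewrite -!dot_co_form dotDr. Qed.
Lemma coN x j : co (- x) j = - co x j.
Proof. by rewrite -!dot_co_form dotNr. Qed.
Lemma coZ (l : R) x j : co (l *: x) j = l * co x j.
Proof. by rewrite -!dot_co_form dotZr. Qed.
Lemma co_ord x (i : 'I_k) : co x i = x 0 i.
Proof. by rewrite /co valK. Qed.

Definition ones (j : nat) : V := \row_i (i < j)%:R.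
Lemma co_ones j a : (a < k)%N -> co (ones j) a = (a < j)%:R.
Proof. by move=> ak; rewrite -[a]/(nat_of_ord (Ordinal ak)) co_ord mxE. Qed.

Definition chain (c : nat -> R) (a0 i : nat) (m : R) : Prop :=
  (forall a, (a0 <= a < i)%N -> 0 <= c a <= m) /\
  (forall a b, (a0 <= a <= b)%N -> (b < i)%N -> c b <= c a).

Definition chain_set i (n : nat) (Q : set V) : set V :=
  [set x | chain (co x) 0 i n%:R /\ Q x].

(** With this condition [chain_set i n Q] is the product of a dilated order simplex and a set that
    does not depend on [n]. *)
Definition ignores i (Q : set V) : Prop :=
  forall x y, (forall j, (i <= j)%N -> co x j = co y j) -> Q x -> Q y.

(** The factor of a cell that does not grow with [n]: the coordinates after [j] stay below 1. *)
Let QC i j (Q : set V) : set V := [set x | chain (co x) j.+1 i 1 /\ Q x].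

(** In this cell the coordinates [0, ..., j] are at least 1; subtracting 1 from them leaves a chain
    bounded by [n]. The guard [j.+1 < i] covers the top cell, which has no next coordinate. *)
Let chain_cell i n j (Q : set V) : (i <= k)%N -> ignores i Q -> (j < i)%N ->
  chain_set i n.+1 Q `&` [set x | (j.+1 < i)%N -> co x j.+1 <= 1] `&`
    [set x | 1 <= co x j] =
  [set ones j.+1 + x | x in chain_set j.+1 n (QC i j Q)].
Proof.
move=> ik iQ ji; apply/seteqP; split=> [x [[[[c0 cc] Qx] c1] cj]|].
  exists (- ones j.+1 + x); last by rewrite addrA subrr add0r.
  have lo a : (a < k)%N -> (a < j.+1)%N -> co (- ones j.+1 + x) a = co x a - 1.
    by move=> ak aj; rewrite coD coN co_ones// aj addrC.
  have hi a : (j < a)%N -> co (- ones j.+1 + x) a = co x a.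
    move=> ja; have [ak|ka] := ltnP a k.
      by rewrite coD coN co_ones// ltnS leqNgt ja oppr0 add0r.
    by rewrite /co; case: insubP => // i'; rewrite ltnNge ka.
  split; [split|split; [split|]] => [a /andP[_ aj]|a b /andP[_ ab] bj|a /andP[ja ai]|a b /andP[ja ab] bi|].
  - rewrite lo//; last by lia.
    have /andP[_ h2] : 0 <= co x a <= n.+1%:R by apply: c0; lia.
    have h3 : co x j <= co x a by apply: cc; lia.
    by move: h2 cj h3 => /=; rewrite -natr1; lra.
  - rewrite !lo; try lia; have : co x b <= co x a by apply: cc; lia.
    by lra.
  - rewrite hi//; have /andP[-> _] /= : 0 <= co x a <= n.+1%:R by apply: c0; lia.
    apply: (@le_trans _ _ (co x j.+1)); last by apply: c1; lia.
    by apply: cc; lia.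
  - by rewrite !hi//; [apply: cc|]; lia.
  - apply: iQ Qx => a ia; rewrite hi//; lia.
move=> _ [y [[c0 cc] [[q0 qc] Qy]] <-].
have lo a : (a < k)%N -> (a < j.+1)%N -> co (ones j.+1 + y) a = co y a + 1.
  by move=> ak aj; rewrite coD co_ones// aj addrC.
have hi a : (j < a)%N -> co (ones j.+1 + y) a = co y a.
  move=> ja; have [ak|ka] := ltnP a k.
    by rewrite coD co_ones// ltnS leqNgt ja add0r.
  by rewrite /co; case: insubP => // i'; rewrite ltnNge ka.
have n0 : 0 <= n%:R :> R by [].
have loP a : (a < j.+1)%N -> 1 <= co (ones j.+1 + y) a <= n.+1%:R.
  move=> aj; rewrite lo//; last by lia.
  have : 0 <= co y a <= n%:R by apply: c0; lia.
  by rewrite -natr1; lra.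
have hiP a : (j < a < i)%N -> 0 <= co (ones j.+1 + y) a <= 1.
  by move=> /andP[ja ai]; rewrite hi//; apply: q0; lia.
split; last by move=> /=; have /andP[] := loP j (ltnSn j).
split; last by move=> /= ji1; have /andP[] : 0 <= co (ones j.+1 + y) j.+1 <= 1 by apply: hiP; lia.
split; last by apply: iQ Qy => a ia; rewrite hi//; lia.
split=> [a /andP[_ ai]|a b /andP[_ ab] bi].
  have [aj|ja] := leqP a j; first by have := loP a aj; rewrite -natr1; lra.
  have : 0 <= co (ones j.+1 + y) a <= 1 by apply: hiP; lia.
  by rewrite -natr1; lra.
have [bj|jb] := leqP b j.
  by rewrite !lo ?lerD2r; try lia; apply: cc; lia.
have [aj|ja] := leqP a j; last by rewrite !hi//; apply: qc; lia.
have h1 := loP a aj.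
have : 0 <= co (ones j.+1 + y) b <= 1 by apply: hiP; lia.
by lra.
Qed.

(** On the wall the coordinate [j] is frozen at 1 and joins the fixed factor, so the growing chain
    is one shorter than in the cell. *)
Let chain_wall i n j (Q : set V) : (i <= k)%N -> ignores i Q -> (j < i)%N ->
  chain_set i n.+1 Q `&` [set x | (j.+1 < i)%N -> co x j.+1 <= 1] `&`
    [set x | co x j = 1] =
  [set ones j + x | x in chain_set j n ([set x | co x j = 1] `&` QC i j Q)].
Proof.
move=> ik iQ ji; apply/seteqP; split=> [x [[[[c0 cc] Qx] c1] /= cj]|].
  exists (- ones j + x); last by rewrite addrA subrr add0r.
  have lo a : (a < k)%N -> (a < j)%N -> co (- ones j + x) a = co x a - 1.
    by move=> ak aj; rewrite coD coN co_ones// aj addrC.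
  have hi a : (j <= a)%N -> co (- ones j + x) a = co x a.
    move=> ja; have [ak|ka] := ltnP a k.
      by rewrite coD coN co_ones// ltnNge ja oppr0 add0r.
    by rewrite /co; case: insubP => // i'; rewrite ltnNge ka.
  split; [split|split; [|split; [split|]]] => [a /andP[_ aj]|a b /andP[_ ab] bj||a /andP[ja ai]|a b /andP[ja ab] bi|].
  - rewrite lo//; last by lia.
    have /andP[_ h2] : 0 <= co x a <= n.+1%:R by apply: c0; lia.
    have h3 : co x j <= co x a by apply: cc; lia.
    by move: h2 cj h3 => /=; rewrite -natr1; lra.
  - rewrite !lo; try lia; have : co x b <= co x a by apply: cc; lia.
    by lra.
  - by rewrite /= hi.
  - rewrite hi//; last by lia.
    have /andP[-> _] /= : 0 <= co x a <= n.+1%:R by apply: c0; lia.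
    apply: (@le_trans _ _ (co x j.+1)); last by apply: c1; lia.
    by apply: cc; lia.
  - by rewrite !hi//; [apply: cc| |]; lia.
  - apply: iQ Qx => a ia; rewrite hi//; lia.
move=> _ [y [[c0 cc] [/= yj [[q0 qc] Qy]]] <-].
have lo a : (a < k)%N -> (a < j)%N -> co (ones j + y) a = co y a + 1.
  by move=> ak aj; rewrite coD co_ones// aj addrC.
have hi a : (j <= a)%N -> co (ones j + y) a = co y a.
  move=> ja; have [ak|ka] := ltnP a k.
    by rewrite coD co_ones// ltnNge ja add0r.
  by rewrite /co; case: insubP => // i'; rewrite ltnNge ka.
have n0 : 0 <= n%:R :> R by [].
have loP a : (a < j)%N -> 1 <= co (ones j + y) a <= n.+1%:R.
  move=> aj; rewrite lo//; last by lia.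
  have : 0 <= co y a <= n%:R by apply: c0; lia.
  by rewrite -natr1; lra.
have hiP a : (j <= a < i)%N -> 0 <= co (ones j + y) a <= 1.
  move=> /andP[ja ai]; rewrite hi//; move: ja; rewrite leq_eqVlt => /orP[/eqP<-|ja].
    by rewrite yj; lra.
  by apply: q0; lia.
split; last by rewrite /= hi.
split; last by move=> /= ji1; have /andP[] : 0 <= co (ones j + y) j.+1 <= 1 by apply: hiP; lia.
split; last by apply: iQ Qy => a ia; rewrite hi//; lia.
split=> [a /andP[_ ai]|a b /andP[_ ab] bi].
  have [ja|aj] := leqP j a; last by have := loP a aj; rewrite -natr1; lra.
  have : 0 <= co (ones j + y) a <= 1 by apply: hiP; lia.
  by rewrite -natr1; lra.
have [jb|bj] := leqP j b; last by rewrite !lo ?lerD2r; try lia; apply: cc; lia.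
have hb : 0 <= co (ones j + y) b <= 1 by apply: hiP; lia.
have [aj|ja] := ltnP a j; first by have := loP a aj; lra.
move: ja; rewrite leq_eqVlt => /orP[/eqP<-|ja].
  by rewrite [leRHS]hi// yj; lra.
by rewrite !hi; try lia; apply: qc; lia.
Qed.

(* Cut [n+1 >= x_1 >= ... >= x_i >= 0] according to the number j of coordinates
   exceeding 1: each cell is a translate of the product of a chain of length j
   bounded by n with a fixed set, so the first difference has degree below i. *)
Lemma chain_set_hdeg (Phi : set V -> G) : set_valuation Phi ->
  forall i Q, (i <= k)%N -> ignores i Q ->
    (forall n, is_polytope (chain_set i n Q)) ->
    hdeg i (fun n => Phi (chain_set i n Q)).
Proof.
move=> vPhi i; have [m] := ubnP i; elim: m i => // m IH [|i].
  move=> _ Q _ _ _; apply: hdeg_eq (hdeg_const (Phi Q)) => n.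
  by congr Phi; apply/seteqP; split=> [x Qx|x [_]//]; split=> //; split=> [a|a b]; rewrite ltn0 ?andbF.
rewrite !ltnS => im Q ik iQ pS; apply: hdeg_antidiff.
(* The part with at most [j] coordinates above 1. It grows from the chain bounded by 1 at [j = 0] to
   the whole set at [j = i.+1], one cell at a time. *)
pose W n j := chain_set i.+1 n.+1 Q `&` [set x | (j < i.+1)%N -> co x j <= 1].
pose h j : V * R := (co_form j, -1).
have hgeE j : hge (h j) = [set x | 1 <= co x j].
  by apply/seteqP; split=> x; rewrite /hge /= /aeval dot_co_form subr_ge0.
have hgeNE j : hge (- h j) = [set x | co x j <= 1].
  by apply/seteqP; split=> x; rewrite /hge /= aevalN oppr_ge0 /aeval dot_co_form subr_le0.
have heqE j : heq (h j) = [set x | co x j = 1].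
  apply/seteqP; split=> x; rewrite /heq /= /aeval dot_co_form.
    by move=> /eqP; rewrite subr_eq0 => /eqP.
  by move=> ->; rewrite subrr.
have pW n j : is_polytope (W n j).
  rewrite /W; have [ji|ij] := ltnP j i.+1.
    rewrite (_ : [set _ | _] = hge (- h j)); first exact: polytope_hge.
    by rewrite hgeNE; apply/seteqP; split=> x /= => [/(_ isT)|].
  by rewrite (_ : [set _ | _] = setT) ?setIT//; apply/seteqP; split.
have Wi n : W n i.+1 = chain_set i.+1 n.+1 Q.
  by rewrite /W ltnn (_ : [set _ | _] = setT) ?setIT//; apply/seteqP; split.
have W0 n : W n 0%N = chain_set i.+1 1 Q.
  apply/seteqP; split=> x.
    move=> [[[c0 cc] Qx] /(_ isT) x0]; split=> //; split=> // a ai.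
    have /andP[-> _] /= := c0 a ai; apply: le_trans x0; apply: cc; lia.
  move=> [[c0 cc] Qx]; split; last first.
    by move=> _; have /andP[] : 0 <= co x 0 <= 1%:R by apply: c0.
  split=> //; split=> // a /c0 /andP[-> h1] /=; apply: le_trans h1 _.
  by rewrite ler_nat.
pose C n j := Phi (chain_set j.+1 n (QC i.+1 j Q)).
pose D n j := Phi (chain_set j n ([set x | co x j = 1] `&` QC i.+1 j Q)).
have cellE n j : (j < i.+1)%N -> W n j.+1 `&` hge (h j) =
    [set ones j.+1 + x | x in chain_set j.+1 n (QC i.+1 j Q)].
  by move=> ji; rewrite hgeE /W chain_cell.
have wallE n j : (j < i.+1)%N -> W n j.+1 `&` heq (h j) =
    [set ones j + x | x in chain_set j n ([set x | co x j = 1] `&` QC i.+1 j Q)].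
  by move=> ji; rewrite heqE /W chain_wall.
have untrans t (A : set V) : A = [set - t + x | x in [set t + x | x in A]].
  apply/seteqP; split=> [x Ax|_ [_ [y Ay <-] <-]].
    by exists (t + x); [exists x|rewrite addrA addNr add0r].
  by rewrite addrA addNr add0r.
have pC n j : (j < i.+1)%N -> is_polytope (chain_set j.+1 n (QC i.+1 j Q)).
  move=> ji; rewrite (untrans (ones j.+1) (chain_set _ _ _)) -cellE//.
  by apply: polytope_translate; exact: polytope_hge.
have pD n j : (j < i.+1)%N ->
    is_polytope (chain_set j n ([set x | co x j = 1] `&` QC i.+1 j Q)).
  move=> ji; rewrite (untrans (ones j) (chain_set _ _ _)) -wallE//.
  by apply: polytope_translate; exact: polytope_heq.
have step n j : (j < i.+1)%N -> Phi (W n j.+1) = Phi (W n j) + (C n j - D n j).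
  move=> ji; rewrite (valuation_cut (h j) vPhi (pW n j.+1)) cellE// wallE//.
  case: vPhi => _ _ PhiT; rewrite (PhiT _ _ (pC n j ji)) (PhiT _ _ (pD n j ji)) -/(C n j) -/(D n j).
  rewrite (_ : W n j.+1 `&` hge (- h j) = W n j); first by rewrite [C n j + _]addrC addrA.
  rewrite hgeNE; apply/seteqP; split=> x.
    by move=> [[cx _] xj]; split.
  move=> [[[c0 cc] Qx] /(_ ji) xj]; split=> //; split=> //= j1i.
  by apply: le_trans xj; apply: cc; lia.
have sumW : forall p j : nat, (j <= i.+1)%N ->
    Phi (W p j) = Phi (W p 0%N) + \sum_(l < j) (C p l - D p l).
  move=> p j; elim: j => [|j IHj] ji; first by rewrite big_ord0 addr0.
  by rewrite step// IHj ?big_ord_recr ?addrA// ltnW.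
(* The top cell is the original family at [n] instead of [n.+1], so the first difference consists of
   a constant and shorter chains. *)
have topC n : C n i = Phi (chain_set i.+1 n Q).
  congr Phi; apply/seteqP; split=> [x [cx [_ Qx]]|x [cx Qx]]; split=> //; split=> //.
  by split=> [a|a b]; lia.
apply: (@hdeg_eq _ _ (fun n => Phi (chain_set i.+1 1 Q) +
   (\sum_(l < i) C n l - \sum_(l < i.+1) D n l))).
  move=> n; rewrite -(Wi n) sumW// W0 sumrB [X in _ = _ + (X - _) - _]big_ord_recr /= topC.
  by rewrite -!addrA; congr (_ + (_ + _)); rewrite addrCA subrr addr0.
apply: hdegD; first exact: hdegW (hdeg_const _).
apply: hdegB; apply: hdeg_sum => -[j ji] _ /=.
- apply: (@hdegW _ j.+1) => //; apply: IH => // [||x y xy [[c0 cc] Qx]|n].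
  + exact: leq_trans im.
  + by lia.
  + split; last by apply: iQ Qx => a ia; apply: xy; lia.
    by split=> [a ha|a b ha hb]; rewrite -!xy; try lia; [exact: c0|exact: cc].
  + by apply: pC; lia.
- apply: (@hdegW _ j) => //; apply: IH => // [||x y xy [/= xj [[c0 cc] Qx]]|n].
  + exact: leq_trans im.
  + by lia.
  + split; first by rewrite /= -xy.
    split; last by apply: iQ Qx => a ia; apply: xy; lia.
    by split=> [a ha|a b ha hb]; rewrite -!xy; try lia; [exact: c0|exact: cc].
  + exact: pD.
Qed.

End ChainSimplex.

(** * Orthoschemes and polynomiality for all polytopes *)

Section McMullen.
Context {d : nat} {G : zmodType}.
Local Notation V := 'rV[R]_d.

Definition dil (n : nat) (A : set V) : set V := [set n%:R *: x | x in A].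

Lemma dil_set0 n : dil n set0 = set0. Proof. exact: image_set0. Qed.

Lemma dil0 (A : set V) : A !=set0 -> dil 0 A = [set 0].
Proof.
move=> [a Aa]; apply/seteqP; split=> [_ [x _ <-]|x ->]; first by rewrite scale0r.
by exists a; rewrite ?scale0r.
Qed.

Lemma dil_translate n t (A : set V) :
  dil n [set t + x | x in A] = [set n%:R *: t + x | x in dil n A].
Proof.
apply/seteqP; split.
  by move=> _ [_ [x Ax <-] <-]; exists (n%:R *: x); [exists x|rewrite scalerDr].
by move=> _ [_ [x Ax <-] <-]; exists (t + x); [exists x|rewrite scalerDr].
Qed.

Lemma chain_shift (c : nat -> R) i : chain c 0 i.+1 1 <->
  [/\ 0 <= c 0%N <= 1, chain (fun a => c a.+1) 0 i 1 &
    forall a, (a < i)%N -> c a.+1 <= c 0%N].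
Proof.
split=> [[c0 cc]|[c0 [c1 cc] c2]].
  split; [exact: c0| |by move=> a ai; apply: cc; lia].
  by split=> [a ai|a b ab bi]; [apply: c0|apply: cc]; lia.
split=> [[|a] ai //|[|a] [|b] ab bi //].
- by apply: c1; lia.
- by apply: c2; lia.
- by apply: cc; lia.
Qed.

Lemma orthoschemeP (ws : seq V) x : orthoscheme ws x <->
  exists2 c : nat -> R, chain c 0 (size ws) 1 &
    x = \sum_(i < size ws) c i *: ws`_i.
Proof.
elim: ws x => [|w ws IH] x /=.
  split=> [->|[c _]]; last by rewrite big_ord0.
  by exists (fun=> 0); [split=> [a|a b]; rewrite ltn0 ?andbF|rewrite big_ord0].
split=> [[t t1 [[_ ->]|[t0 [y yw tx]]]]|[c /chain_shift[/andP[c0 c1] cc cm] ->]].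
- exists (fun=> 0); first by split=> [a _|a b _ _] //; rewrite lexx ler01.
  by rewrite big1// => i _; rewrite scale0r.
- move/IH: yw => [c [cc c'] yE].
  exists (fun i => if i is i'.+1 then t * c i' else t).
    apply/chain_shift; split=> [||a ai].
    + by rewrite ltW.
    + split=> [a ai|a b ab bi]; last by apply: ler_wpM2l; [exact: ltW|exact: c'].
      have /andP[a0 a1] := cc a ai; rewrite mulr_ge0 ?(ltW t0)//=.
      by apply: mulr_ile1 => //; exact: ltW.
    + have /andP[a0 a1] := cc a ai; rewrite -[leRHS]mulr1.
      by apply: ler_wpM2l => //; exact: ltW.
  rewrite big_ord_recl /=.
  have -> : x = t *: (t^-1 *: x) by rewrite scalerA mulfV ?scale1r// gt_eqF.
  rewrite -tx scalerDr yE scaler_sumr; congr (_ + _).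
  by apply: eq_bigr => i _; rewrite scalerA.
- exists (c 0%N) => //; move: c0; rewrite le_eqVlt => /orP[/eqP c0|c0].
    left; split=> //; rewrite big_ord_recl /= -c0 scale0r add0r big1// => i _.
    have ci : c (bump 0 i) = 0.
      apply/eqP; rewrite eq_le [X in _ <= X]c0 cm//=.
      by case: cc => /(_ i) + _; rewrite leq0n ltn_ord => /(_ isT) /andP[].
    by rewrite ci scale0r.
  right; split=> //; exists (\sum_(i < size ws) (c i.+1 / c 0%N) *: ws`_i).
    apply/IH; exists (fun i => c i.+1 / c 0%N) => //.
    case: cc => cc c'; split=> [a ai|a b ab bi].
      have /andP[a0 a1] := cc a ai; rewrite divr_ge0 ?(ltW c0)//=.
      by rewrite ler_pdivrMr// mul1r cm.
    by rewrite ler_pM2r ?invr_gt0//; exact: c'.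
  rewrite big_ord_recl /= scalerDr scalerA mulVf ?scale1r ?gt_eqF//.
  congr (_ + _); rewrite scaler_sumr; apply: eq_bigr => i _.
  by rewrite scalerA mulrC.
Qed.

Lemma orthoscheme_polytope (ws : seq V) : is_polytope (orthoscheme ws).
Proof.
elim: ws => [|w ws IH] /=; first exact: polytope_set1.
by apply: polytope_pyramid; exact: polytope_translate.
Qed.

End McMullen.

Lemma chain_set_polytope k n : is_polytope (@chain_set k k n setT).
Proof.
pose es : seq 'rV[R]_k := [seq delta_mx 0 i | i <- enum 'I_k].
have ses : size es = k by rewrite size_map size_enum_ord.
rewrite (_ : chain_set _ _ _ = dil n (orthoscheme es)); last first.
  have sumE (c : nat -> R) : \sum_(i < size es) c i *: es`_i = \row_(i < k) c i.
    rewrite ses; apply/rowP => j; rewrite !mxE summxE (bigD1 j)//= big1 ?addr0.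
      rewrite !mxE (nth_map j) ?size_enum_ord// nth_ord_enum !mxE !eqxx mulr1//.
    move=> i ij; rewrite !mxE (nth_map j) ?size_enum_ord// nth_ord_enum !mxE eqxx.
    by rewrite eq_sym (negbTE ij) mulr0.
  apply/seteqP; split=> [x [[c0 cc] _]|_ [_ /orthoschemeP[c [c0 cc] ->] <-]]; last first.
    rewrite sumE ses in c0 cc *; split=> //.
    have coE a : (a < k)%N -> co (n%:R *: \row_(i < k) c i) a = n%:R * c a.
      by move=> ak; rewrite coZ -[a]/(nat_of_ord (Ordinal ak)) co_ord mxE.
    split=> [a /andP[_ ak]|a b /andP[_ ab] bk].
      rewrite coE//; have /andP[a0 a1] := c0 a ak; rewrite mulr_ge0//=.
      by rewrite -[leRHS]mulr1 ler_wpM2l.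
    by rewrite !coE ?ler_wpM2l//; [exact: cc|exact: leq_ltn_trans bk].
  have [n0|n0] := eqVneq n 0%N.
    exists 0; first exact: orthoscheme0.
    rewrite scaler0; apply/rowP => i; rewrite mxE -co_ord; apply/eqP.
    have /andP[h0 h1] := c0 i (ltn_ord i).
    by rewrite eq_le h0 ?andbT /=; move: h1; rewrite n0.
  have nn0 : n%:R != 0 :> R by rewrite pnatr_eq0.
  have n_gt0 : 0 < n%:R :> R by rewrite ltr0n lt0n.
  exists (n%:R^-1 *: x); last by rewrite scalerA mulfV ?scale1r.
  apply/orthoschemeP; exists (fun a => co x a / n%:R).
    rewrite ses; split=> [a ak|a b ab bk]; last by rewrite ler_pM2r ?invr_gt0//; exact: cc.
    have /andP[a0 a1] := c0 a ak; rewrite divr_ge0//=.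
    by rewrite ler_pdivrMr// mul1r.
  rewrite (sumE (fun a => co x a / n%:R)).
  by apply/rowP => i; rewrite !mxE co_ord mulrC.
by apply: polytope_dilate; exact: orthoscheme_polytope.
Qed.

(** The linear map taking the standard basis to [ws] pulls [Phi] back to a valuation on [R^k], under
    which orthoschemes become order simplices. Freeness of [ws] makes the map injective, hence
    compatible with intersections. *)
Lemma orthoscheme_hdeg d (G : zmodType) (Phi : set 'rV[R]_d -> G) ws :
  set_valuation Phi -> free ws ->
  hdeg (size ws) (fun n => Phi (dil n (orthoscheme ws))).
Proof.
move=> [Phi0 PhiU PhiT] fws; pose k := size ws.
pose L (x : 'rV[R]_k) : 'rV[R]_d := \sum_(i < k) x 0 i *: ws`_i.
have LD x y : L (x + y) = L x + L y.
  by rewrite -big_split; apply: eq_bigr => i _; rewrite mxE scalerDl.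
have LZ (l : R) x : L (l *: x) = l *: L x.
  by rewrite scaler_sumr; apply: eq_bigr => i _; rewrite mxE scalerA.
have Linj x y : L x = L y -> x = y.
  move=> xy; apply/rowP => i; have := congr1 (coord (in_tuple ws) i) xy.
  by rewrite !coord_sum_free.
have Laff : affine_map L by move=> x y l; rewrite LD !LZ.
pose Psi (X : set 'rV[R]_k) := Phi (L @` X).
have vPsi : set_valuation Psi.
  split; first by rewrite /Psi image_set0.
    have LI A B : L @` (A `&` B) = (L @` A) `&` (L @` B).
      apply/seteqP; split=> [_ [x [Ax Bx] <-]|_ [[x Ax <-] [y By /Linj yx]]].
        by split; exists x.
      by exists x => //; split=> //; rewrite -yx.
    move=> A B pA pB pU pI; rewrite /Psi image_setU LI PhiU -?image_setU -?LI//;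
      exact: polytope_affine_image.
  move=> t A pA; rewrite /Psi -(PhiT (L t) (L @` A)); last exact: polytope_affine_image.
  congr Phi; apply/seteqP; split.
    by move=> _ [_ [x Ax <-] <-]; exists (L x); [exists x|rewrite LD].
  by move=> _ [_ [x Ax <-] <-]; exists (t + x); [exists x|rewrite LD].
have := @chain_set_hdeg k G Psi vPsi k setT (leqnn k).
have iT : ignores k (setT : set 'rV[R]_k) by [].
move=> /(_ iT (chain_set_polytope k)); apply: hdeg_eq => n; congr Phi.
apply/seteqP; split.
  move=> _ [x [[c0 cc] _] <-]; have [n0|n0] := eqVneq n 0%N.
    exists 0; first exact: orthoscheme0.
    rewrite scaler0; apply/esym; rewrite /L big1// => i _.
    have -> : x 0 i = 0; last by rewrite scale0r.
    rewrite -co_ord; apply/eqP.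
    have /andP[h0 h1] := c0 i (ltn_ord i).
    by rewrite eq_le h0 ?andbT /=; move: h1; rewrite n0.
  have nn0 : n%:R != 0 :> R by rewrite pnatr_eq0.
  have n_gt0 : 0 < n%:R :> R by rewrite ltr0n lt0n.
  exists (n%:R^-1 *: L x); last by rewrite scalerA mulfV ?scale1r.
  apply/orthoschemeP; exists (fun a => co x a / n%:R).
    split=> [a ak|a b ab bk]; last by rewrite ler_pM2r ?invr_gt0//; exact: cc.
    have /andP[a0 a1] := c0 a ak; rewrite divr_ge0//=.
    by rewrite ler_pdivrMr// mul1r.
  rewrite scaler_sumr; apply: eq_bigr => i _.
  by rewrite scalerA co_ord mulrC.
move=> _ [_ /orthoschemeP[c [c0 cc] ->] <-].
exists (n%:R *: \row_(i < k) c i); last first.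
  by rewrite LZ; congr (_ *: _); apply: eq_bigr => i _; rewrite mxE.
have coE a : (a < k)%N -> co (n%:R *: \row_(i < k) c i) a = n%:R * c a.
  by move=> ak; rewrite coZ -[a]/(nat_of_ord (Ordinal ak)) co_ord mxE.
split=> //; split=> [a /andP[_ ak]|a b /andP[_ ab] bk].
  rewrite coE//; have /andP[a0 a1] := c0 a ak; rewrite mulr_ge0//=.
  by rewrite -[leRHS]mulr1 ler_wpM2l.
by rewrite !coE ?ler_wpM2l//; [exact: cc|exact: leq_ltn_trans bk].
Qed.

(** Bounded degree survives the sum and difference of a cut, so [cut_induction] reduces the claim to
    orthoschemes. *)
Lemma valuation_hdeg d (G : zmodType) (Phi : set 'rV[R]_d -> G)
    (U : {vspace 'rV[R]_d}) P :
  set_valuation Phi -> is_polytope P ->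
  (forall x y, P x -> P y -> x - y \in U) ->
  hdeg (\dim U) (fun n => Phi (dil n P)).
Proof.
move=> vPhi pP PU; have [Phi0 _ PhiT] := vPhi.
move: P pP PU; apply: cut_induction => [|p ws fws wsU|P h pP h1 h2 h3].
- apply: hdeg_eq (hdegW (leq0n _) (hdeg_const 0)) => n.
  by rewrite dil_set0 Phi0.
- apply: (@hdegW _ (size ws)).
    by rewrite -(eqP fws); apply: dimvS; apply/span_subvP.
  apply: hdeg_eq (orthoscheme_hdeg vPhi fws) => n.
  rewrite dil_translate PhiT//.
  by apply: polytope_dilate; exact: orthoscheme_polytope.
apply: hdeg_eq (hdegB (hdegD h1 h2) h3) => -[|n].
  (* At [n = 0] every nonempty piece collapses to [{0}]. Additivity then amounts to that of the
     Euler characteristic: if both sides of the hyperplane meet [P], so does the hyperplane. *)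
  have e0 A : Phi (dil 0 A) = if `[< A !=set0 >] then Phi [set 0] else 0.
    case: asboolP => [/dil0->//|/set0P/negP]; rewrite negbK => /eqP ->.
    by rewrite dil_set0.
  rewrite !e0.
  have [P0|P0] := pselect (P !=set0); last first.
    by rewrite !asboolF ?addr0 ?subr0// => -[x]; rewrite /= => xP; apply: P0; exists x; case: xP.
  have [[x [Px hx]]|Pn] := pselect (P `&` hge h !=set0); last first.
    have -> : P `&` hge (- h) = P.
      apply/seteqP; split=> [x []//|x Px]; split=> //.
      have [//|hx] : hge (- h) x \/ hge h x by have := hge_setU h; move/seteqP=> [_ /(_ x I)] []; [right|left].
      by case: Pn; exists x.
    rewrite [`[< P `&` hge h !=set0 >]]asboolF// [`[< P `&` heq h !=set0 >]]asboolF ?add0r ?subr0//.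
    by move=> [x [Px hx]]; apply: Pn; exists x; split=> //; rewrite /hge /= hx.
  have [[y [Py hy]]|Pn] := pselect (P `&` hge (- h) !=set0); last first.
    have -> : P `&` hge h = P.
      apply/seteqP; split=> [z []//|z Pz]; split=> //.
      have [//|hz] : hge h z \/ hge (- h) z by have := hge_setU h; move/seteqP=> [_ /(_ z I)] []; [left|right].
      by case: Pn; exists z.
    rewrite [`[< P `&` hge (- h) !=set0 >]]asboolF// [`[< P `&` heq h !=set0 >]]asboolF ?addr0 ?subr0//.
    by move=> [z [Pz hz]]; apply: Pn; exists z; split=> //; rewrite /hge /= aevalN hz oppr0.
  rewrite !asboolT ?addrK//; [|by exists y|by exists x].
  move: hx hy; rewrite /hge /= aevalN oppr_ge0 => hx hy.
  have [e|ne] := eqVneq (aeval h x) 0; first by exists x.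
  have D0 : 0 < aeval h x - aeval h y.
    by rewrite subr_gt0 (le_lt_trans hy)// lt_def ne.
  (* The point where the segment from [x] to [y] crosses the hyperplane. *)
  exists ((- aeval h y / (aeval h x - aeval h y)) *: x +
          (aeval h x / (aeval h x - aeval h y)) *: y).
  have e1 : - aeval h y / (aeval h x - aeval h y) +
      aeval h x / (aeval h x - aeval h y) = 1.
    by rewrite -mulrDl addrC mulfV ?gt_eqF.
  split; last by rewrite /heq /= aeval_conv//; field; rewrite gt_eqF.
  apply: (@convex2 _ _ P) => //; first exact: polytope_convex.
    by rewrite divr_ge0 ?oppr_ge0 ?(ltW D0).
  by rewrite divr_ge0 ?(ltW D0).
pose k : 'rV[R]_d * R := (h.1, n.+1%:R * h.2).
have n0 : 0 < n.+1%:R :> R by rewrite ltr0n.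
have kE x : aeval k (n.+1%:R *: x) = n.+1%:R * aeval h x.
  by rewrite /aeval /= dotZr mulrDr.
have pD : is_polytope (dil n.+1 P) by exact: polytope_dilate.
rewrite (valuation_cut k vPhi pD); congr (Phi _ + Phi _ - Phi _);
  apply/seteqP; split.
- by move=> _ [x [Px hx] <-]; split; [exists x|rewrite /hge /= kE mulr_ge0// ltW].
- move=> _ [[x Px <-]]; rewrite /hge /= kE pmulr_rge0// => hx.
  by exists x.
- move=> _ [x [Px hx] <-]; split; [by exists x|rewrite /hge /= aevalN kE -mulrN].
  by rewrite mulr_ge0 ?(ltW n0)// -aevalN.
- move=> _ [[x Px <-]]; rewrite /hge /= aevalN kE -mulrN pmulr_rge0// => hx.
  by exists x => //; split=> //; rewrite /= aevalN.
- by move=> _ [x [Px hx] <-]; split; [exists x|rewrite /heq /= kE hx mulr0].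
- move=> _ [[x Px <-]]; rewrite /heq /= kE => /eqP.
  by rewrite mulf_eq0 (gt_eqF n0) /= => /eqP hx; exists x.
Qed.

End SetValuations.

(** * Consequences of weak h*-monotonicity *)

Section ClosedCones.
Context {R : realType} {G : vectType R}.

(** The sum is a polynomial in [1 / (m + 1)], which tends to its constant term. The limit is taken
    on coordinate rows, where closedness is defined. *)
Lemma closed_cone_limit (C : set G) (N : nat) (c : nat -> G) :
  closed_in_vect C ->
  (forall m : nat, C (\sum_(j < N) (m.+1%:R^-1 ^+ j) *: c j)) ->
  (0 < N)%N -> C (c 0%N).
Proof.
move=> clC hC; case: N hC => // N hC _.
pose co_row (v : G) : 'rV[R]_(\dim {:G}) := \row_i coord (vbasis {:G}) i v.
pose B := [set u : 'rV[R]_(\dim {:G}) |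
    C (\sum_(i < \dim {:G}) u 0 i *: (vbasis {:G})`_i)].
have coE v : B (co_row v) <-> C v.
  rewrite /B /= [X in C X](_ : _ = v)//.
  rewrite [RHS](coord_vbasis (memvf v)); apply: eq_bigr => i _.
  by rewrite !mxE.
apply/coE.
pose f (m : nat) := co_row (c 0%N) + \sum_(j < N) (m.+1%:R^-1 ^+ j.+1) *: co_row (c j.+1).
have cvgf : f @ \oo --> co_row (c 0%N).
  rewrite -[X in _ --> X]addr0 /f; apply: cvgD; first exact: cvg_cst.
  have cvg0 (g : nat -> nat -> 'rV[R]_(\dim {:G})) :
      (forall j, g j @ \oo --> (0 : 'rV[R]_(\dim {:G}))) ->
      (fun m => \sum_(j < N) g j m) @ \oo --> (0 : 'rV[R]_(\dim {:G})).
    move=> g0; elim: (N) => [|n IH].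
      rewrite (_ : (fun m => _) = (fun=> 0)); first exact: cvg_cst.
      by apply/funext => m; rewrite big_ord0.
    rewrite (_ : (fun m => _) = (fun m => \sum_(j < n) g j m) \+ g n).
      have h := cvgD IH (g0 n); rewrite addr0 in h; exact: h.
    by apply/funext => m; rewrite big_ord_recr.
  apply: (cvg0 (fun j m => (m.+1%:R^-1 ^+ j.+1) *: co_row (c j.+1))) => j.
  rewrite -(scale0r (co_row (c j.+1))).
  apply: cvgZr_tmp; rewrite -[X in _ --> X](expr0n R j.+1).
  have -> : (fun m : nat => m.+1%:R^-1 ^+ j.+1 : R) = (fun x : R => x ^+ j.+1) \o @harmonic R.
    by [].
  apply: (cvg_comp _ _ (@cvg_harmonic R)).
  exact: exprn_continuous.
apply: (@closed_cvg _ _ _ _ f B clC _ _ cvgf).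
apply: nearW => m.
have -> : f m = co_row (\sum_(j < N.+1) (m.+1%:R^-1 ^+ j) *: c j).
  apply/rowP => i; rewrite big_ord_recl expr0 scale1r /f !mxE summxE linearD linear_sum.
  congr (_ + _); apply: eq_bigr => j _; rewrite !mxE linearZ //.
exact/coE.
Qed.

End ClosedCones.

(** * Extension to sets, affine dimension, computation of [hstar] *)

Section Extension.
Context {R : realType} {d : nat} {G : vectType R}.
Local Notation V := 'rV[R]_d.
Implicit Types (P Q : polytope R d).

Lemma polytope_inj P Q : (P : set V) = Q -> P = Q.
Proof.
case: P Q => A pA [B pB] /= AB; subst B; congr Polytope; exact: Prop_irrelevance.
Qed.

(* Junk value 0 on sets that are not polytopes. *)
Definition ext (phi : polytope R d -> G) (A : set V) : G :=
  if pselect (is_polytope A) is left pA then phi (Polytope pA) else 0.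

Lemma extE phi P : ext phi P = phi P.
Proof.
rewrite /ext; case: pselect => [pA|]; last by have := polytopeP P.
by congr phi; exact: polytope_inj.
Qed.

Lemma ext_polytopeE phi A (pA : is_polytope A) : ext phi A = phi (Polytope pA).
Proof. by rewrite -extE. Qed.

Lemma ext_valuation phi : valuation phi -> set_valuation (ext phi).
Proof.
move=> [phi0 phiU phiT]; split.
- by rewrite (ext_polytopeE _ (@is_polytope0 R d)).
- by move=> A B pA pB pU pI; rewrite !ext_polytopeE; exact: phiU.
- move=> t A pA; rewrite (ext_polytopeE _ (polytope_translate t pA)) (ext_polytopeE _ pA).
  by rewrite -[RHS](phiT t); apply: (congr1 phi); exact: polytope_inj.
Qed.

Definition spans (U : {vspace V}) (A : set V) : Prop :=
  forall x y, A x -> A y -> x - y \in U.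

Lemma big_minn_in (I : Type) (s : seq I) (p : pred I) (F : I -> nat) x0 (K : nat -> Prop) :
  K x0 -> (forall i, p i -> K (F i)) -> K (\big[minn/x0]_(i <- s | p i) F i).
Proof.
move=> K0 KF; elim/big_ind: _ => // m n Km Kn.
by rewrite /minn; case: ifP.
Qed.

Lemma big_minn_le (I : eqType) (s : seq I) (p : pred I) (F : I -> nat) x0 j :
  j \in s -> p j -> (\big[minn/x0]_(i <- s | p i) F i <= F j)%N.
Proof.
elim: s => // i s IH; rewrite inE big_cons => /orP[/eqP<- ->|js pj].
  exact: geq_minl.
by case: ifP => _; [apply: leq_trans (geq_minr _ _) _|]; exact: IH.
Qed.

Lemma aff_dimP P : (exists2 U, \dim U = aff_dim P & spans U P) /\
  (forall U, spans U P -> (aff_dim P <= \dim U)%N).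
Proof.
split=> [|U sU].
  apply: (@big_minn_in _ _ _ _ _ (fun k => exists2 U : {vspace V}, \dim U = k & spans U P)) => [|i /asboolP[U dU sU]]; last by exists U.
  by exists fullv; [rewrite dimvf /dim /= mul1n|move=> x y *; exact: memvf].
have dU : (\dim U < d.+1)%N.
  by rewrite ltnS (leq_trans (dimvS (subvf U)))// dimvf /dim /= mul1n.
have := @big_minn_le _ (index_enum 'I_d.+1) (fun k : 'I_d.+1 => `[< exists2 U : {vspace V}, \dim U = k &
      spans U P >]) (@nat_of_ord _) d (Ordinal dU).
by apply; [exact: mem_index_enum|apply/asboolP; exists U].
Qed.

Lemma aff_dim_le P : (aff_dim P <= d)%N.
Proof.
have [[U <- _] _] := aff_dimP P.
by rewrite (leq_trans (dimvS (subvf U)))// dimvf /dim /= mul1n.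
Qed.

Lemma aff_dim_eq P r :
  (exists2 U, \dim U = r & spans U P) -> (forall U, spans U P -> (r <= \dim U)%N) ->
  aff_dim P = r.
Proof.
have [[U dU sU] mU] := aff_dimP P => -[U' dU' sU'] mU'.
by apply/eqP; rewrite eqn_leq -{1}dU' mU//= -dU mU'.
Qed.

(** By uniqueness of the expansion, the vector chosen by [xget] agrees with any explicit one. *)
Lemma hstarE (phi : polytope R d -> G) P r h i : aff_dim P = r ->
  (forall n, phi (dilate n P) = hexp r h n) -> (i <= r)%N -> hstar phi i P = h i.
Proof.
move=> <- hE ir; rewrite /hstar.
have ir' : (i < (aff_dim P).+1)%N by [].
rewrite insubT /=.
have : is_hstar_vector phi P [ffun i : 'I_(aff_dim P).+1 => h i].
  by move=> n; rewrite hE; apply: eq_bigr => j _; rewrite ffunE.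
move=> /(@xgetI _ 0 [set h | is_hstar_vector phi P h]) /=; set h' := xget _ _ => h'P.
have -> : h' (Ordinal ir') = h' (inord i) by congr (h' _); apply: val_inj; rewrite /= inordK.
apply: (@hexp_unique _ (aff_dim P) (fun i => h' (inord i)) h) => // n.
rewrite -hE h'P; apply: eq_bigr => j _; congr (h' _ *+ _).
by apply: val_inj; rewrite /= inordK.
Qed.

Lemma is_polytope_scale (c : R) (A : set V) : is_polytope A ->
  is_polytope [set c *: x | x in A].
Proof.
apply: polytope_affine_image => x y l; rewrite scalerDr !scalerA.
by rewrite mulrC [c * (1 - l)]mulrC.
Qed.

Definition scale_polytope (c : R) P := Polytope (is_polytope_scale c (polytopeP P)).

(** Direction spaces see differences only. Besides translations and dilations this covers
    inclusions, with [f] the identity. *)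
Lemma aff_dim_bij (f : V -> V) P Q :
  (forall x, polytope_set P x -> polytope_set Q (f x)) ->
  (exists2 c : R, c != 0 & forall x y, f x - f y = c *: (x - y)) ->
  (aff_dim P <= aff_dim Q)%N.
Proof.
move=> fPQ [c c0 fE]; have [[U <- sU] _] := aff_dimP Q.
have [_] := aff_dimP P; apply => x y Px Py.
have := sU _ _ (fPQ _ Px) (fPQ _ Py); rewrite fE => /(memvZ c^-1).
by rewrite scalerA mulVf// scale1r.
Qed.

Lemma aff_dim_scale (c : R) P : c != 0 -> aff_dim (scale_polytope c P) = aff_dim P.
Proof.
move=> c0; apply/eqP; rewrite eqn_leq; apply/andP; split.
  apply: (@aff_dim_bij (fun x => c^-1 *: x)).
    by move=> _ [x Px <-]; rewrite scalerA mulVf// scale1r.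
  by exists c^-1; [rewrite invr_eq0|move=> x y; rewrite scalerBr].
apply: (@aff_dim_bij (fun x => c *: x)) => [x Px|]; first by exists x.
by exists c => // x y; rewrite scalerBr.
Qed.

Lemma aff_dim_translate t P : aff_dim (translate t P) = aff_dim P.
Proof.
apply/eqP; rewrite eqn_leq; apply/andP; split.
  apply: (@aff_dim_bij (fun x => - t + x)).
    by move=> _ [x Px <-]; rewrite addrA addNr add0r.
  exists 1; first exact: oner_neq0.
  by move=> x y; rewrite scale1r opprD addrACA subrr add0r.
apply: (@aff_dim_bij (fun x => t + x)) => [x Px|]; first by exists x.
exists 1; first exact: oner_neq0.
by move=> x y; rewrite scale1r opprD addrACA subrr add0r.
Qed.

End Extension.

Section Homogeneity.
Context {R : realType} {d : nat} {G : vectType R}.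
Local Notation V := 'rV[R]_d.
Implicit Types (P Q : polytope R d).
Variables (C : set G) (C_cone : convex_cone C) (C_pointed : pointed_cone C).
Variable C_closed : closed_in_vect C.
Variables (phi : polytope R d -> G) (vphi : valuation phi).
Variable (mphi : weakly_hstar_monotone C phi).

Let phi0 := phi origin_polytope.

Lemma hstar_mono P Q i : P `<=` Q -> (P : set V) !=set0 -> aff_dim P = aff_dim Q ->
  (i <= d)%N -> C (hstar phi i Q - hstar phi i P).
Proof.
move=> PQ [x Px] dPQ id; case: mphi => _; apply=> //.
rewrite /pdim !asboolF ?dPQ// => /seteqP[+ _]; first by move=> /(_ x (PQ _ Px)).
by move=> /(_ x Px).
Qed.

Lemma phi_dilate_mexp P : exists a, forall n, phi (dilate n P) = mexp (aff_dim P) a n.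
Proof.
have [[U dU sU] _] := aff_dimP P.
have /hdeg_mexp[a aE] := valuation_hdeg (ext_valuation vphi) (polytopeP P) sU.
by exists a => n; rewrite -dU -aE -extE.
Qed.

Lemma power_hexps r : exists e : nat -> nat -> R,
  forall j, (j <= r)%N -> forall n : nat, n%:R ^+ j = hexp r (e j) n.
Proof.
have H j : exists e : nat -> R, (j <= r)%N ->
    forall n : nat, n%:R ^+ j = hexp r e n.
  have [jr|rj] := leqP j r; last by exists (fun=> 0).
  move: jr; rewrite leq_eqVlt => /orP[/eqP->|/(@hexp_small_power R)[e eE _]].
    by have [e _ eE] := @power_hexp R r; exists e.
  by exists e.
by have [e eE] := choice H; exists e.
Qed.

(* In the binomial basis of degree r, a monomial n^j with j < r has
   coefficients of both signs; letting the polytope shrink to a point isolates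
   the lowest nonzero term, which must then vanish as C is pointed. *)
Lemma phi_lower_coef P a : (P : set V) 0 ->
  (forall n, phi (dilate n P) = mexp (aff_dim P) a n) ->
  forall j, (0 < j < aff_dim P)%N -> a j = 0.
Proof.
move=> P0 aE j; set r := aff_dim P in aE *.
have [m] := ubnP j; elim: m j => // m IH j; rewrite ltnS => jm /andP[j0 jr].
pose S (t : nat) := scale_polytope (t.+1%:R^-1) P.
have t0 (t : nat) : t.+1%:R^-1 != 0 :> R by rewrite invr_eq0 pnatr_eq0.
have dS t : aff_dim (S t) = r by exact: aff_dim_scale.
(* The dilates of [S t] by multiples of [t.+1] are dilates of [P]; this determines the coefficients
   for [S t] from those for [P]. *)
have SE t n : phi (dilate n (S t)) = mexp r (fun l => t.+1%:R^-1 ^+ l *: a l) n.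
  have [b bE] := phi_dilate_mexp (S t); rewrite dS in bE.
  have tb : mexp r (fun l => t.+1%:R ^+ l *: b l) =1 mexp r a.
    move=> k; rewrite -aE; transitivity (phi (dilate (k * t.+1) (S t))).
      rewrite bE /mexp; apply: eq_bigr => l _.
      by rewrite scalerA natrM exprMn.
    apply: (congr1 phi); apply: polytope_inj; apply/seteqP; split.
      move=> _ [_ [x Px <-] <-]; exists x => //.
      by rewrite natrM scalerA mulfK// pnatr_eq0.
    move=> _ [x Px <-]; exists (t.+1%:R^-1 *: x); first by exists x.
    by rewrite natrM scalerA mulfK// pnatr_eq0.
  rewrite bE; apply: eq_bigr => l _; congr (_ *: _).
  have <- := mexp_inj tb (ltn_ord l : (l <= r)%N).
  by rewrite scalerA -exprMn mulVf ?pnatr_eq0// expr1n scale1r.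
have [e eE] := power_hexps r.
have [ej ejE [i1 [i2 [i1r i2r ei1 ei2]]]] := @hexp_small_power_signs R _ _ jr.
have ejj i : (i <= r)%N -> e j i = ej i.
  by move=> ir; apply: (@hexp_unique _ r (e j) ej) => // n; rewrite -ejE -eE// ltnW.
have hS t i : (i <= r)%N ->
    hstar phi i (S t) = \sum_(l < r.+1) (e l i * t.+1%:R^-1 ^+ l) *: a l.
  move=> ir; apply: (@hstarE _ _ _ _ _ r (fun i => \sum_(l < r.+1) (e l i * t.+1%:R^-1 ^+ l) *: a l)) => // n.
  rewrite SE /mexp /hexp; under [RHS]eq_bigr do rewrite -sumrMnl.
  rewrite exchange_big; apply: eq_bigr => l _ /=.
  rewrite (eE l _ n) ?scaler_suml; last by rewrite -ltnS.
  by apply: eq_bigr => i' _; rewrite scalerA mulrnAl -scalerMnl.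
(* Compare P / (t + 1) with its half. The constant terms cancel and the other terms below degree [j]
   vanish by induction; multiplied by [(t + 1)^j], the difference tends to the term of degree [j].
   Halving produces the factor [1 - 2^-j]. *)
have key i : (i <= r)%N -> C ((e j i * (1 - 2^-1 ^+ j)) *: a j).
  move=> ir; pose c l := (e (j + l)%N i * (1 - 2^-1 ^+ (j + l))) *: a (j + l)%N.
  rewrite -[j]addn0; apply: (@closed_cone_limit _ _ _ (r.+1 - j)%N c) => //; last first.
    by rewrite subn_gt0 ltnS ltnW.
  move=> t; have St : S (2 * t.+1).-1 `<=` S t.
    move=> _ [x Px <-]; exists (2^-1 *: x).
      have /polytope_convex/convex_setP cP := polytopeP P.
      have -> : 2^-1 *: x = 2^-1 *: x + (1 - 2^-1) *: 0 :> V by rewrite scaler0 addr0.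
      by apply: cP => //; rewrite ?invr_ge0// invf_le1// ler1n.
    rewrite scalerA prednK ?muln_gt0// natrM invfM mulrC//.
  have := @hstar_mono _ _ i St; rewrite !dS => /(_ _ erefl) hd.
  have {}hd : C (hstar phi i (S t) - hstar phi i (S (2 * t.+1).-1)).
    apply: hd; first by exists 0; exists 0 => //; rewrite scaler0.
    exact: leq_trans ir (aff_dim_le P).
  have [_ _ CZ] := C_cone.
  have := CZ (t.+1%:R ^+ j) _ (exprn_ge0 _ (ler0n _ _)) hd.
  rewrite !hS// -sumrB scaler_sumr.
  congr C; rewrite -(big_mkord xpredT (fun l => t.+1%:R ^+ j *: ((e l i * t.+1%:R^-1 ^+ l) *: a l -
    (e l i * (2 * t.+1).-1.+1%:R^-1 ^+ l) *: a l))).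
  rewrite (@big_cat_nat _ _ _ j)//; last exact: leqW (ltnW jr).
  rewrite big_nat big1.
    rewrite [LHS]add0r -{1}[j]add0n big_addn big_mkord; apply: eq_bigr => l _.
    rewrite /c [(j + l)%N]addnC -scalerBl !scalerA; congr (_ *: _).
    rewrite prednK ?muln_gt0// natrM invfM exprMn exprD.
    have tj : t.+1%:R ^+ j * t.+1%:R^-1 ^+ j = 1 :> R.
      by rewrite -exprMn mulfV ?expr1n ?pnatr_eq0.
    transitivity ((t.+1%:R ^+ j * t.+1%:R^-1 ^+ j) *
        (e (l + j)%N i * t.+1%:R^-1 ^+ l * (1 - 2^-1 ^+ (l + j)))); first by ring.
    by rewrite tj; ring.
  move=> [|l] /andP[_ lj].
    by rewrite !expr0 subrr scaler0.
  rewrite (IH l.+1) ?scaler0 ?subrr ?scaler0//.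
    exact: leq_trans lj jm.
  exact: ltn_trans lj jr.
have pos : 0 < 1 - 2^-1 ^+ j :> R.
  by rewrite subr_gt0 exprn_ilt1 ?invr_ge0// ?invf_lt1 ?ltr1n// -lt0n.
have [_ _ CZ] := C_cone.
apply: C_pointed.
  have := CZ (ej i1 * (1 - 2^-1 ^+ j))^-1 _ _ (key i1 i1r).
  rewrite ejj// scalerA mulVf ?scale1r; first by apply; rewrite invr_ge0 mulr_ge0// ltW.
  by rewrite mulf_neq0// gt_eqF.
have := CZ (- (ej i2 * (1 - 2^-1 ^+ j))^-1) _ _ (key i2 i2r).
rewrite ejj// scalerA mulNr mulVf ?scaleN1r; first apply.
  by rewrite oppr_ge0 invr_le0 mulr_le0_ge0// ltW.
by rewrite mulf_neq0// ?(gt_eqF pos)// lt_eqF.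
Qed.

Lemma phi_homogeneous P n : (P : set V) !=set0 ->
  phi (dilate n P) = phi0 + n%:R ^+ (aff_dim P) *: (phi P - phi0).
Proof.
move=> [p Pp]; pose Q := translate (- p) P.
have [_ _ phiT] := vphi.
have Q0 : (Q : set V) 0 by exists p => //; rewrite addNr.
have nQ k : phi (dilate k P) = phi (dilate k Q).
  rewrite -(phiT (k%:R *: - p)); apply: (congr1 phi); apply: polytope_inj.
  exact/esym/dil_translate.
have <- : aff_dim Q = aff_dim P by exact: aff_dim_translate.
have <- : phi Q = phi P by exact: phiT.
rewrite nQ; have [a aE] := phi_dilate_mexp Q.
have a0 := phi_lower_coef Q0 aE.
have Qz : phi (dilate 0 Q) = phi0.
  apply: (congr1 phi); apply: polytope_inj; apply: dil0; by exists 0.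
have Q1 : phi (dilate 1 Q) = phi Q.
  apply: (congr1 phi); apply: polytope_inj; apply/seteqP; split=> [_ [x Qx <-]|x Qx].
    by rewrite scale1r.
  by exists x => //; rewrite scale1r.
set r := aff_dim Q in aE a0 *.
have rE k : (0 < r)%N -> mexp r a k = a 0%N + k%:R ^+ r *: a r.
  case: (r) a0 => // r' a0 _.
  rewrite /mexp big_ord_recr big_ord_recl /= expr0 scale1r big1 ?addr0// => i _.
  by have ir := ltn_ord i; rewrite a0 ?scaler0//= /bump; lia.
(* In degree 0 the constant term and the leading term are the same coefficient. *)
have [r0|r0] := posnP r.
  have cst k : mexp r a k = a 0%N by rewrite r0 /mexp big_ord1 expr0 scale1r.
  by rewrite r0 expr0 scale1r subrKC -Q1 !aE !cst.
rewrite -Q1 -Qz !aE !rE// expr0n (gtn_eqF r0) scale0r addr0 expr1n scale1r.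
by rewrite [a 0%N + a r]addrC addrK.
Qed.

End Homogeneity.

(** * Prisms and the values on polytopes of lower dimension *)

Section Prisms.
Context {R : realType} {d : nat}.
Local Notation V := 'rV[R]_d.
Implicit Types (P Q : polytope R d).

Definition prism_polytope P w := Polytope (polytope_prism w (polytopeP P)).

(** A direction space of the prism contains [w], and it contains [U] too: intersecting it with [U]
    still gives a direction space of [P], whose dimension cannot be smaller. *)
Lemma aff_dim_prism P U w (c : R) : (P : set V) !=set0 -> \dim U = aff_dim P -> spans U P ->
  w \notin U -> c != 0 -> aff_dim (prism_polytope P (c *: w)) = (aff_dim P).+1.
Proof.
move=> [p Pp] dU sU wU c0.
have [_ minU] := aff_dimP P.
apply: aff_dim_eq => [|U' sU'].
  exists (U + <[w]>)%VS; last first.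
    move=> x y [t _ Px] [u _ Py].
    have -> : x - y = (x - t *: (c *: w) - (y - u *: (c *: w))) + ((t - u) * c) *: w.
      by rewrite -scalerA scalerBl opprB addrACA [RHS]addrAC addrACA; apply/rowP => i; rewrite !mxE; ring.
    by rewrite memv_add ?sU// memvZ// memv_line.
  rewrite dimv_disjoint_sum ?dim_vline ?dU; last first.
    apply/eqP; rewrite -subv0; apply/subvP => v; rewrite memv_cap memv0 => /andP[vU /vlineP[k vk]].
    apply/eqP; rewrite vk; have [->|k0] := eqVneq k 0; first by rewrite scale0r.
    have : w \in U by rewrite -[w](scalerK k0) -vk memvZ.
    by rewrite (negbTE wU).
  have -> : w != 0 by apply: contra wU => /eqP->; exact: mem0v.
  by rewrite addn1.
have PU' : spans (U :&: U')%VS P.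
  move=> x y Px Py; rewrite memv_cap sU//= sU'//; exists 0; rewrite ?lexx ?ler01//;
    by rewrite scale0r subr0.
have UU' : (U <= U')%VS.
  have e : (U :&: U')%VS = U.
    by apply/eqP; rewrite eqEdim capvSl /= dU minU.
  by rewrite -e capvSr.
have wU' : w \in U'.
  have : c *: w \in U'.
    rewrite -[c *: w](addrK p); apply: sU'.
      by exists 1; rewrite ?lexx ?ler01// scale1r addrAC subrr add0r.
    by exists 0; rewrite ?lexx ?ler01// scale0r subr0.
  by move=> /(memvZ c^-1); rewrite scalerA mulVf// scale1r.
rewrite -dU ltn_neqAle dimvS// andbT; apply/eqP => e.
have eU : U = U' by apply/eqP; rewrite eqEdim UU' e leqnn.
by move: wU; rewrite eU wU'.
Qed.

End Prisms.

Section LowDimension.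
Context {R : realType} {d : nat} {G : vectType R}.
Local Notation V := 'rV[R]_d.
Implicit Types (P Q : polytope R d).
Variables (C : set G) (C_cone : convex_cone C) (C_pointed : pointed_cone C).
Variable C_closed : closed_in_vect C.
Variables (phi : polytope R d -> G) (vphi : valuation phi).
Variable (mphi : weakly_hstar_monotone C phi).

Let phi0 := phi origin_polytope.

(** Stack translates of the prism of height [w]: consecutive ones meet in just a translate of [P],
    because [w] is not a direction of [P]. *)
Lemma phi_prism P U w (s : nat) : spans U P -> w \notin U ->
  phi (prism_polytope P (s.+1%:R *: w)) + phi P *+ s = phi (prism_polytope P w) *+ s.+1.
Proof.
move=> sU wU; have [_ phiU phiT] := vphi.
elim: s => [|s IH].
  rewrite mulr0n addr0 mulr1n; apply: (congr1 phi); apply: polytope_inj.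
  by rewrite /= scale1r.
pose I := translate (s.+1%:R *: w) P.
pose Q := translate (s.+1%:R *: w) (prism_polytope P w).
have s0 : 0 < s.+1%:R :> R by rewrite ltr0n.
have ss0 : 0 < s.+2%:R :> R by rewrite ltr0n.
have sS : s.+2%:R = s.+1%:R + 1 :> R by rewrite -natr1.
suff H : phi (prism_polytope P (s.+2%:R *: w)) + phi P =
    phi (prism_polytope P (s.+1%:R *: w)) + phi (prism_polytope P w).
  by rewrite [phi P *+ _]mulrS addrA H addrAC IH [RHS]mulrSr.
rewrite -[phi P](phiT (s.+1%:R *: w)) -[phi (prism_polytope P w)](phiT (s.+1%:R *: w)).
apply: phiU.
- apply/seteqP; split.
    move=> x [t /andP[t0 t1] Px]; have [ts|ts] := leP (t * s.+2%:R) s.+1%:R.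
      left; exists (t * s.+2%:R / s.+1%:R).
        by rewrite divr_ge0 ?mulr_ge0 ?(ltW s0) ?(ltW ss0)//= ler_pdivrMr// mul1r.
      by rewrite scalerA mulfVK ?gt_eqF// -scalerA.
    right; exists (x - s.+1%:R *: w); last by rewrite subrKC.
    exists (t * s.+2%:R - s.+1%:R).
      have := ler_wpM2r (ltW ss0) t1; rewrite mul1r {2}sS.
      by move: ts; lra.
    by rewrite -addrA -opprD -scalerDl subrKC -scalerA.
  move=> x [[t /andP[t0 t1] Px]|[y [t /andP[t0 t1] Py] <-]].
    exists (t * s.+1%:R / s.+2%:R).
      rewrite divr_ge0 ?mulr_ge0 ?(ltW s0) ?(ltW ss0)//= ler_pdivrMr// mul1r.
      by have := ler_wpM2r (ltW s0) t1; rewrite mul1r sS; lra.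
    by rewrite scalerA mulfVK ?gt_eqF// -scalerA.
  exists ((s.+1%:R + t) / s.+2%:R).
    rewrite divr_ge0 ?addr_ge0 ?(ltW s0) ?(ltW ss0)//= ler_pdivrMr// mul1r sS.
    by rewrite lerD2l.
  rewrite scalerA mulfVK ?gt_eqF// scalerDl opprD addrA.
  by rewrite [s.+1%:R *: w + y]addrC addrK.
- apply/seteqP; split.
    move=> _ [x Px <-]; split.
      exists 1; first by rewrite lexx ler01.
      by rewrite scale1r addrAC subrr add0r.
    by exists x => //; exists 0; rewrite ?lexx ?ler01// scale0r subr0.
  move=> x [[t /andP[t0 t1] Px] [y [u /andP[u0 u1] Py] xE]].
  have := sU _ _ Px Py; rewrite -xE.
  have -> : s.+1%:R *: w + y - t *: (s.+1%:R *: w) - (y - u *: w) =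
      (s.+1%:R * (1 - t) + u) *: w by apply/rowP => i; rewrite !mxE; ring.
  have [e _|c0] := eqVneq (s.+1%:R * (1 - t) + u) 0; last first.
    by move=> /(memvZ (s.+1%:R * (1 - t) + u)^-1); rewrite scalerA mulVf// scale1r (negbTE wU).
  have u_0 : u = 0.
    have t1' : 0 <= 1 - t by rewrite subr_ge0.
    have := mulr_ge0 (ltW s0) t1' => h.
    by apply/eqP; rewrite eq_le u0 andbT; lra.
  by exists y => //; move: Py; rewrite u_0 scale0r subr0.
Qed.

Lemma notin_of_dim (U : {vspace V}) : (\dim U < d)%N -> exists w, w \notin U.
Proof.
move=> dU; apply: contrapT => no.
have : (fullv <= U)%VS.
  by apply/subvP => w _; apply: contrapT => /negP wU; apply: no; exists w.
move=> /dimvS; rewrite dimvf /dim /= mul1n => h.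
by have := leq_ltn_trans h dU; rewrite ltnn.
Qed.

(* With [r = dim P], the prisms P + [0, w] and P + [0, 2 w] are homogeneous of
   degree [r + 1] and P of degree [r]; doubling both prisms gives two affine
   equations whose only solution is [phi P = phi {0}]. *)
Lemma phi_low_dim P : (P : set V) !=set0 -> (aff_dim P < d)%N -> phi P = phi0.
Proof.
move=> P0 Pd; have [[U dU sU] _] := aff_dimP P.
have [w wU] : exists w, w \notin U by apply: notin_of_dim; rewrite dU.
pose P2 := dilate 2 P.
have sU2 : spans U P2.
  by move=> _ _ [x Px <-] [y Py <-]; rewrite -scalerBr memvZ ?sU.
pose Q s := prism_polytope P (s%:R *: w).
pose Q2 s := prism_polytope P2 (s%:R *: w).
have Q0 s : (Q s : set V) !=set0.
  by case: P0 => p Pp; exists p; exists 0; rewrite ?lexx ?ler01// scale0r subr0.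
have QE s : dilate 2 (Q s) = Q2 (2 * s)%N.
  apply: polytope_inj; apply/seteqP; split.
    move=> _ [x [t t01 Px] <-]; exists t => //; exists (x - t *: (s%:R *: w)) => //.
    by rewrite scalerBr natrM !scalerA; congr (_ - _ *: _); ring.
  move=> x [t t01 [y Py yE]]; exists (y + t *: (s%:R *: w)).
    by exists t => //; rewrite addrK.
  by rewrite scalerDr yE natrM !scalerA; apply/rowP => i; rewrite !mxE; ring.
have dQ s : aff_dim (Q s.+1) = (aff_dim P).+1.
  by apply: (aff_dim_prism P0 dU sU wU); rewrite pnatr_eq0.
have hom X n := @phi_homogeneous _ _ _ _ C_cone C_pointed C_closed _ vphi mphi X n.
pose p := phi P - phi0; pose q := phi (Q 1%N) - phi0; pose x := phi (prism_polytope P2 w) - phi0.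
have Q1E : phi (Q 1%N) = phi (prism_polytope P w).
  by apply: (congr1 phi); apply: polytope_inj; rewrite /= scale1r.
have pP2 : phi P2 = phi0 + 2 ^+ aff_dim P *: p by exact: hom.
have e2 : phi (Q 2%N) - phi0 = q *+ 2 - p.
  have := phi_prism 1 sU wU; rewrite -/(Q 2%N) -Q1E mulr1n => /(canRL (addrK _)) ->.
  by rewrite /q /p mulrnBl [phi0 *+ 2]mulr2n opprD opprB !addrA subrK addrAC.
have xE : phi (prism_polytope P2 w) = x + phi0 by rewrite subrK.
have h1 : 2 ^+ (aff_dim P).+1 *: q = x *+ 2 - 2 ^+ aff_dim P *: p.
  have := hom (Q 1%N) 2%N (Q0 1%N); rewrite (QE 1%N : _ = Q2 2%N) dQ -/q -/phi0 => E.
  have := phi_prism 1 sU2 wU; rewrite -/(Q2 2%N) E pP2 mulr1n xE mulrnDl => h.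
  have : (phi0 + 2 ^+ (aff_dim P).+1 *: q + (phi0 + 2 ^+ aff_dim P *: p)) - phi0 *+ 2 = x *+ 2.
    by rewrite h addrK.
  by move=> <-; rewrite addrACA -mulr2n [phi0 *+ 2 + _]addrC !addrK.
have h2 : 2 ^+ (aff_dim P).+1 *: (q *+ 2 - p) = x *+ 4 - (2 ^+ aff_dim P *: p) *+ 3.
  have := hom (Q 2%N) 2%N (Q0 2%N); rewrite (QE 2%N : _ = Q2 4%N) dQ e2 -/phi0 => E.
  have := phi_prism 3 sU2 wU; rewrite -/(Q2 4%N) E pP2 xE [(phi0 + _) *+ 3]mulrnDl [(x + phi0) *+ _]mulrnDl => h.
  have : (phi0 + 2 ^+ (aff_dim P).+1 *: (q *+ 2 - p) +
     (phi0 *+ 3 + (2 ^+ aff_dim P *: p) *+ 3)) - phi0 *+ 4 = x *+ 4.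
    by rewrite h addrK.
  by move=> <-; rewrite addrACA -mulrS [phi0 *+ 4 + _]addrC !addrK.
(* Twice [h1] minus [h2] eliminates [q] and [x] and leaves [y *+ 2 = y]. *)
pose y := 2 ^+ aff_dim P *: p.
have yy : 2 ^+ (aff_dim P).+1 *: p = y *+ 2.
  by rewrite exprS -scalerA scaler_nat.
have : y = 0.
  have : y *+ 2 = y.
    have : 2 ^+ (aff_dim P).+1 *: (q *+ 2) - 2 ^+ (aff_dim P).+1 *: (q *+ 2 - p) = y.
      rewrite -scalerMnr h1 h2 -/y mulrnBl -mulrnA opprB addrC addrA subrK.
      by rewrite -mulrnBr// mulr1n.
    by rewrite -scalerBr opprB subrKC yy.
  by move=> /(canRL (addrK _)); rewrite subrr.
move=> /eqP; rewrite scaler_eq0 expf_eq0 pnatr_eq0 andbF /= subr_eq0 => /eqP.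
exact.
Qed.

End LowDimension.

Section FullDimension.
Context {R : realType} {d : nat}.
Local Notation V := 'rV[R]_d.
Implicit Types (P Q : polytope R d).

Lemma aff_dim_hyperplane P h : h.1 != 0 -> P `<=` heq h -> (aff_dim P < d)%N.
Proof.
move=> h0 Ph; have [_ minU] := aff_dimP P.
pose U := lker (linfun (mulmxr (h.1)^T : 'rV[R]_d -> 'rV[R]_1)).
have UP x : (x \in U) = (dot h.1 x == 0).
  rewrite memv_ker lfunE /=.
  have -> : x *m h.1^T = (dot h.1 x)%:M.
    apply/rowP => i; rewrite !mxE ord1 eqxx mulr1n; apply: eq_bigr => j _.
    by rewrite !mxE mulrC.
  apply/eqP/eqP => [/rowP/(_ 0)|->]; last by rewrite raddf0.
  by rewrite !mxE eqxx mulr1n.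
apply: (@leq_ltn_trans (\dim U)).
  apply: minU => x y /Ph + /Ph; rewrite /heq /= /aeval => hx hy.
  by rewrite UP dotBr subr_eq0; apply/eqP; apply: (@addIr _ h.2); rewrite hx hy.
have dV : \dim {: V} = d by rewrite dimvf /dim /= mul1n.
rewrite -[ltnRHS]dV ltn_neqAle dimvS ?subvf// andbT; apply/eqP => e.
have eU : U = fullv by apply/eqP; rewrite eqEdim subvf e leqnn.
have : h.1 \in U by rewrite eU memvf.
rewrite UP /dot psumr_eq0 => [/allP h1|i _]; last by rewrite -expr2 sqr_ge0.
case/eqP: h0; apply/rowP => i; rewrite mxE.
by have := h1 i (mem_index_enum i); rewrite /= mulf_eq0 orbb => /eqP.
Qed.

(** No constraint with nonzero linear part is an equality on all of [P], which lies in no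
    hyperplane. Successive midpoints of witnesses give a point where all these constraints are
    strict, and a small cube around it satisfies them. *)
Lemma full_dim_interior P : (P : set V) !=set0 -> aff_dim P = d ->
  exists2 p : V, polytope_set P p & exists2 N : nat, (0 < N)%N &
    forall y : V, (forall i, `|y 0 i| <= 1) -> polytope_set P (p + N%:R^-1 *: y).
Proof.
move=> [x0 Px0] dP; have [s sE] := polytope_hpoly (polytopeP P).
have cP : convex_set (polytope_set P) by exact: polytope_convex (polytopeP P).
have pos h : h.1 != 0 -> h \in s -> exists2 x, polytope_set P x & 0 < aeval h x.
  move=> h0 hs; apply: contrapT => no.
  suff : (aff_dim P < d)%N by rewrite dP ltnn.
  apply: (aff_dim_hyperplane h0) => x Px.
  apply/eqP; rewrite eq_le; apply/andP; split; last by move: (Px); rewrite sE => /(_ h hs).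
  by rewrite leNgt; apply/negP => hx; apply: no; exists x.
have [p Pp pp] : exists2 p, polytope_set P p &
    forall h, h \in s -> h.1 != 0 -> 0 < aeval h p.
  have : {subset s <= s} by [].
  elim: {1 3}s => [|h r IH] rs; first by exists x0.
  have [|p Pp pr] := IH; first by move=> k kr; apply: rs; rewrite inE kr orbT.
  have hs : h \in s by apply: rs; rewrite inE eqxx.
  have [h0|h0] := eqVneq h.1 0.
    by exists p => // k; rewrite inE => /orP[/eqP->|/pr//]; rewrite h0 eqxx.
  have [x Px hx] := pos h h0 hs.
  have half1 : 2^-1 + 2^-1 = 1 :> R by lra.
  have half0 : 0 < 2^-1 :> R by rewrite invr_gt0.
  exists (2^-1 *: p + 2^-1 *: x).
    by apply: (@convex2 _ _ (polytope_set P)) => //; exact: ltW.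
  have nn k z : k \in s -> polytope_set P z -> 0 <= aeval k z.
    by move=> ks; rewrite sE; apply.
  move=> k; rewrite inE => /orP[/eqP-> _|kr k0]; rewrite aeval_conv//.
    by rewrite ltr_wpDl ?mulr_gt0// mulr_ge0 ?nn ?ltW.
  rewrite ltr_wpDr ?mulr_gt0 ?pr// mulr_ge0 ?(ltW half0)// nn//.
  by apply: rs; rewrite inE kr orbT.
exists p => //.
have [N N0 NP] : exists2 N : nat, (0 < N)%N & forall M : nat, (N <= M)%N ->
    forall h, h \in s -> forall y : V, (forall i, `|y 0 i| <= 1) ->
    0 <= aeval h (p + M%:R^-1 *: y).
  have : {subset s <= s} by [].
  elim: {1 3}s => [|h r IH] rs; first by exists 1%N.
  have [|N N0 NP] := IH; first by move=> k kr; apply: rs; rewrite inE kr orbT.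
  have hs : h \in s by apply: rs; rewrite inE eqxx.
  have [h0|h0] := eqVneq h.1 0.
    exists N => // M NM k; rewrite inE => /orP[/eqP-> y _|/NP]; last exact.
    have : 0 <= aeval h p by move: Pp; rewrite sE; apply.
    rewrite /aeval h0 /dot big1 => [|i _]; last by rewrite mxE mul0r.
    by rewrite big1// => i _; rewrite mxE mul0r.
  have hp := pp h hs h0.
  pose S := \sum_i `|h.1 0 i|.
  have S0 : 0 <= S by exact: sumr_ge0.
  have q0 : 0 <= S / aeval h p by rewrite divr_ge0// ltW.
  exists (maxn N (Num.bound (S / aeval h p))); first by rewrite leq_max N0.
  move=> M; rewrite geq_max => /andP[NM BM] k; rewrite inE => /orP[/eqP->|kr] y y1; last exact: NP.
  have SM : S <= M%:R * aeval h p.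
    rewrite -ler_pdivrMr//; apply: (le_trans (ltW (archi_boundP q0))).
    by rewrite ler_nat.
  have M0 : 0 < M%:R :> R by rewrite ltr0n (leq_trans N0).
  rewrite aevalDr dotZr -(pmulr_rge0 _ M0) mulrDr mulrA mulfV ?gt_eqF// mul1r.
  have : - S <= dot h.1 y; last by lra.
  rewrite /S -sumrN; apply: ler_sum => i _.
  have : `|h.1 0 i * y 0 i| <= `|h.1 0 i|.
    by rewrite normrM -[leRHS]mulr1 ler_wpM2l.
  by rewrite ler_norml => /andP[].
exists N => // y y1; rewrite sE => h hs; exact: NP.
Qed.

End FullDimension.

(** * Euler characteristic and volume-like valuations *)

Section EulerCharacteristic.
Context {R : realType} {d : nat}.
Local Notation V := 'rV[R]_d.

Definition chi (A : set V) : R := if `[< A = set0 >] then 0 else 1.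

Lemma chi_nonempty (A : set V) : A !=set0 -> chi A = 1.
Proof. by move=> /set0P/eqP A0; rewrite /chi asboolF. Qed.

Lemma chi0 : chi set0 = 0. Proof. by rewrite /chi asboolT. Qed.

Lemma closed_line_hpoly (s : seq (V * R)) (p v : V) :
  closed [set t : R | hpoly s (p + t *: v)].
Proof.
elim: s => [|h s IH].
  rewrite (_ : [set _ | _] = setT); first exact: closedT.
  by apply/seteqP; split.
rewrite (_ : [set _ | _] = (fun t : R => aeval h p + t * dot h.1 v) @^-1` [set x | 0 <= x] `&`
    [set t : R | hpoly s (p + t *: v)]).
  apply: closedI => //; apply: preimage_closed; last exact: closed_ge.
  move=> t _; apply: cvgD; first exact: cvg_cst.
  by apply: cvgM; [exact: cvg_id|exact: cvg_cst].
apply/seteqP; split=> t /=; rewrite hpoly_cons.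
  by move=> [hx sx]; split=> //; move: hx; rewrite /= aevalDr dotZr.
by move=> [hx sx]; split=> //; rewrite /= aevalDr dotZr.
Qed.

(** A segment from [A] to [B] stays in the convex union; being connected, it is not the union of two
    disjoint nonempty closed parts. *)
Lemma polytope_setU_meet (A B : set V) : is_polytope A -> is_polytope B ->
  is_polytope (A `|` B) -> A !=set0 -> B !=set0 -> A `&` B !=set0.
Proof.
move=> pA pB pU [p Ap] [q Bq]; apply: contrapT => no.
have [s sE] := polytope_hpoly pA; have [r rE] := polytope_hpoly pB.
pose I : set R := [set` `[0, 1]].
pose TA := [set t : R | A (p + t *: (q - p))].
pose TB := [set t : R | B (p + t *: (q - p))].
have cA : closed TA by rewrite /TA sE; exact: closed_line_hpoly.
have cB : closed TB by rewrite /TB rE; exact: closed_line_hpoly.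
have IAB t : I t -> TA t \/ TB t.
  rewrite /I /= in_itv /= => /andP[t0 t1].
  have /convex_setP cU := polytope_convex pU.
  have : (A `|` B) (t *: q + (1 - t) *: p) by apply: cU => //; [right|left].
  have -> // : t *: q + (1 - t) *: p = p + t *: (q - p).
  by apply/rowP => i; rewrite !mxE; ring.
have cI : connected I by exact: segment_connected.
have E : I `&` TA = I.
  apply: cI.
  - by exists 0; split; rewrite /I /TA /= ?in_itv /= ?lexx ?ler01// scale0r addr0.
  - exists (~` TB); first by rewrite openC.
    apply/seteqP; split=> t [It Tt]; split=> //.
      by move=> Tb; apply: no; exists (p + t *: (q - p)).
    by case: (IAB t It).
  - by exists TA.
have I1 : I 1 by rewrite /I /= in_itv /= ler01 lexx.
rewrite -E in I1; apply: no; exists q; split=> //.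
by case: I1 => _; rewrite /TA /= scale1r subrKC.
Qed.

Lemma chi_valuation (G : lmodType R) (c : G) : set_valuation (fun A => chi A *: c).
Proof.
split=> [|A B pA pB pU pI|t A pA]; first by rewrite chi0 scale0r.
  have [->|A0] := eqVneq A set0; first by rewrite set0U set0I chi0 addrC.
  have [->|B0] := eqVneq B set0; first by rewrite setU0 setI0.
  move/set0P in A0; move/set0P in B0.
  rewrite !chi_nonempty//; first exact: polytope_setU_meet.
  by case: A0 => a Aa; exists a; left.
congr (_ *: _); have [->|/set0P[a Aa]] := eqVneq A set0; first by rewrite image_set0.
by rewrite !chi_nonempty//; [exists a|exists (t + a); exists a].
Qed.

End EulerCharacteristic.

(** * Comparison of volume-like valuations by counting cells *)

Section VolumeLike.
Context {R : realType} {d : nat} {G : vectType R}.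
Local Notation V := 'rV[R]_d.
Variables (C : set G) (C_cone : convex_cone C) (C_closed : closed_in_vect C).

(** The properties shared by volume and the reduced valuation. The condition [h.1 != 0] excludes a
    degenerate [h], for which [heq h] may be the whole space. *)
Definition volume_like (Psi : set V -> G) : Prop :=
  [/\ forall P h, is_polytope P -> h.1 != 0 ->
        Psi P = Psi (P `&` hge h) + Psi (P `&` hge (- h)),
      forall t P, is_polytope P -> Psi [set t + x | x in P] = Psi P,
      forall n P, is_polytope P -> (0 < n)%N -> Psi (dil n P) = n%:R ^+ d *: Psi P,
      forall P Q, is_polytope P -> is_polytope Q -> P `<=` Q -> C (Psi Q - Psi P)
    & Psi set0 = 0].

Definition unit_cube : set V := [set x | forall i, 0 <= x 0 i <= 1].

Lemma unit_cube_polytope : is_polytope unit_cube.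
Proof.
(* The face of the cube spanned by the first [i] coordinates; each is a prism over the preceding
   one. *)
pose K (i : nat) : set V := [set x | forall j : 'I_d,
  ((j < i)%N -> 0 <= x 0 j <= 1) /\ ((i <= j)%N -> x 0 j = 0)].
suff KP i : (i <= d)%N -> is_polytope (K i).
  have := KP d (leqnn d); congr is_polytope; apply/seteqP; split=> x Kx.
    by move=> i; case: (Kx i) => + _; apply.
  by move=> j; split=> // dj; have := ltn_ord j; rewrite ltnNge dj.
elim: i => [_|i IH id].
  have := @polytope_set1 R d 0; congr is_polytope; apply/seteqP; split=> x.
    by move=> -> j; split=> // _; rewrite mxE.
  by move=> Kx; apply/rowP => j; case: (Kx j) => _; rewrite mxE; apply.
have := polytope_prism (delta_mx 0 (Ordinal id)) (IH (ltnW id)).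
congr is_polytope; apply/seteqP; split=> x.
  move=> [t /andP[t0 t1] Kx] j; have := Kx j; rewrite !mxE eqxx /=.
  have [->|ji] := eqVneq j (Ordinal id).
    rewrite mulr1 => -[_ /(_ (leqnn i))] /eqP; rewrite subr_eq0 => /eqP->.
    by split=> [_|/=]; [rewrite t0 t1|rewrite ltnn].
  have ji' : (j != i :> nat) by apply: contra ji => /eqP ji; apply/eqP/val_inj.
  rewrite mulr0 subr0 => -[h1 h2]; split=> h; [apply: h1|apply: h2]; last exact: ltnW.
  by move: h; rewrite ltnS leq_eqVlt (negbTE ji').
move=> Kx; exists (x 0 (Ordinal id)); first by case: (Kx (Ordinal id)) => + _; apply=> /=.
move=> j; have := Kx j; rewrite !mxE eqxx /=.
have [->|ji] := eqVneq j (Ordinal id).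
  by move=> _; rewrite mulr1 subrr; split=> //=; rewrite ltnn.
have ji' : (j != i :> nat) by apply: contra ji => /eqP ji; apply/eqP/val_inj.
rewrite mulr0 subr0 => -[h1 h2]; split=> h; [apply: h1|apply: h2]; first exact: ltnW.
by rewrite ltn_neqAle eq_sym ji'.
Qed.

Let cell (i : nat) (z : 'I_d -> R) : set V :=
  [set x | forall j : 'I_d, (j < i)%N -> z j <= x 0 j <= z j + 1].

Lemma delta_neq0 (i : 'I_d) : delta_mx 0 i != 0 :> V.
Proof.
apply/eqP => /rowP/(_ i); rewrite !mxE !eqxx => /eqP; exact/negP/oner_neq0.
Qed.

(* Slice along the coordinates one after the other into unit cells: a cell
   meeting P is contained in P'. *)
Lemma volume_like_cells (Psi1 Psi2 : set V -> G) (P P' : set V) : volume_like Psi1 -> volume_like Psi2 ->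
  Psi1 unit_cube = Psi2 unit_cube -> is_polytope P -> is_polytope P' ->
  (forall x y : V, P x -> (forall i, `|y 0 i - x 0 i| <= 1) -> P' y) ->
  C (Psi2 P' - Psi1 P).
Proof.
move=> [cut1 tr1 _ mono1 z1] [cut2 tr2 _ mono2 z2] eqc pP pP' PP'.
have [C0 CD _] := C_cone.
suff main m : forall i z, (i + m = d)%N -> is_polytope (P `&` cell i z) ->
    is_polytope (P' `&` cell i z) ->
    C (Psi2 (P' `&` cell i z) - Psi1 (P `&` cell i z)).
  have cT z : cell 0 z = setT by apply/seteqP; split.
  by have := main d 0%N (fun=> 0) (add0n d); rewrite cT !setIT; apply.
elim: m => [|m IH] i z im pc pc'.
  have cE : cell i z = [set (\row_j z j) + x | x in unit_cube].
    apply/seteqP; split=> [x cx|_ [x ux <-] j _]; last first.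
      by rewrite !mxE; have := ux j; lra.
    exists (x - \row_j z j); last by rewrite subrKC.
    move=> j; rewrite !mxE; have ji : (j < i)%N by have := ltn_ord j; lia.
    by have := cx j ji; lra.
  have pcell : is_polytope (cell i z).
    by rewrite cE; apply: polytope_translate; exact: unit_cube_polytope.
  have [e|/set0P[x [Px cx]]] := eqVneq (P `&` cell i z) set0.
    by rewrite e z1 -z2; apply: mono2 => //; exact: polytope_set0.
  have -> : P' `&` cell i z = cell i z.
    apply/seteqP; split=> [y []//|y cy]; split=> //; apply: (PP' x) => // j.
    have ji : (j < i)%N by have := ltn_ord j; lia.
    have := cx j ji; have := cy j ji; rewrite ler_norml.
    by move=> /andP[? ?] /andP[? ?]; apply/andP; split; lra.
  have -> : Psi2 (cell i z) = Psi1 (cell i z).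
    by rewrite cE tr1 ?tr2 ?eqc//; exact: unit_cube_polytope.
  by apply: mono1 => // y [].
have id : (i < d)%N by lia.
pose i0 := Ordinal id.
have [M1 M1P] := polytope_bounded pP; have [M2 M2P] := polytope_bounded pP'.
pose M := maxn M1 M2.
have MP x : P x -> `|x 0 i0| < M%:R.
  by move=> /(M1P x i0)/lt_le_trans; apply; rewrite ler_nat leq_maxl.
have MP' x : P' x -> `|x 0 i0| < M%:R.
  by move=> /(M2P x i0)/lt_le_trans; apply; rewrite ler_nat leq_maxr.
pose H (n : nat) : V * R := (delta_mx 0 i0, M%:R - n%:R).
have HE n : hge (H n) = [set x | - M%:R + n%:R <= x 0 i0].
  by apply/seteqP; split=> x; rewrite /hge /= /aeval /= dot_deltal; lra.
have HNE n : hge (- H n) = [set x | x 0 i0 <= - M%:R + n%:R].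
  by apply/seteqP; split=> x; rewrite /hge /= aevalN /aeval /= dot_deltal; lra.
(* Add unit layers in direction [i] one by one, starting below both polytopes; each layer is a cell
   with one more coordinate fixed, settled by the outer induction. *)
have slice (n : nat) : C (Psi2 (P' `&` cell i z `&` hge (- H n)) - Psi1 (P `&` cell i z `&` hge (- H n))).
  elim: n => [|n IHn].
    rewrite [X in Psi2 X](_ : _ = set0).
      rewrite [X in Psi1 X](_ : _ = set0); first by rewrite z1 z2 subrr.
      apply/seteqP; split=> // x [[/MP + _]]; rewrite HNE /= ltr_norml.
      by move=> /andP[h1 _]; rewrite addr0 leNgt h1.
    apply/seteqP; split=> // x [[/MP' + _]]; rewrite HNE /= ltr_norml.
    by move=> /andP[h1 _]; rewrite addr0 leNgt h1.
  have split_slice X : X `&` cell i z `&` hge (- H n.+1) `&` hge (H n) =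
      X `&` cell i.+1 (fun j => if j == i0 then - M%:R + n%:R else z j).
    apply/seteqP; split=> x; rewrite HE HNE.
      move=> [[[Xx cx] /= h1] /= h2]; split=> // j ji.
      case: ifPn => [/eqP->|ji0]; first by move: h1; rewrite -natr1; lra.
      apply: cx; rewrite ltn_neqAle -ltnS ji andbT.
      by apply: contra ji0 => /eqP ji0; apply/eqP/val_inj.
    move=> [Xx cx]; have := cx i0 (ltnSn i); rewrite eqxx => /andP[h1 h2].
    split=> //; split; last by move: h2; rewrite /= -natr1; lra.
    split=> // j ji; have := cx j (ltnW ji); case: ifPn => // /eqP e.
    by move: ji; rewrite e ltnn.
  have split_slice2 X : X `&` cell i z `&` hge (- H n.+1) `&` hge (- H n) =
      X `&` cell i z `&` hge (- H n).
    apply/seteqP; split=> x; rewrite !HNE.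
      by move=> [[[Xx cx] /= h1] /= h2].
    by move=> [[Xx cx] /= h2]; split=> //; split=> //=; rewrite -natr1; lra.
  have pS := polytope_hge (- H n.+1) pc; have pS' := polytope_hge (- H n.+1) pc'.
  rewrite (cut1 _ (H n) pS (delta_neq0 i0)) (cut2 _ (H n) pS' (delta_neq0 i0)).
  rewrite !split_slice !split_slice2 opprD addrACA; apply: CD => //.
  apply: IH; first by lia.
    by rewrite -split_slice; exact: polytope_hge.
  by rewrite -split_slice; exact: polytope_hge.
have := slice (M + M)%N.
have all_slice (X : set V) : (forall x : V, X x -> `|x 0 i0| < M%:R) ->
    X `&` cell i z `&` hge (- H (M + M)%N) = X `&` cell i z.
  move=> XM; apply/seteqP; split=> [x []//|x [Xx cx]]; split=> //.
  have := XM x Xx; rewrite HNE /= natrD ltr_norml => /andP[? ?]; lra.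
by rewrite (all_slice P MP) (all_slice P' MP').
Qed.

(** Recentre and enlarge [P] to a [Q] containing the cube of all [y] with [|y_i| <= 1]. By
    convexity, points within 1 of [k Q] in every coordinate lie in [(k + 1) Q], so the cell count
    compares [k Q] with [(k + 1) Q]; the ratio of the scales tends to 1. *)
Lemma volume_like_le (Psi1 Psi2 : set V -> G) (P : polytope R d) : (0 < d)%N ->
  volume_like Psi1 -> volume_like Psi2 ->
  Psi1 unit_cube = Psi2 unit_cube -> (P : set V) !=set0 -> aff_dim P = d ->
  C (Psi2 P - Psi1 P).
Proof.
move=> d0 v1 v2 eqc P0 dP.
have [p Pp [N N0 NP]] := full_dim_interior P0 dP.
have [_ tr1 hom1 _ z1] := v1; have [_ tr2 hom2 mono2 z2] := v2.
have [_ _ CZ] := C_cone.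
pose Q := dil N [set - p + x | x in (P : set V)].
have pP1 : is_polytope [set - p + x | x in (P : set V)].
  by apply: polytope_translate; exact: polytopeP.
have pQ : is_polytope Q by exact: polytope_dilate.
have Nn0 : N%:R != 0 :> R by rewrite pnatr_eq0 -lt0n.
have cubeQ (y : V) : (forall i, `|y 0 i| <= 1) -> Q y.
  move=> /NP Py; exists (N%:R^-1 *: y); last by rewrite scalerA mulfV ?scale1r.
  by exists (p + N%:R^-1 *: y) => //; rewrite addrA addNr add0r.
have step (k : nat) : (0 < k)%N -> C (k.+1%:R ^+ d *: Psi2 Q - k%:R ^+ d *: Psi1 Q).
  move=> k0; rewrite -hom1// -hom2//.
  apply: volume_like_cells => //; try exact: polytope_dilate.
  move=> _ y [q Qq <-] yq.
  have k1 : k.+1%:R != 0 :> R by rewrite pnatr_eq0.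
  have Qu : Q (y - k%:R *: q) by apply: cubeQ => i; have := yq i; rewrite !mxE.
  exists ((k%:R / k.+1%:R) *: q + k.+1%:R^-1 *: (y - k%:R *: q)).
    apply: (@convex2 _ _ Q) => //; first exact: polytope_convex.
    by rewrite -[X in _ + X]mul1r -mulrDl natr1 mulfV.
  by rewrite scalerDr !scalerA mulrCA mulfV// mulr1 scale1r subrKC.
suff CQ : C (Psi2 Q - Psi1 Q).
  have := CZ (N%:R ^+ d)^-1 _ _ CQ.
  rewrite /Q hom1// hom2// tr1 ?tr2; try exact: polytopeP.
  rewrite -scalerBr scalerA mulVf ?expf_neq0// scale1r; apply.
  by rewrite invr_ge0 exprn_ge0.
(* The coefficients of [Psi2 Q - (1 - x)^d Psi1 Q] as a polynomial in [x], to be taken at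
   [x = 1 / (m + 1)]. *)
pose c j := if j is 0%N then Psi2 Q - Psi1 Q else - ((-1) ^+ j *+ 'C(d, j)) *: Psi1 Q.
rewrite -[_ - _]/(c 0%N); apply: (@closed_cone_limit _ _ _ d.+1) => // m.
have -> : \sum_(j < d.+1) m.+1%:R^-1 ^+ j *: c j =
    Psi2 Q - (1 - m.+1%:R^-1) ^+ d *: Psi1 Q.
  rewrite exprBn scaler_suml big_ord_recl [X in _ - X]big_ord_recl /= !expr0 !scale1r.
  rewrite !mul1r expr1n bin0 mulr1 mulr1n scale1r opprD addrA; congr (_ + _).
  rewrite -sumrN; apply: eq_bigr => i _; rewrite expr1n mulr1 /c /= scalerA -scaleNr.
  by congr (_ *: _); rewrite mulrN mulrnAr mulrC.
(* [step] needs a positive factor; for [m = 0] the second term vanishes since [0 < d]. *)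
have [->|m0] := posnP m.
  by rewrite invr1 subrr expr0n (gtn_eqF d0) scale0r subr0 -[Psi2 Q]subr0 -z2; apply: mono2 => //; exact: polytope_set0.
have m1 : m.+1%:R != 0 :> R by rewrite pnatr_eq0.
have := CZ (m.+1%:R^-1 ^+ d) _ _ (step m m0).
rewrite scalerBr !scalerA -!exprMn mulVf// expr1n scale1r.
have -> : m.+1%:R^-1 * m%:R = 1 - m.+1%:R^-1 :> R by rewrite -natr1 in m1 *; field.
by apply; rewrite exprn_ge0// invr_ge0.
Qed.

End VolumeLike.

(** * The valuation phi - phi {0} chi is volume-like *)

Section ReducedValuation.
Context {R : realType} {d : nat} {G : vectType R}.
Local Notation V := 'rV[R]_d.
Implicit Types (P Q : polytope R d).
Variables (C : set G) (C_cone : convex_cone C) (C_pointed : pointed_cone C).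
Variable C_closed : closed_in_vect C.
Variables (phi : polytope R d -> G) (vphi : valuation phi).
Variable (mphi : weakly_hstar_monotone C phi).
Hypothesis d_gt0 : (0 < d)%N.

Let phi0 := phi origin_polytope.

Definition reduced (A : set V) : G := ext phi A - chi A *: phi0.

Lemma reduced_valuation : set_valuation reduced.
Proof.
have [e0 eU eT] := ext_valuation vphi; have [c0 cU cT] := @chi_valuation R d G phi0.
split; first by rewrite /reduced e0 c0 subrr.
  by move=> A B pA pB pU pI; rewrite /reduced addrACA -opprD eU// cU// opprD addrACA.
by move=> t A pA; rewrite /reduced eT// cT.
Qed.

Lemma reduced_low_dim P : (aff_dim P < d)%N -> reduced P = 0.
Proof.
move=> Pd; have [P0|/set0P P0] := eqVneq (P : set V) set0.
  by rewrite P0; have [-> _ _] := reduced_valuation.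
rewrite /reduced extE chi_nonempty// scale1r.
by rewrite (phi_low_dim C_cone C_pointed C_closed vphi mphi P0 Pd) subrr.
Qed.

Lemma reduced_set0 : reduced set0 = 0.
Proof. by have [] := reduced_valuation. Qed.

Lemma reduced_dil n P : (0 < n)%N -> reduced (dil n (P : set V)) = n%:R ^+ d *: reduced P.
Proof.
move=> n0; have [P0|/set0P P0] := eqVneq (P : set V) set0.
  by rewrite P0 dil_set0 reduced_set0 scaler0.
have nP0 : dil n (P : set V) !=set0 by case: P0 => x Px; exists (n%:R *: x); exists x.
have E : reduced (dil n (P : set V)) = n%:R ^+ aff_dim P *: reduced P.
  rewrite /reduced !chi_nonempty// !scale1r.
  have -> : dil n (P : set V) = polytope_set (dilate n P) by [].
  by rewrite !extE (phi_homogeneous C_cone C_pointed C_closed vphi mphi)// addrC addKr.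
rewrite E; have := aff_dim_le P; rewrite leq_eqVlt => /orP[/eqP->//|Pd].
by rewrite reduced_low_dim// !scaler0.
Qed.

(** Evaluating the expansion at [n = 0] and [n = 1] gives [h_0 = phi0] and
    [h_1 = phi X - (d + 1) phi0], so monotonicity of [h_1] is that of [phi]. *)
Lemma phi_mono P Q : P `<=` Q -> (P : set V) !=set0 -> aff_dim P = d ->
  aff_dim Q = d -> C (phi Q - phi P).
Proof.
move=> PQ P0 dP dQ; have := hstar_mono mphi PQ P0; rewrite dP dQ => /(_ 1%N erefl d_gt0).
have h1 (X : polytope R d) : (X : set V) !=set0 -> aff_dim X = d -> hstar phi 1 X = phi X - phi0 *+ d.+1.
  move=> X0 dX; have [[U dU sU] _] := aff_dimP X.
  have [h hE] := valuation_hdeg (ext_valuation vphi) (polytopeP X) sU.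
  rewrite dU dX in hE.
  have hE' n : phi (dilate n X) = hexp d h n by rewrite -hE -extE.
  rewrite (hstarE dX hE')//.
  have e0 : h 0%N = phi0.
    have -> : phi0 = phi (dilate 0 X).
      by apply: (congr1 phi); apply: polytope_inj; apply/esym; exact: dil0.
    rewrite hE' /hexp big_ord_recl add0n subn0 binn mulr1n big1 ?addr0// => i _.
    by rewrite bin_small ?mulr0n// /= /bump; have := ltn_ord i; lia.
  have e1 : phi X = hexp d h 1.
    rewrite -hE'; apply: (congr1 phi); apply: polytope_inj; apply/seteqP; split=> [x Xx|_ [x Xx <-]].
      by exists x => //; rewrite scale1r.
    by rewrite scale1r.
  rewrite e1 /hexp -e0; case: (d) d_gt0 => // d' _.
  rewrite 2!big_ord_recl big1 => [|i _]; last first.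
    by rewrite bin_small ?mulr0n// /= /bump; have := ltn_ord i; lia.
  rewrite addr0 /= (_ : 1 + d'.+1 - 0 = d'.+2)%N; last by lia.
  rewrite binSn (_ : 1 + d'.+1 - bump 0 0 = d'.+1)%N; last by rewrite /bump; lia.
  by rewrite binn mulr1n [_ + h _]addrC addrK.
have Q0 : (Q : set V) !=set0 by case: P0 => x /PQ; exists x.
by rewrite !h1// opprB addrA subrK.
Qed.

(** Comparing with the half-size copy, homogeneity turns the difference into [1 - 2^-d] times the
    value itself. *)
Lemma reduced_ge0 P : C (reduced P).
Proof.
have [C0 _ CZ] := C_cone.
have [P0|/set0P [p Pp]] := eqVneq (P : set V) set0; first by rewrite P0 reduced_set0.
have := aff_dim_le P; rewrite leq_eqVlt => /orP[/eqP dP|Pd]; last by rewrite reduced_low_dim.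
pose Q := translate (- p) P.
have Q0 : (Q : set V) 0 by exists p => //; rewrite addNr.
have dQ : aff_dim Q = d by rewrite aff_dim_translate.
have -> : reduced P = reduced Q.
  by have [_ _ T] := reduced_valuation; rewrite -(T (- p) P (polytopeP P)).
pose S := scale_polytope 2^-1 Q.
have two0 : 2%:R != 0 :> R by rewrite pnatr_eq0.
have dS : aff_dim S = d by rewrite aff_dim_scale// invr_eq0.
have SQ : S `<=` Q.
  move=> _ [x Qx <-]; have /polytope_convex/convex_setP cQ := polytopeP Q.
  have -> : 2^-1 *: x = 2^-1 *: x + (1 - 2^-1) *: 0 :> V by rewrite scaler0 addr0.
  by apply: cQ => //; rewrite ?invr_ge0// invf_le1// ler1n.
have S0 : (S : set V) !=set0 by exists 0; exists 0 => //; rewrite scaler0.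
have QS : reduced Q = 2%:R ^+ d *: reduced S.
  rewrite -reduced_dil//; congr reduced; apply/seteqP; split.
    by move=> x Qx; exists (2^-1 *: x); [exists x|rewrite scalerA mulfV ?scale1r].
  by move=> _ [_ [x Qx <-] <-]; rewrite scalerA mulfV ?scale1r.
have := phi_mono SQ S0 dS dQ.
have -> : phi Q - phi S = reduced Q - reduced S.
  rewrite /reduced !extE !chi_nonempty//; last by exists 0.
  by rewrite opprB addrA subrK.
have -> : reduced Q - reduced S = (1 - (2%:R ^+ d)^-1) *: reduced Q.
  by rewrite scalerBl scale1r {3}QS scalerA mulVf ?scale1r// expf_neq0.
have pos : 0 < 1 - (2%:R ^+ d)^-1 :> R.
  by rewrite subr_gt0 invf_lt1 ?exprn_gt0// exprn_egt1 ?ltr1n// -lt0n.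
move=> /(CZ (1 - (2%:R ^+ d)^-1)^-1); rewrite scalerA mulVf ?gt_eqF// scale1r; apply.
by rewrite invr_ge0 ltW.
Qed.

Lemma reduced_volume_like : volume_like C reduced.
Proof.
have [C0 _ _] := C_cone.
split=> [P h pP h0|t P pP|n P pP n0|P Q pP pQ PQ|].
- rewrite (valuation_cut h reduced_valuation pP).
  have -> : reduced (P `&` heq h) = 0; last by rewrite subr0.
  apply: (reduced_low_dim (P := Polytope (polytope_heq h pP))).
  by apply: (aff_dim_hyperplane h0) => x [].
- by have [_ _ ->] := reduced_valuation.
- exact: (@reduced_dil n (Polytope pP) n0).
- have [->|/set0P P0] := eqVneq P set0.
    by rewrite reduced_set0 subr0; exact: (reduced_ge0 (Polytope pQ)).
  (* [phi_mono] concerns full-dimensional polytopes. If [P] is one, so is [Q]; otherwise [P] has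
     value 0 and [reduced_ge0] suffices. *)
  have := aff_dim_le (Polytope pP); rewrite leq_eqVlt => /orP[/eqP dP|Pd].
    have dQ : aff_dim (Polytope pQ) = d.
      apply/eqP; rewrite eqn_leq aff_dim_le -{1}dP.
      apply: (@aff_dim_bij _ _ id) => //.
      by exists 1; [exact: oner_neq0|move=> x y; rewrite scale1r].
    have := @phi_mono (Polytope pP) (Polytope pQ) PQ P0 dP dQ.
    rewrite /reduced !(ext_polytopeE _ pP) !(ext_polytopeE _ pQ) !chi_nonempty//.
      by rewrite opprB addrA subrK.
    by case: P0 => x /PQ; exists x.
  have -> : reduced P = 0 by exact: (reduced_low_dim (P := Polytope pP)).
  by rewrite subr0; exact: (reduced_ge0 (Polytope pQ)).
- exact: reduced_set0.
Qed.

End ReducedValuation.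

(** * Lebesgue volume *)

Section ProductSigmaFinite.
Context d1 d2 (T1 : measurableType d1) (T2 : measurableType d2) (R : realType).
Variable m1 : {sigma_finite_measure set T1 -> \bar R}.
Variable m2 : {sigma_finite_measure set T2 -> \bar R}.

Lemma sigma_finite_product1 : sigma_finite setT (m1 \x m2)%E.
Proof.
have /sigma_finiteP[F [F_T F_nd F_oo]] := sigma_finiteT m1.
have /sigma_finiteP[E [E_T E_nd E_oo]] := sigma_finiteT m2.
exists (fun n => F n `*` E n).
  apply/seteqP; split=> // -[x y] _.
  have : (\bigcup_i F i) x by rewrite -F_T.
  have : (\bigcup_i E i) y by rewrite -E_T.
  move=> [j _ Ey] [i _ Fx]; exists (maxn i j) => //; split.
    by have /subsetPset := F_nd _ _ (leq_maxl i j); apply.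
  by have /subsetPset := E_nd _ _ (leq_maxr i j); apply.
move=> n; have [mF Foo] := F_oo n; have [mE Eoo] := E_oo n.
split; first exact: measurableX.
rewrite product_measure1E// lte_mul_pinfty// ge0_fin_numE//.
Qed.

(** Sigma-finiteness lets the product serve again as a factor in the induction on the dimension. *)
Definition product_measure_sigma_finite :
  {sigma_finite_measure set (T1 * T2)%type -> \bar R} :=
  HB.pack_for {sigma_finite_measure set (T1 * T2)%type -> \bar R} (m1 \x m2)%E
    (Measure_isSigmaFinite.Build _ _ _ (m1 \x m2)%E sigma_finite_product1).

End ProductSigmaFinite.

Section LebesgueVolume.
Context {R : realType}.

(** The volume is read on a measure space [T] through [iota]. Measurable coordinates make preimages
    of half-spaces, hence of polytopes, measurable. *)
Definition realizes d disp (T : measurableType disp) (mu : set T -> \bar R)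
    (iota : T -> 'rV[R]_d) : Prop :=
  (forall A, lebesgue_vol A = mu (iota @^-1` A)) /\
  (forall i, measurable_fun setT (fun t => iota t 0 i)).

Definition row_cons d (x : R) (y : 'rV[R]_d) : 'rV[R]_d.+1 := row_mx (x%:M : 'rV[R]_1) y.

Lemma row_cons0 d x (y : 'rV[R]_d) : row_cons x y 0 ord0 = x.
Proof.
transitivity (row_mx (x%:M : 'rV[R]_1) y 0 (lshift d 0)); last by rewrite row_mxEl mxE eqxx mulr1n.
by apply: (congr1 (fun k : 'I_(1 + d) => row_mx (x%:M : 'rV[R]_1) y 0 k)); exact: val_inj.
Qed.

Lemma row_consS d x (y : 'rV[R]_d) i : row_cons x y 0 (lift ord0 i) = y 0 i.
Proof.
transitivity (row_mx (x%:M : 'rV[R]_1) y 0 (rshift 1 i)); last exact: row_mxEr.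
by apply: (congr1 (fun k : 'I_(1 + d) => row_mx (x%:M : 'rV[R]_1) y 0 k)); exact: val_inj.
Qed.

Lemma row_consE d (z : 'rV[R]_d.+1) :
  z = row_cons (z 0 ord0) (\row_i z 0 (lift ord0 i)).
Proof.
apply/rowP => i; case: (unliftP ord0 i) => [j ->|->]; last by rewrite row_cons0.
by rewrite row_consS mxE.
Qed.

Definition section_at d (x : R) (A : set 'rV[R]_d.+1) : set 'rV[R]_d :=
  [set y : 'rV[R]_d | A (row_cons x y)].

Definition iota_cons d disp (T : measurableType disp) (iota : T -> 'rV[R]_d)
  (p : measurableTypeR R * T) : 'rV[R]_d.+1 := row_cons p.1 (iota p.2).

Lemma realizes_cons d disp (T : measurableType disp)
    (mu : {sigma_finite_measure set T -> \bar R}) (iota : T -> 'rV[R]_d) :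
  realizes mu iota -> realizes (@lebesgue_measure R \x mu)%E (iota_cons iota).
Proof.
move=> [muE miota]; split=> [A|i].
  rewrite /= /product_measure1; apply: eq_integral => x _.
  rewrite muE /=; congr (mu _); apply/seteqP; split=> t /=.
    by rewrite /xsection /= inE.
  by rewrite /xsection /= inE.
case: (unliftP ord0 i) => [j ->|->].
  rewrite (_ : (fun t => _) = (fun t => iota t 0 j) \o snd).
    by apply: measurableT_comp => //; exact: measurable_snd.
  by apply/funext => t; rewrite /iota_cons row_consS.
rewrite (_ : (fun t => _) = fst); first exact: measurable_fst.
by apply/funext => t; rewrite /iota_cons row_cons0.
Qed.

(* [lebesgue_vol] is the iterated product measure transported to row vectors;
   the measurable type depends on [d], hence the existential form. *)
Lemma volume_space d : exists disp (T : measurableType disp)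
  (mu : {sigma_finite_measure set T -> \bar R}) (iota : T -> 'rV[R]_d),
  realizes mu iota.
Proof.
elim: d => [|d [disp [T [mu [iota h]]]]].
  exists _, unit, (@dirac _ unit tt R), (fun=> 0); split=> [A|i].
    rewrite /= /dirac indicE; case: asboolP => A0.
      by rewrite mem_set.
    by rewrite memNset.
  exact: measurable_cst.
exists _, _, (product_measure_sigma_finite (@lebesgue_measure R) mu), (iota_cons iota).
exact: realizes_cons.
Qed.

Lemma measurable_hpoly d disp (T : measurableType disp) (mu : set T -> \bar R)
    (iota : T -> 'rV[R]_d) (s : seq ('rV[R]_d * R)) :
  realizes mu iota -> measurable (iota @^-1` hpoly s).
Proof.
move=> [_ miota]; elim: s => [|h s IH].
  rewrite (_ : _ @^-1` _ = setT); first exact: measurableT.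
  by apply/seteqP; split.
rewrite hpoly_cons preimage_setI; apply: measurableI => //.
have mf : measurable_fun setT (fun t => aeval h (iota t)).
  apply: measurable_funD; last exact: measurable_cst.
  by apply: measurable_sum => i; apply: measurable_funM => //; exact: measurable_cst.
have := mf measurableT _ (measurable_itv `[0, +oo[).
rewrite setTI; congr measurable; apply/seteqP; split=> t /=.
  by rewrite in_itv /= andbT.
by rewrite in_itv /= andbT.
Qed.

Lemma measurable_polytope d disp (T : measurableType disp) (mu : set T -> \bar R)
    (iota : T -> 'rV[R]_d) (P : set 'rV[R]_d) :
  realizes mu iota -> is_polytope P -> measurable (iota @^-1` P).
Proof. by move=> h /polytope_hpoly[s ->]; exact: measurable_hpoly h. Qed.

Lemma lebesgue_vol_ge0 d (A : set 'rV[R]_d) : (0 <= lebesgue_vol A)%E.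
Proof. by have [disp [T [mu [iota [-> _]]]]] := volume_space d. Qed.

Lemma lebesgue_vol0 d : lebesgue_vol (set0 : set 'rV[R]_d) = 0%E.
Proof. by have [disp [T [mu [iota [-> _]]]]] := volume_space d; rewrite preimage_set0 measure0. Qed.

Lemma lebesgue_volU d (A B : set 'rV[R]_d) : is_polytope A -> is_polytope B ->
  (lebesgue_vol (A `|` B) + lebesgue_vol (A `&` B) = lebesgue_vol A + lebesgue_vol B)%E.
Proof.
move=> pA pB; have [disp [T [mu [iota h]]]] := volume_space d.
have mA := measurable_polytope h pA; have mB := measurable_polytope h pB.
case: h => hE _; rewrite !hE preimage_setU preimage_setI.
have -> : iota @^-1` A `|` iota @^-1` B = iota @^-1` A `|` (iota @^-1` B `\` iota @^-1` A).
  apply/seteqP; split=> t [At|]; [by left| |by left|by move=> [Bt _]; right].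
  by move=> Bt; have [At|At] := pselect ((iota @^-1` A) t); [left|right].
rewrite measureU//; last 2 first.
- exact: measurableD.
- by apply/seteqP; split=> // t [At [_ /(_ At)]].
by rewrite -addeA [iota @^-1` A `&` _]setIC -(measureDI _ mB mA).
Qed.

Lemma le_lebesgue_vol d (A B : set 'rV[R]_d) : is_polytope A -> is_polytope B ->
  A `<=` B -> (lebesgue_vol A <= lebesgue_vol B)%E.
Proof.
move=> pA pB AB; have [disp [T [mu [iota h]]]] := volume_space d.
have mA := measurable_polytope h pA; have mB := measurable_polytope h pB.
case: h => hE _; rewrite !hE; apply: le_measure; rewrite ?inE//.
by move=> t; exact: AB.
Qed.

Lemma lebesgue_vol_box d (a b : R) : a <= b ->
  lebesgue_vol [set x : 'rV[R]_d | forall i, a <= x 0 i <= b] = ((b - a) ^+ d)%:E.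
Proof.
move=> ab; elim: d => [|d IH] /=.
  by rewrite asboolT ?expr0// => -[].
have E x : lebesgue_vol [set y : 'rV[R]_d | forall i,
     a <= row_cons x y 0 i <= b] =
   ((b - a) ^+ d * \1_(`[a, b]%classic) x)%:E.
  rewrite indicE; case: (boolP (x \in _)) => [|/negP]; rewrite inE /= in_itv /= => xab.
    rewrite mulr1 -IH; congr lebesgue_vol; apply/seteqP; split=> y /= hy i.
      by have := hy (lift ord0 i); rewrite row_consS.
    case: (unliftP ord0 i) => [j ->|->]; last by rewrite row_cons0.
    by rewrite row_consS.
  rewrite mulr0; transitivity (lebesgue_vol (set0 : set 'rV[R]_d)); last exact: lebesgue_vol0.
  congr lebesgue_vol; apply/seteqP; split=> y //= hy.
  by apply: xab; have := hy ord0; rewrite row_cons0.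
transitivity (\int[@lebesgue_measure R]_x (((b - a) ^+ d)%:E * (\1_(`[a, b]%classic) x)%:E))%E.
  by rewrite /=; apply: eq_integral => x _; rewrite -EFinM; exact: E.
rewrite ge0_integralZl//; last first.
  by rewrite lee_fin exprn_ge0// subr_ge0.
  by apply/measurable_EFinP.
rewrite integral_indic// setIT.
have e : lebesgue_measure (`[a, b]%classic : set R) = (b - a)%:E.
  rewrite lebesgue_measure_itv /= lte_fin.
  by move: ab; rewrite le_eqVlt => /orP[/eqP->|->]; rewrite ?ltxx ?subrr.
by rewrite [X in (_ * X)%E](_ : _ = (b - a)%:E) -?EFinM ?exprSr//; exact: e.
Qed.

Lemma lebesgue_vol_fin d (P : set 'rV[R]_d) : is_polytope P ->
  lebesgue_vol P \is a fin_num.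
Proof.
move=> pP; have [M MP] := polytope_bounded pP.
have [disp [T [mu [iota h]]]] := volume_space d.
have mP := measurable_polytope h pP.
rewrite ge0_fin_numE ?lebesgue_vol_ge0//.
have M0 : - M%:R <= M%:R :> R by rewrite ge0_cp.
have := @lebesgue_vol_box d (- M%:R) M%:R M0.
case: h => hE miota; rewrite !hE => boxE.
apply: (@le_lt_trans _ _ (mu (iota @^-1` [set x : 'rV[R]_d | forall i, - M%:R <= x 0 i <= M%:R]))); last first.
  by rewrite boxE ltry.
apply: le_measure; rewrite ?inE//.
  rewrite (_ : _ @^-1` _ = \bigcap_(i in [set: 'I_d]) ((fun t => iota t 0 i) @^-1` `[- M%:R, M%:R])).
    apply: fin_bigcap_measurable => // i _.
    by rewrite -[X in measurable X]setTI; apply: miota.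
  apply/seteqP; split=> t /= ht i; first by move=> _; rewrite /= in_itv /=; exact: ht.
  by have := ht i I; rewrite /= in_itv.
move=> t /= Pt i; have := MP _ i Pt; rewrite ltr_norml => /andP[h1 h2].
by rewrite !ltW.
Qed.

(** Pushing Lebesgue measure forward along [x |-> (x - t0) / s] and dividing by [s] gives a measure
    with the right value on half-open intervals, so it is Lebesgue measure again. *)
Lemma integral_affine (t0 s : R) (g : R -> \bar R) : 0 < s ->
  measurable_fun [set: measurableTypeR R] g -> (forall x, 0 <= g x)%E ->
  (\int[@lebesgue_measure R]_x g (((x : R) - t0) / s)%R =
   s%:E * \int[@lebesgue_measure R]_x g x)%E.
Proof.
move=> s0 mg g0.
pose f0 (x : R) : R := (x - t0) / s.
pose f : measurableTypeR R -> measurableTypeR R := f0.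
have mf : measurable_fun setT f.
  by apply: measurable_funM => //; apply: measurable_funB.
pose mfm := isMeasurableFun.Build _ _ _ _ _ mf.
pose F : {mfun measurableTypeR R >-> measurableTypeR R} := HB.pack f mfm.
have si0 : 0 <= s^-1 by rewrite invr_ge0 ltW.
pose k : {nonneg R} := NngNum si0.
pose nu1 := mscale k (pushforward (@lebesgue_measure R) F).
let t := eval cbv beta delta [nu1] in (nu1 mf) in pose nu := t.
have nuE (A : set (measurableTypeR R)) :
    measurable A -> @lebesgue_measure R A = nu A.
  apply: lebesgue_measure_unique => X [[a b] _ <-] /=.
  rewrite /nu /mscale /= /pushforward.
  have -> : F @^-1` `]a, b]%classic = `]s * a + t0, s * b + t0]%classic.
    apply/seteqP; split=> x /=; rewrite !in_itv /= /f /f0 ltr_pdivlMr// ler_pdivrMr//.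
      by move=> /andP[h1 h2]; apply/andP; split; lra.
    by move=> /andP[h1 h2]; apply/andP; split; lra.
  rewrite !lebesgue_measure_itv /= !lte_fin ltrD2r ltr_pM2l//.
  case: ifP => _; last by rewrite mule0.
  rewrite -!EFinD -EFinM; congr EFin; field; by rewrite gt_eqF.
have -> : (\int[@lebesgue_measure R]_x g x = \int[nu]_x g x)%E.
  by apply: eq_measure_integral => A mA _; exact: nuE.
rewrite /nu ge0_integral_mscale//=.
rewrite (ge0_integral_pushforward (phi := f))//.
rewrite preimage_setT muleA -EFinM mulfV ?gt_eqF// mul1e.
by [].
Qed.

Lemma section_hpoly d (x : R) (s : seq ('rV[R]_d.+1 * R)) :
  exists r, section_at x (hpoly s) = hpoly r.
Proof.
exists [seq ((\row_i h.1 0 (lift ord0 i) : 'rV[R]_d), h.1 0 ord0 * x + h.2) |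
  h : 'rV[R]_d.+1 * R <- s].
have E (h : 'rV[R]_d.+1 * R) (y : 'rV[R]_d) :
    aeval (\row_i h.1 0 (lift ord0 i) : 'rV[R]_d, h.1 0 ord0 * x + h.2) y =
    aeval h (row_cons x y).
  rewrite /aeval /dot /= big_ord_recl row_cons0 addrA; congr (_ + _).
  rewrite addrC; congr (_ + _).
  by apply: eq_bigr => i _; rewrite mxE row_consS.
apply/seteqP; split=> y hy.
  by move=> _ /mapP[h hs ->]; rewrite E; exact: hy.
by move=> h hs; rewrite -E; apply: hy; apply/mapP; exists h.
Qed.

(** Induction by sections: the section of the image at [x] is an image of the section at
    [(x - t0) / s]. The form [hpoly] is kept because it is stable under sections and gives
    measurability. *)
Lemma lebesgue_vol_affine d (s : R) (t : 'rV[R]_d) r : 0 < s ->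
  lebesgue_vol [set t + s *: x | x in hpoly r] =
  ((s ^+ d)%:E * lebesgue_vol (hpoly r))%E.
Proof.
move=> s0; elim: d t r => [|d IH] t r.
  rewrite /= expr0 mul1e; congr (if _ then _ else _); apply/asbool_equiv_eq.
  split=> [[x hx _]|h]; first by have := hx; rewrite (thinmx0 x).
  by exists 0 => //; exact: thinmx0.
have [disp [T [mu [iota h]]]] := volume_space d.
have h' := realizes_cons h.
pose g (x : R) := lebesgue_vol (section_at x (hpoly r)).
have mg : measurable_fun [set: measurableTypeR R] g.
  rewrite (_ : g = mu \o xsection (iota_cons iota @^-1` hpoly r)).
    by apply: measurable_fun_xsection; exact: measurable_hpoly h'.
  apply/funext => x; rewrite /g; case: h => -> _ /=; congr (mu _).
  by apply/seteqP; split=> y /=; rewrite /xsection /= inE.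
pose t0 : R := t 0 ord0.
pose t1 : 'rV[R]_d := \row_i t 0 (lift ord0 i).
have secE x : section_at x [set t + s *: x | x in hpoly r] =
    [set t1 + s *: y | y in section_at ((x - t0) / s) (hpoly r)].
  apply/seteqP; split=> y.
    move=> [z hz zE].
    have e0 : t0 + s * z 0 ord0 = x.
      by have := congr1 (fun u : 'rV[R]_d.+1 => u 0 ord0) zE; rewrite row_cons0 !mxE.
    exists (\row_i z 0 (lift ord0 i)).
      rewrite /section_at /= -e0 (_ : (_ - _) / s = z 0 ord0) -?row_consE//.
      by rewrite addrAC subrr add0r mulrC mulKf// gt_eqF.
    apply/rowP => i; have := congr1 (fun u : 'rV[R]_d.+1 => u 0 (lift ord0 i)) zE.
    by rewrite row_consS !mxE.
  move=> [z hz <-]; exists (row_cons ((x - t0) / s) z) => //.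
  apply/rowP => i; case: (unliftP ord0 i) => [j ->|->].
    by rewrite row_consS mxE [in LHS]mxE row_consS !mxE.
  rewrite row_cons0 mxE [X in _ + X]mxE row_cons0 mulrCA mulfV ?gt_eqF// mulr1.
  by rewrite subrKC.
transitivity (\int[@lebesgue_measure R]_x ((s ^+ d)%:E * g (((x : R) - t0) / s)%R))%E.
  apply: eq_integral => x _; rewrite -/(section_at x _) secE.
  by have [q qE] := section_hpoly ((x - t0) / s) r; rewrite /g qE; exact: IH.
rewrite ge0_integralZl//; last 3 first.
- apply: (measurableT_comp mg); apply: measurable_funM => //; exact: measurable_funB.
- by move=> x _; exact: lebesgue_vol_ge0.
- by rewrite lee_fin exprn_ge0// ltW.
rewrite integral_affine//; last by move=> x; exact: lebesgue_vol_ge0.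
by rewrite muleA -EFinM exprSr.
Qed.

End LebesgueVolume.

(** * Valuations [c1 chi + c2 vol] *)

Section Converse.
Context {R : realType} {d : nat}.
Local Notation V := 'rV[R]_d.
Implicit Types (P Q : polytope R d).

Definition volume (A : set V) : R := fine (lebesgue_vol A).

Lemma volume_ge0 (A : set V) : 0 <= volume A.
Proof. by apply: fine_ge0; exact: lebesgue_vol_ge0. Qed.

Lemma volume_set0 : volume set0 = 0.
Proof. by rewrite /volume lebesgue_vol0. Qed.

Lemma volumeU (A B : set V) : is_polytope A -> is_polytope B ->
  is_polytope (A `|` B) -> is_polytope (A `&` B) ->
  volume (A `|` B) + volume (A `&` B) = volume A + volume B.
Proof.
move=> pA pB pU pI; rewrite /volume -!fineD ?lebesgue_vol_fin//.
by rewrite lebesgue_volU.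
Qed.

Lemma volume_affine s t (A : set V) : 0 < s -> is_polytope A ->
  volume [set t + s *: x | x in A] = s ^+ d * volume A.
Proof.
move=> s0 /[dup] pA /polytope_hpoly[r rE].
rewrite /volume rE lebesgue_vol_affine// fineM// -rE.
exact: lebesgue_vol_fin.
Qed.

Lemma volume_translate t (A : set V) : is_polytope A ->
  volume [set t + x | x in A] = volume A.
Proof.
move=> pA; have := volume_affine t ltr01 pA; rewrite expr1n mul1r => <-.
by congr volume; apply: eq_imagel => x _; rewrite scale1r.
Qed.

Lemma volume_dil n (A : set V) : (0 < n)%N -> is_polytope A ->
  volume (dil n A) = n%:R ^+ d * volume A.
Proof.
move=> n0 pA; have s0 : 0 < n%:R :> R by rewrite ltr0n.
rewrite -(volume_affine 0 s0 pA).
by congr volume; apply: eq_imagel => x _; rewrite add0r.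
Qed.

Lemma le_volume (A B : set V) : is_polytope A -> is_polytope B -> A `<=` B ->
  volume A <= volume B.
Proof.
by move=> pA pB AB; rewrite fine_le ?lebesgue_vol_fin// le_lebesgue_vol.
Qed.

Lemma volume_unit_cube : volume (unit_cube : set V) = 1.
Proof.
by rewrite /volume /unit_cube lebesgue_vol_box// subr0 expr1n.
Qed.

Lemma volume_valuation (G : lmodType R) (c : G) : set_valuation (fun A => volume A *: c).
Proof.
split=> [|A B pA pB pU pI|t A pA]; first by rewrite volume_set0 scale0r.
  by rewrite -!scalerDl volumeU.
by rewrite volume_translate.
Qed.

(* A polytope P in a hyperplane has arbitrarily many disjoint translates inside
   a fixed bounded set, the prism over P. *)
Lemma volume_low_dim P : (aff_dim P < d)%N -> volume P = 0.
Proof.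
move=> Pd; have [[U dU sU] _] := aff_dimP P.
have [w wU] : exists w, w \notin U by apply: notin_of_dim; rewrite dU.
have pP := polytopeP P.
pose Q := prism P w; have pQ : is_polytope Q by exact: polytope_prism.
have [disp [T [mu [iota h]]]] := volume_space (R := R) d.
have bound (n : nat) : n%:R * volume P <= volume Q.
  case: n => [|n]; first by rewrite mul0r volume_ge0.
  pose F (i : 'I_n.+1) := [set (i%:R / n.+1%:R) *: w + x | x in (P : set V)].
  have pF i : is_polytope (F i) by exact: polytope_translate.
  have mF i : measurable (iota @^-1` F i) by exact: measurable_polytope h (pF i).
  have tF : trivIset setT (fun i => iota @^-1` F i).
    apply/trivIsetP => i j _ _ ij; apply/seteqP; split=> // t [[x Px xE] [y Py yE]].
    have := sU _ _ Px Py.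
    have -> : x - y = ((j%:R - i%:R) / n.+1%:R) *: w.
      have -> : x = iota t - (i%:R / n.+1%:R) *: w by rewrite -xE addrAC subrr add0r.
      have -> : y = iota t - (j%:R / n.+1%:R) *: w by rewrite -yE addrAC subrr add0r.
      by apply/rowP => l; rewrite !mxE; ring.
    have c0 : (j%:R - i%:R) / n.+1%:R != 0 :> R.
      rewrite mulf_neq0 ?invr_eq0 ?pnatr_eq0// subr_eq0 eqr_nat.
      by rewrite eq_sym; exact: ij.
    move=> /(memvZ ((j%:R - i%:R) / n.+1%:R)^-1).
    by rewrite scalerA mulVf// scale1r (negbTE wU).
  have mQ : measurable (iota @^-1` Q) by exact: measurable_polytope h pQ.
  have sub : \big[setU/set0]_(i < n.+1) (iota @^-1` F i) `<=` iota @^-1` Q.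
    move=> t; rewrite -bigcup_mkord_ord => -[k kn [x Px xE]].
    exists ((inord k : 'I_n.+1)%:R / n.+1%:R).
      by rewrite divr_ge0//= ler_pdivrMr ?ltr0n// mul1r ler_nat ltnW.
    by rewrite -xE addrC addKr.
  have : (mu (\big[setU/set0]_(i < n.+1) (iota @^-1` F i)) <= mu (iota @^-1` Q))%E.
    by apply: le_measure; rewrite ?inE//; exact: bigsetU_measurable.
  rewrite measure_bigsetU_ord//; case: h => hE _.
  have eF i : mu (iota @^-1` F i) = (volume P)%:E.
    rewrite -hE -(volume_translate ((i%:R / n.+1%:R) *: w) pP).
    by rewrite /volume fineK//; exact: lebesgue_vol_fin (pF i).
  have eQ : mu (iota @^-1` Q) = (volume Q)%:E.
    by rewrite -hE /volume fineK//; exact: lebesgue_vol_fin.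
  rewrite (eq_bigr (fun=> (volume P)%:E)); last by move=> i _; exact: eF.
  rewrite [X in (_ <= X)%E](_ : _ = (volume Q)%:E); last exact: eQ.
  by rewrite sumEFin lee_fin sumr_const card_ord -[volume P *+ _]mulr_natl.
apply/eqP; rewrite eq_le volume_ge0 andbT leNgt; apply/negP => v0.
have := archi_boundP (divr_ge0 (volume_ge0 Q) (ltW v0)).
by rewrite ltr_pdivrMr// ltNge bound.
Qed.

Lemma volume_volume_like (G : vectType R) (C : set G) (c : G) : convex_cone C -> C c ->
  volume_like C (fun A => volume A *: c).
Proof.
move=> [C0 _ CZ] Cc; split=> [P h pP h0|t P pP|n P pP n0|P Q pP pQ PQ|].
- rewrite (valuation_cut h (volume_valuation c) pP).
  have -> : volume (P `&` heq h) = 0; last by rewrite scale0r subr0.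
  apply: (@volume_low_dim (Polytope (polytope_heq h pP))).
  by apply: (aff_dim_hyperplane h0) => x [].
- by rewrite volume_translate.
- by rewrite volume_dil// scalerA.
- by rewrite -scalerBl; apply: CZ => //; rewrite subr_ge0 le_volume.
- by rewrite volume_set0 scale0r.
Qed.

Section ChiVol.
Variables (G : vectType R) (C : set G) (C_cone : convex_cone C).
Variables (c1 c2 : G) (C1 : C c1) (C2 : C c2).
Variable phi : polytope R d -> G.
Hypothesis phiE : forall P, phi P = euler_char P *: c1 + vol P *: c2.

Lemma chi_vol_valuation : valuation phi.
Proof.
have [chi_0 chiU chiT] := @chi_valuation R d G c1.
have [vol0 volU volT] := volume_valuation c2.
split=> [|P Q U I UE IE|t P].
- by rewrite phiE -[euler_char _]/(chi set0) -[vol _]/(volume set0) chi_0 vol0 addr0.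
- rewrite !phiE -![euler_char _]/(chi _) -![vol _]/(volume _).
  have pU := polytopeP U; have pI := polytopeP I; rewrite UE in pU; rewrite IE in pI.
  rewrite UE IE addrACA chiU ?volU//; try exact: polytopeP.
  by rewrite addrACA.
- rewrite !phiE -![euler_char _]/(chi _) -![vol _]/(volume _) /=.
  by rewrite chiT ?volT//; exact: polytopeP.
Qed.

Lemma dil_chi n P : (P : set V) !=set0 -> euler_char (dilate n P) = 1.
Proof.
by move=> [x Px]; apply: (@chi_nonempty _ _ (dil n P)); exists (n%:R *: x); exists x.
Qed.

Lemma const_hexp (r : nat) : exists k : nat -> R, forall n : nat, 1 = hexp r k n.
Proof.
have [k kE] := hdegW (leq0n r) (hdeg_const (1 : R)).
by exists k => n; rewrite -kE.
Qed.

(** Below full dimension the volume vanishes and the vector depends on the dimension only. In full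
    dimension the difference is [e_i (volume Q - volume P) c2], with a nonnegative Eulerian number
    [e_i]. *)
Lemma chi_vol_monotone : weakly_hstar_monotone C phi.
Proof.
have [C0 CD CZ] := C_cone.
split.
  rewrite /cone_le subr0 phiE; apply: CD; apply: CZ => //.
    by rewrite /euler_char; case: ifP.
  exact: volume_ge0.
move=> i P Q id PQ; rewrite /pdim.
case: asboolP => P0; case: asboolP => Q0 //.
- by move=> _; have -> : P = Q; [apply: polytope_inj; rewrite P0 Q0|rewrite /cone_le subrr].
move=> [dPQ]; move/eqP/set0P in P0; move/eqP/set0P in Q0.
(* Above the common dimension both entries are 0 by the failure of [insub]. *)
have [ir|ri] := leqP i (aff_dim P); last first.
  by rewrite /cone_le /hstar !insubF ?subrr// ?ltnS leqNgt -?dPQ ri.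
have [k kE] := const_hexp (aff_dim P).
have := aff_dim_le P; rewrite leq_eqVlt => /orP[/eqP dP|Pd]; last first.
  have hX (X : polytope R d) : (X : set V) !=set0 -> aff_dim X = aff_dim P ->
      hstar phi i X = k i *: c1.
    move=> X0 dX; rewrite (hstarE dX (h := fun j => k j *: c1))// => n.
    have dnX : (aff_dim (dilate n X) < d)%N.
      apply: leq_ltn_trans Pd; rewrite -dX; have [[U <- sU] _] := aff_dimP X.
      have [_] := aff_dimP (dilate n X); apply=> _ _ [x Xx <-] [y Xy <-].
      by rewrite -scalerBr memvZ ?sU.
    rewrite phiE dil_chi// -[vol _]/(volume _) volume_low_dim// scale0r addr0.
    rewrite (kE n) /hexp scaler_suml; apply: eq_bigr => j _.
    by rewrite scalerMnl.
  by rewrite /cone_le !hX// subrr.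
have [e e0 eE] := @power_hexp R d.
have hX (X : polytope R d) : (X : set V) !=set0 -> aff_dim X = aff_dim P ->
    hstar phi i X = k i *: c1 + (e i * volume X) *: c2.
  move=> X0 dX; rewrite (hstarE dX (h := fun j => k j *: c1 + (e j * volume X) *: c2))// => n.
  rewrite phiE dil_chi// -[vol _]/(volume _).
  (* At [n = 0] the dilate is [{0}], of volume 0 if [0 < d]. For [d = 0] the factor [0^0] is 1, and
     [X] is already the only point. *)
  have -> : volume (dilate n X) = n%:R ^+ d * volume X.
    case: n => [|n]; last by rewrite (@volume_dil n.+1)//; exact: polytopeP.
    rewrite -[polytope_set _]/(dil 0 X) dil0// expr0n.
    have [d0|d0] := eqVneq d 0%N; last first.
      rewrite mul0r; apply: (@volume_low_dim origin_polytope).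
      apply: (@leq_ltn_trans 0%N); last by rewrite lt0n.
      have [_] := aff_dimP (@origin_polytope R d) => /(_ 0%VS); rewrite dimv0; apply.
      by move=> x y -> ->; rewrite subrr mem0v.
    rewrite mul1r; congr volume; apply/seteqP; split=> x.
      move=> ->; case: X0 => y Xy; rewrite (_ : 0 = y)//.
      by apply/rowP => j; have := ltn_ord j; rewrite {2}d0.
    by move=> _; apply/rowP => j; have := ltn_ord j; rewrite {2}d0.
  rewrite (eE n) (kE n) dP /hexp mulr_suml !scaler_suml -big_split; apply: eq_bigr => j _ /=.
  by rewrite mulrnAl mulrnDl !scalerMnl.
rewrite /cone_le !hX// opprD addrACA subrr add0r -scalerBl -mulrBr; apply: CZ => //.
rewrite mulr_ge0// subr_ge0; apply: le_volume => //; exact: polytopeP.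
Qed.

End ChiVol.
End Converse.

(** * The classification and the isomorphism of cones *)

Theorem theorem6p6 (R : realType) (d : nat) (G : vectType R) (C : set G)
    (C_cone : convex_cone C) (C_pointed : pointed_cone C)
    (C_closed : closed_in_vect C) :
  (forall phi : polytope R d -> G,
     weakly_hstar_monotone_valuations d C phi <->
     exists c1 c2 : G, [/\ C c1, C c2 &
       forall P, phi P = euler_char P *: c1 + vol P *: c2])
  /\ ((0 < d)%N ->
      cone_isomorphism (C `*` C) (weakly_hstar_monotone_valuations d C)
        (chi_vol d)).
Proof.
have [C0 CD CZ] := C_cone.
have main (phi : polytope R d -> G) :
     weakly_hstar_monotone_valuations d C phi <->
     exists c1 c2 : G, [/\ C c1, C c2 &
       forall P, phi P = euler_char P *: c1 + vol P *: c2].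
  split=> [[vphi mphi]|[c1 [c2 [C1 C2 phiE]]]]; last first.
    split; first exact: chi_vol_valuation phiE.
    exact: chi_vol_monotone phiE.
  pose c1 := phi origin_polytope.
  have C1 : C c1 by case: mphi; rewrite /cone_le subr0.
  (* In dimension 0 the only polytopes are the empty set and the point, so [phi = c1 chi]. *)
  have [d0|d_gt0] := posnP d.
    exists c1, 0; split=> // P; rewrite scaler0 addr0 -[euler_char P]/(chi P).
    have [P0|/set0P[x Px]] := eqVneq (P : set 'rV[R]_d) set0.
      rewrite P0 chi0 scale0r; have [<- _ _] := vphi.
      by apply: (congr1 phi); exact: polytope_inj.
    rewrite chi_nonempty ?scale1r; last by exists x.
    apply: (congr1 phi); apply: polytope_inj; apply/seteqP; split=> y /=.
      by move=> _; apply/rowP => j; have := ltn_ord j; rewrite {2}d0.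
    move=> ->; rewrite (_ : 0 = x)//.
    by apply/rowP => j; have := ltn_ord j; rewrite {2}d0.
  pose psi := reduced phi; pose c2 := psi unit_cube.
  have vl1 : volume_like C psi := reduced_volume_like C_cone C_pointed C_closed vphi mphi d_gt0.
  have C2 : C c2.
    have [_ _ _ mono psi0] := vl1; rewrite -[c2]subr0 -psi0.
    by apply: mono => //; [exact: polytope_set0|exact: unit_cube_polytope].
  have vl2 := @volume_volume_like R d G C c2 C_cone C2.
  exists c1, c2; split=> // P.
  suff e : psi P = volume P *: c2.
    by rewrite -[euler_char P]/(chi P) -[vol P]/(volume P) -e /psi /reduced extE addrC subrK.
  have [P0|/set0P P0] := eqVneq (P : set 'rV[R]_d) set0.
    by rewrite P0 volume_set0 scale0r; case: vl1.
  have := aff_dim_le P; rewrite leq_eqVlt => /orP[/eqP dP|Pd]; last first.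
    by rewrite volume_low_dim// scale0r; exact: (reduced_low_dim C_cone C_pointed C_closed vphi mphi).
  have cube_eq : psi unit_cube = volume (unit_cube : set 'rV[R]_d) *: c2.
    by rewrite volume_unit_cube scale1r.
  (* The comparison is symmetric in the two valuations, so the difference and its opposite both lie
     in the pointed cone. *)
  have le1 := volume_like_le C_cone C_closed d_gt0 vl1 vl2 cube_eq P0 dP.
  have le2 := volume_like_le C_cone C_closed d_gt0 vl2 vl1 (esym cube_eq) P0 dP.
  apply/eqP; rewrite eq_sym -subr_eq0; apply/eqP; apply: C_pointed => //.
  by rewrite opprB.
split=> // d_gt0.
have chi_volE c : chi_vol d c = (fun P => euler_char P *: c.1 + vol P *: c.2) by [].
have chi1 : euler_char (@origin_polytope R d) = 1.
  by apply: (@chi_nonempty R d [set 0]); exists 0.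
have vol0 : vol (@origin_polytope R d) = 0.
  apply: (@volume_low_dim R d origin_polytope).
  apply: (@leq_ltn_trans 0%N) => //.
  have [_] := aff_dimP (@origin_polytope R d) => /(_ 0%VS); rewrite dimv0; apply.
  by move=> x y -> ->; rewrite subrr mem0v.
pose cube := Polytope (@unit_cube_polytope R d).
have chi_cube : euler_char cube = 1.
  by apply: (@chi_nonempty R d unit_cube); exists 0 => i; rewrite mxE lexx ler01.
have vol_cube : vol cube = 1 by exact: volume_unit_cube.
split.
- split; first by split.
    by move=> x y [? ?] [? ?]; split; exact: CD.
  by move=> a x a0 [? ?]; split; exact: CZ.
- split.
  + apply/main; exists 0, 0; split=> // P; by rewrite !scaler0 addr0.
  + move=> f g /main[a1 [a2 [A1 A2 fE]]] /main[b1 [b2 [B1 B2 gE]]]; apply/main.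
    exists (a1 + b1), (a2 + b2); split; [exact: CD|exact: CD|move=> P].
    by rewrite -[(f + g) P]/(f P + g P) fE gE !scalerDr addrACA.
  + move=> a f a0 /main[a1 [a2 [A1 A2 fE]]]; apply/main.
    exists (a *: a1), (a *: a2); split; [exact: CZ|exact: CZ|move=> P].
    by rewrite -[(a *: f) P]/(a *: f P) fE scalerDr !scalerA ![a * _]mulrC.
- split.
  + by move=> c [A1 A2]; apply/main; exists c.1, c.2.
  (* The value at the origin recovers [c1], as a point has volume 0 for [0 < d]; the value at the
     unit cube is [c1 + c2]. *)
  + move=> a b _ _ ab; have := congr1 (fun f => f origin_polytope) ab.
    rewrite !chi_volE chi1 vol0 !scale1r !scale0r !addr0 => e1.
    have := congr1 (fun f => f cube) ab.
    rewrite !chi_volE chi_cube vol_cube !scale1r e1 => /addrI e2.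
    by rewrite [a]surjective_pairing [b]surjective_pairing e1 e2.
  + move=> phi /main[c1 [c2 [A1 A2 phiE]]]; exists (c1, c2) => //.
    by apply/funext => P; rewrite phiE.
- move=> x y _ _; apply/funext => P.
  rewrite -[RHS]/(chi_vol d x P + chi_vol d y P) /chi_vol /= !scalerDr addrACA//.
- move=> a x _ _; apply/funext => P.
  rewrite -[RHS]/(a *: chi_vol d x P) /chi_vol /= scalerDr !scalerA ![a * _]mulrC//.
Qed.
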